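(* Let $E$ be an elliptic curve with origin $\mathcal O$ over a number field $k$, let $p$ be an odd prime, let $v$ be a finite place of $k$ and let $K$ be a finite extension of $k_v$. Let $P\in E[p](K)$ and $Q\in E[p](\overline K)$ be such that $P$ and $Q$ generate $E[p](\overline K)$. Let $[\xi]\in\mathrm{H}^1(K,E[p])$ and let $\alpha\in R_K^\times$, $\rho\in(R_K\otimes_K R_K)^\times$ be compatible representatives for $[\xi]$ (see context). Then, computing in $\overline{R_K}$ with the multiplication $*=*_\rho$, $$\Delta_{P,Q}^{*p}=\sum_{\substack{i_1,\ldots,i_p\in\mathbb Z/p\mathbb Z\\ p\mid\sum_\ell i_\ell}} e_p(Q,P)^{\sum_{\ell=1}^p\ell\, i_\ell}\left(\prod_{j=1}^{p-1}\rho\Big(jQ+\sum_{\ell=1}^j i_\ell P,\; Q+i_{j+1}P\Big)\right)\delta_{\mathcal O},$$ where $\Delta_{P,Q}=\delta_Q+\delta_{Q+P}+\cdots+\delta_{Q+(p-1)P}$ and $\Delta_{P,Q}^{*p}$ is its $p$-fold $*$-product with itself.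
   Context: $e_p$ is the Weil pairing on $E[p](\overline K)$ with values in $\mu_p$, and $\varepsilon_p(S,T):=e_p(S,T)^{(p+1)/2}$ is the unique square root of $e_p(S,T)$ in $\mu_p$. $\overline{R_K}$ is the set of all maps $E[p](\overline K)\to\overline K$ with $G_K=\mathrm{Gal}(\overline K/K)$ acting by $(\sigma f)(S)=\sigma(f(\sigma^{-1}S))$; $R_K$ is the set of $G_K$-invariant maps. Elements of $\overline{R_K}\otimes\overline{R_K}$ are maps $E[p](\overline K)^2\to\overline K$, $R_K\otimes_K R_K$ the $G_K$-invariant ones. $w(S):=e_p(S,-)\in\overline{R_K}^\times$ and $(\partial\gamma)(T_1,T_2):=\gamma(T_1)\gamma(T_2)/\gamma(T_1+T_2)$. For $[\xi]$ represented by a cocycle $\xi$, $\alpha,\rho$ are compatible representatives if there is $\gamma\in\overline{R_K}^\times$ with $w(\xi(\sigma))=\sigma(\gamma)/\gamma$ for all $\sigma\in G_K$, $\gamma(\mathcal O)=1$, $\gamma^p=\alpha$, $\partial\gamma=\rho$. $\delta_T$ is the indicator function of $T\in E[p](\overline K)$. The multiplication is $(f*_\rho g)(T)=\sum_{T_1+T_2=T}\varepsilon_p(T_1,T_2)\rho(T_1,T_2)f(T_1)g(T_2)$ over $T_1,T_2\in E[p](\overline K)$. *)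

(* Defs.v *)
From HB Require Import structures.
From mathcomp Require Import all_boot all_order all_algebra all_field.
From mathcomp Require Import qpoly.
From mathcomp Require Import boolp classical_sets fsbigop.
From mathcomp Require Import ring.

Set Implicit Arguments.
Unset Strict Implicit.
Unset Printing Implicit Defensive.

Import Order.TTheory GRing.Theory Num.Theory.
Local Open Scope ring_scope.

(* A finite place of a number field is given by its normalised discrete
   valuation.  The value at 0 (morally +oo) is irrelevant. *)
Record discrete_valuation (F : fieldType) (v : F -> int) : Prop := {
  val_mul : forall x y, x != 0 -> y != 0 -> v (x * y) = v x + v y;
  val_add : forall x y, x != 0 -> y != 0 -> x + y != 0 ->
    Num.min (v x) (v y) <= v (x + y);
  val_uniformizer : exists2 x, x != 0 & v x = 1
}.

Definition val_close (F : fieldType) (v : F -> int) (n : int) (x y : F) : Prop :=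
  x = y \/ n <= v (x - y).

Definition val_complete (F : fieldType) (v : F -> int) : Prop :=
  forall u : nat -> F,
    (forall n : int, exists N : nat, forall i j : nat,
       (N <= i)%N -> (N <= j)%N -> val_close v n (u i) (u j)) ->
    exists l : F, forall n : int, exists N : nat, forall i : nat,
       (N <= i)%N -> val_close v n (u i) l.

Record is_completion (k : fieldType) (v : k -> int)
    (kv : fieldType) (vhat : kv -> int) (iota : {rmorphism k -> kv}) : Prop := {
  compl_valuation : discrete_valuation vhat;
  compl_extends : forall x, x != 0 -> vhat (iota x) = v x;
  compl_dense : forall (y : kv) (n : int), exists x, val_close vhat n y (iota x);
  compl_complete : val_complete vhat
}.

(* y^2 + a1 x y + a3 y = x^3 + a2 x^2 + a4 x + a6 *)
Record weierstrass (F : Type) :=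
  Weierstrass { a1 : F; a2 : F; a3 : F; a4 : F; a6 : F }.

Definition map_curve (F F' : Type) (f : F -> F') (E : weierstrass F) :=
  Weierstrass (f (a1 E)) (f (a2 E)) (f (a3 E)) (f (a4 E)) (f (a6 E)).

Definition discriminant (F : fieldType) (E : weierstrass F) : F :=
  let b2 := a1 E ^+ 2 + 4 * a2 E in
  let b4 := 2 * a4 E + a1 E * a3 E in
  let b6 := a3 E ^+ 2 + 4 * a6 E in
  let b8 := a1 E ^+ 2 * a6 E + 4 * a2 E * a6 E - a1 E * a3 E * a4 E
            + a2 E * a3 E ^+ 2 - a4 E ^+ 2 in
  - b2 ^+ 2 * b8 - 8 * b4 ^+ 3 - 27 * b6 ^+ 2 + 9 * b2 * b4 * b6.

Definition elliptic (F : fieldType) (E : weierstrass F) : bool :=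
  discriminant E != 0.

Section Points.
Variables (F : fieldType) (E : weierstrass F).

(* [None] is the point at infinity. *)
Definition on_curve (T : option (F * F)) : bool :=
  if T is Some (x, y) then
    y ^+ 2 + a1 E * x * y + a3 E * y == x ^+ 3 + a2 E * x ^+ 2 + a4 E * x + a6 E
  else true.

Record point := Point { coords :> option (F * F); coordsP : on_curve coords }.

HB.instance Definition _ := [isSub for coords].
HB.instance Definition _ := [Choice of point by <:].

Definition pzero : point := @Point None isT.

(* Chord-and-tangent addition: the line through the two points has slope l. *)
Definition add_coords (S T : option (F * F)) : option (F * F) :=
  match S, T with
  | None, _ => T
  | _, None => S
  | Some (x1, y1), Some (x2, y2) =>
    if (x1 == x2) && (y2 == - y1 - a1 E * x1 - a3 E) then None else
    let l := if x1 == x2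
             then (3 * x1 ^+ 2 + 2 * a2 E * x1 + a4 E - a1 E * y1)
                  / (2 * y1 + a1 E * x1 + a3 E)
             else (y2 - y1) / (x2 - x1) in
    let x3 := l ^+ 2 + a1 E * l - a2 E - x1 - x2 in
    Some (x3, - (l * (x3 - x1) + y1) - a1 E * x3 - a3 E)
  end.

Lemma add_coordsP S T :
  on_curve S -> on_curve T -> on_curve (add_coords S T).
Proof.
pose w x y := y ^+ 2 + a1 E * x * y + a3 E * y
              - (x ^+ 3 + a2 E * x ^+ 2 + a4 E * x + a6 E).
have wE x y : on_curve (Some (x, y)) = (w x y == 0) by rewrite subr_eq0.
case: S T => [[x1 y1]|] [[x2 y2]|] //; rewrite !wE => /eqP e1 /eqP e2.
rewrite /add_coords; case: ifP => // nopp.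
case: eqP => [exx | /eqP nxx]; last first.
  have {}nxx : x2 - x1 != 0 by rewrite subr_eq0 eq_sym.
  set l := (y2 - y1) / (x2 - x1).
  have el : y2 = l * (x2 - x1) + y1 by rewrite /l divfK // subrK.
  rewrite wE; set x3 := _ - x2; apply/eqP/(mulfI nxx); rewrite mulr0.
  transitivity ((x2 - x3) * w x1 y1 + (x3 - x1) * w x2 y2).
    by rewrite el /w /x3; ring.
  by rewrite e1 e2 !mulr0 addr0.
subst x2; have eyy : y2 = y1.
  have : (y2 - y1) * (y2 + y1 + a1 E * x1 + a3 E) = 0.
    by transitivity (w x1 y2 - w x1 y1); [rewrite /w; ring | rewrite e1 e2 subrr].
  move/eqP; rewrite mulf_eq0 subr_eq0 => /orP[/eqP // | /eqP h].
  move: nopp; rewrite eqxx /= => /eqP []; apply/eqP; rewrite -subr_eq0.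
  by apply/eqP; rewrite -h; ring.
subst y2; have nd : 2 * y1 + a1 E * x1 + a3 E != 0.
  apply: contraFneq nopp => h; rewrite eqxx /= -subr_eq0.
  by apply/eqP; rewrite -h; ring.
set l := _ / (2 * y1 + _ + _).
have el : l * (2 * y1 + a1 E * x1 + a3 E)
  - (3 * x1 ^+ 2 + 2 * a2 E * x1 + a4 E - a1 E * y1) = 0.
  by rewrite /l divfK // subrr.
rewrite wE; set x3 := _ - x1; apply/eqP.
transitivity (w x1 y1 + (x3 - x1) *
  (l * (2 * y1 + a1 E * x1 + a3 E)
   - (3 * x1 ^+ 2 + 2 * a2 E * x1 + a4 E - a1 E * y1))).
  by rewrite /w /x3; ring.
by rewrite e1 el mulr0 addr0.
Qed.

Definition padd (S T : point) : point :=
  Point (add_coordsP (coordsP S) (coordsP T)).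

Definition pmul (n : nat) (T : point) : point := iter n (padd T) pzero.

Definition torsion (n : nat) (T : point) : bool := pmul n T == pzero.

End Points.

Arguments pzero {F} E.

Declare Scope curve_scope.
Delimit Scope curve_scope with EC.
Notation "S + T" := (padd S T) : curve_scope.
Notation "n * T" := (pmul n T) : curve_scope.

Section MapPoint.
Variables (F F' : fieldType) (f : {rmorphism F -> F'}) (E : weierstrass F).

Definition map_coords (T : option (F * F)) : option (F' * F') :=
  omap (fun c => (f c.1, f c.2)) T.

Lemma map_coordsP T : on_curve E T -> on_curve (map_curve f E) (map_coords T).
Proof.
case: T => [[x y]|] //= /eqP e; rewrite -!(rmorphM, rmorphXn, rmorphD) /=.
by rewrite e.
Qed.

Definition map_point (T : point E) : point (map_curve f E) :=
  Point (map_coordsP (coordsP T)).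

End MapPoint.

Section Functions.
Variables (F : fieldType) (E : weierstrass F).

(* Polynomials in y over F[x]. *)
Definition weierstrass_poly : {poly {poly F}} :=
  'X ^+ 2 + (a1 E *: 'X + (a3 E)%:P) *: 'X
  - ('X ^+ 3 + a2 E *: 'X ^+ 2 + a4 E *: 'X + (a6 E)%:P)%:P.

Lemma mk_monic_weierstrass_poly : mk_monic weierstrass_poly = weierstrass_poly.
Proof.
rewrite /weierstrass_poly -addrA; set r := (X in 'X ^+ 2 + X).
have sr : (size r < size ('X ^+ 2 : {poly {poly F}}))%N.
  rewrite size_polyXn ltnS (leq_trans (size_polyD _ _)) // geq_max size_polyN.
  rewrite (leq_trans (size_scale_leq _ _)) ?size_polyX //.
  by rewrite (leq_trans (size_polyC_leq1 _)).
rewrite /mk_monic size_polyDl // size_polyXn /= monicE lead_coefDl //.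
by rewrite lead_coefXn eqxx.
Qed.

(* The modulus is monic of degree 2 in y, so this is the affine coordinate
   ring F[x, y] / (W): every element is uniquely u`_0 + u`_1 * y. *)
Definition coord_ring := {poly %/ weierstrass_poly}.

Definition reg_eval (u : coord_ring) (x y : F) : F :=
  (u : {poly {poly F}}).[y%:P].[x].

(* u lies in the n-th power of the maximal ideal (x - x0, y - y0) *)
Definition in_ideal_pow (x0 y0 : F) (n : nat) (u : coord_ring) : Prop :=
  exists c : 'I_n.+1 -> coord_ring,
    u = \sum_(i < n.+1)
          c i * in_qpoly weierstrass_poly ('X - x0%:P)%:P ^+ i
              * in_qpoly weierstrass_poly ('X - y0%:P%:P) ^+ (n - i).

(* x and y have poles of order 2 and 3 at the origin; the orders of A(x) and
   B(x) y have different parities, so there is no cancellation. *)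
Definition pole_order (u : coord_ring) : nat :=
  let A : {poly F} := (u : {poly {poly F}})`_0 in
  let B : {poly F} := (u : {poly {poly F}})`_1 in
  maxn (size A).-1.*2 (if B == 0 then 0 else (size B).-1.*2 + 3).

Definition reg_order (u : coord_ring) (T : point E) (n : int) : Prop :=
  if coords T is Some (x0, y0) then
    exists m : nat, [/\ n = m%:Z, in_ideal_pow x0 y0 m u
                      & ~ in_ideal_pow x0 y0 m.+1 u]
  else u != 0 /\ n = - (pole_order u)%:Z.

Record ratfun := RatFun { rat_num : coord_ring; rat_den : coord_ring; rat_den_neq0 : rat_den != 0 }.

(* Junk at the origin and where [rat_den] vanishes, that is at finitely many
   points; only used up to finitely many points. *)
Definition rat_eval (f : ratfun) (T : point E) : F :=
  if coords T is Some (x, y) then reg_eval (rat_num f) x y / reg_eval (rat_den f) x y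
  else 0.

Definition rat_order (f : ratfun) (T : point E) (n : int) : Prop :=
  exists a b : int,
    [/\ reg_order (rat_num f) T a, reg_order (rat_den f) T b & n = a - b].

Definition has_divisor (f : ratfun) (D : point E -> int) : Prop :=
  forall T, rat_order f T (D T).

Definition for_almost_all (A : point E -> Prop) : Prop :=
  exists s : seq (point E), forall X, X \notin s -> A X.

(* Over an algebraically closed field: e(S, T) = g(X + S) / g(X), where
   g^n = f o [n] and div f = n (T) - n (O). *)
Definition weil_pairing (n : nat) (e : point E -> point E -> F) : Prop :=
  forall S T, torsion n S -> torsion n T -> exists f g : ratfun,
    [/\ has_divisor f (fun X => n%:Z *+ (X == T) - n%:Z *+ (X == pzero E)),
        for_almost_all (fun X => rat_eval f (n * X)%EC = rat_eval g X ^+ n)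
      & for_almost_all (fun X => rat_eval g (X + S)%EC = e S T * rat_eval g X)].

End Functions.

(* L is an algebraic closure of the perfect field K, embedded by j. *)
Section Galois.
Variables (K L : fieldType) (j : {rmorphism K -> L}).

Definition is_algebraic_closure : Prop :=
  GRing.closed_field_axiom L /\ forall z : L, algebraicOver j z.

Record absgal := Absgal {
  absgal_map : {rmorphism L -> L};
  absgalV : {rmorphism L -> L};
  absgalK : cancel absgal_map absgalV;
  absgalVK : cancel absgalV absgal_map;
  absgal_fix : forall x : K, absgal_map (j x) = j x
}.

Lemma absgalV_fix (s : absgal) (x : K) : absgalV s (j x) = j x.
Proof. by rewrite -{1}(absgal_fix s x) absgalK. Qed.

Definition absgal_inv (s : absgal) : absgal :=
  Absgal (@absgalVK s) (@absgalK s) (@absgalV_fix s).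

Lemma absgal_mul_fix (s t : absgal) (x : K) :
  (absgal_map s \o absgal_map t) (j x) = j x.
Proof. by rewrite /= !absgal_fix. Qed.

Definition absgal_mul (s t : absgal) : absgal :=
  @Absgal (absgal_map s \o absgal_map t) (absgalV t \o absgalV s)
    (can_comp (@absgalK s) (@absgalK t)) (can_comp (@absgalVK t) (@absgalVK s))
    (absgal_mul_fix s t).

Variable E : weierstrass K.
Notation EL := (map_curve j E).

Lemma absgal_coordsP (s : absgal) T :
  on_curve EL T -> on_curve EL (map_coords (absgal_map s) T).
Proof.
by move/(map_coordsP (absgal_map s)); rewrite /map_curve /= !absgal_fix.
Qed.

Definition absgal_point (s : absgal) (T : point EL) : point EL :=
  Point (absgal_coordsP s (coordsP T)).

(* Maps E[p](L) -> L and E[p](L)^2 -> L are represented by maps on all points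
    of E(L); only the values at p-torsion points are ever used. *)

Definition absgal_fun (s : absgal) (f : point EL -> L) : point EL -> L :=
  fun S => absgal_map s (f (absgal_point (absgal_inv s) S)).

Definition absgal_fun2 (s : absgal) (f : point EL -> point EL -> L) :
    point EL -> point EL -> L :=
  fun S T => absgal_map s (f (absgal_point (absgal_inv s) S)
                             (absgal_point (absgal_inv s) T)).

Variable p : nat.

(* units of \overline{R_K} *)
Definition unit_Rbar (f : point EL -> L) : Prop :=
  forall T, torsion p T -> f T != 0.

(* units of R_K *)
Definition unit_R (f : point EL -> L) : Prop :=
  unit_Rbar f /\ forall s T, torsion p T -> absgal_fun s f T = f T.

(* units of R_K \otimes_K R_K *)
Definition unit_RR (f : point EL -> point EL -> L) : Prop :=
  (forall S T, torsion p S -> torsion p T -> f S T != 0) /\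
  forall s S T, torsion p S -> torsion p T -> absgal_fun2 s f S T = f S T.

(* Continuous cocycles, for the Krull topology on [absgal] and the discrete
   topology on E[p](L). *)
Record cocycle (xi : absgal -> point EL) : Prop := {
  cocycle_tors : forall s, torsion p (xi s);
  cocycle_mul : forall s t,
    xi (absgal_mul s t) = (xi s + absgal_point s (xi t))%EC;
  cocycle_cont : forall s, exists X : seq L, forall t,
    {in X, absgal_map t =1 absgal_map s} -> xi t = xi s
}.

Definition coboundary (gamma : point EL -> L) (T1 T2 : point EL) : L :=
  gamma T1 * gamma T2 / gamma (T1 + T2)%EC.

Definition compatible_representatives (e : point EL -> point EL -> L)
    (xi : absgal -> point EL)
    (alpha : point EL -> L) (rho : point EL -> point EL -> L) : Prop :=
  exists gamma : point EL -> L,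
    [/\ unit_Rbar gamma,
        forall s S, torsion p S -> e (xi s) S = absgal_fun s gamma S / gamma S,
        gamma (pzero EL) = 1,
        forall T, torsion p T -> gamma T ^+ p = alpha T
      & forall T1 T2, torsion p T1 -> torsion p T2 ->
          coboundary gamma T1 T2 = rho T1 T2].

End Galois.

Section Star.
Variables (L : fieldType) (E : weierstrass L) (p : nat).
Variables (e rho : point E -> point E -> L).

Definition eps (S T : point E) : L := e S T ^+ (p.+1)./2.

Definition star (f g : point E -> L) : point E -> L := fun T =>
  \sum_(U \in [set U : point E * point E |
         [/\ torsion p U.1, torsion p U.2 & (U.1 + U.2)%EC = T]]%classic)
     eps U.1 U.2 * rho U.1 U.2 * f U.1 * g U.2.

(* f * ... * f with n.+1 factors, bracketed to the left *)
Definition star_powS (f : point E -> L) (n : nat) : point E -> L :=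
  iter n (fun h => star h f) f.

Definition delta (S T : point E) : L := (T == S)%:R.

Definition Delta (P Q : point E) (T : point E) : L :=
  \sum_(i < p) delta (Q + i * P)%EC T.

End Star.

Definition generate_torsion (F : fieldType) (E : weierstrass F) (p : nat)
    (P Q : point E) : Prop :=
  forall T, torsion p T -> exists a b : nat, T = (a * P + b * Q)%EC.

(* Main.v *)
(* Expanding the *-product, the coefficient of delta_(pQ + sP), s = i_1 + ... + i_p, is
   a product of values of epsilon times a telescoping product of values of
   rho = d(gamma); the latter is symmetric in the i_l for fixed s, and the former is
   e(Q,P)^(sum l i_l) up to a factor depending on s only.  A cyclic shift of the indices
   multiplies it by e(Q,P)^s, so the terms with s prime to p cancel, because e(Q,P) is
   a primitive p-th root of unity.

   The properties of the Weil pairing come from functions E(L) -> L compared up to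
   finitely many points, with orders at the affine points only: a function without
   affine zeros and poles is constant, and by degrees of norms to L[x] a function with
   affine divisor (A) - (B) forces A = B.  With the divisors of lines this gives the
   group law and bilinearity.  For e(T,T) = 1, the product of the translates of f_T by
   the multiples of T is constant.  For non-degeneracy, in characteristic 0 a function
   invariant under E[p] is a function of pX: if e(-,T) = 1 then f_T is the p-th power of
   a function with divisor (T) - (O), so T = O.  Finally E[p] <> 0, since otherwise
   x(pX) would be a Moebius transform of x(X), which points of large 2-power order
   exclude. *)
From HB Require Import structures.
From mathcomp Require Import all_boot all_order all_algebra all_solvable all_field.
From mathcomp Require Import qpoly boolp classical_sets functions cardinality fsbigop.
From mathcomp Require Import finmap ring.
Require Import Defs.
Set Implicit Arguments.
Unset Strict Implicit.
Unset Printing Implicit Defensive.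
Import Order.TTheory GRing.Theory Num.Theory.
Local Open Scope ring_scope.
(** * Completed-square coordinates and the group operation *)

(** Addition is given only by the chord-and-tangent formulas, so neither associativity nor the
    structure of E[p] is at hand; both have to come from functions. Functions are plain maps with
    arbitrary values at finitely many points, and a zero-one law (a rational function vanishes
    almost everywhere or almost nowhere) replaces computation in a function field. Leaving out the
    origin spares a local analysis at infinity; the price is paid in e(T,T) = 1, where the orbit of
    T contains the origin and regularity is carried through the orbit by translation. Descent along
    multiplication by p uses neither Galois theory nor division polynomials: x(pX) is written as A/B
    in x(X) in lowest terms, and a generic fibre has as many distinct points as the degree of A/B.

    The square root in epsilon makes the exponents meet: with y = epsilon(Q,P), s the sum of the i_l
    and W the sum of the l i_l, the epsilon factors multiply to y^(2W - s), that is e(Q,P)^W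
    y^(-s). *)

Section ClosedField.
Variable L : fieldType.
Hypothesis closedL : GRing.closed_field_axiom L.

Lemma closed_root (q : {poly L}) : (1 < size q)%N -> exists x, root q x.
Proof.
move=> sq; have lq : lead_coef q != 0 by rewrite lead_coef_eq0 -size_poly_gt0 (ltn_trans _ sq).
have n0 : (0 < (size q).-1)%N by rewrite -ltnS prednK // (ltn_trans _ sq).
have [x hx] := closedL (fun i => - q`_i / lead_coef q) n0.
exists x; rewrite /root horner_coef -(prednK (ltn_trans (ltn0Sn 0) sq)) big_ord_recr /=.
apply/eqP/(mulfI (invr_neq0 lq)); rewrite mulr0 mulrDr -lead_coefE mulKf // hx.
rewrite mulr_sumr -big_split big1 //= => i _.
by field.
Qed.

Lemma closed_split (q : {poly L}) :
  exists rs, q = lead_coef q *: \prod_(z <- rs) ('X - z%:P).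
Proof.
have [n sq] := ubnP (size q); elim: n => // n IHn in q sq *.
have [s1|s1] := leqP (size q) 1.
  exists nil; rewrite big_nil [q]size1_polyC // lead_coefC.
  by rewrite -mul_polyC mulr1.
have [x /factor_theorem [r er]] := closed_root s1.
have r0 : r != 0.
  by apply: contraTneq s1 => r0; rewrite er r0 mul0r size_poly0.
have [|rs ers] := IHn r.
  by rewrite -ltnS (leq_trans _ sq) // er size_Mmonic ?monicXsubC // size_XsubC addn2 ltnS.
exists (x :: rs); rewrite big_cons {1}er {1}ers er lead_coefM lead_coefXsubC mulr1.
by rewrite -scalerAl mulrC.
Qed.

End ClosedField.

Definition good_curve (L : fieldType) (E : weierstrass L) : Prop :=
  [/\ GRing.closed_field_axiom L, forall n, n.+1%:R != 0 :> L & elliptic E].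

(** The hypotheses are bundled with the equation so that [point E] can carry a canonical group
    structure, whose laws depend on them. *)
Record ecurve (L : fieldType) := ECurve {
  ecurve_eqn :> weierstrass L;
  ecurveP : good_curve ecurve_eqn
}.

Section Coordinates.
Variables (L : fieldType) (E : ecurve L).

Let gE := ecurveP E.
Implicit Types X Y : point E.
Notation O := (pzero E).

Let two0 : 2 != 0 :> L. Proof. by case: gE => _ /(_ 1%N). Qed.

(* x and the completed-square ordinate y + (a1 x + a3) / 2; both are 0 at the origin. *)
Definition px X : L := if coords X is Some (x, _) then x else 0.
Definition pe X : L :=
  if coords X is Some (x, y) then y + (a1 E * x + a3 E) / 2 else 0.

(** In the coordinates [px], [pe] the equation becomes e^2 = x^3 + cA x^2 + cB x + cC, and negation
    becomes e -> -e. *)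
Definition cA := a2 E + a1 E ^+ 2 / 4.
Definition cB := a4 E + a1 E * a3 E / 2.
Definition cC := a6 E + a3 E ^+ 2 / 4.
Definition cubic : {poly L} :=
  locked ('X ^+ 3 + cA *: 'X ^+ 2 + cB *: 'X + cC%:P).

Lemma cubicE x : cubic.[x] = x ^+ 3 + cA * x ^+ 2 + cB * x + cC.
Proof. by rewrite /cubic -lock !hornerE. Qed.

Lemma cubic_deriv x : cubic^`().[x] = 3 * x ^+ 2 + 2 * cA * x + cB.
Proof. rewrite /cubic -lock !derivE /= !hornerE /=.  ring. Qed.

Lemma size_cubic : size cubic = 4.
Proof.
rewrite /cubic -lock -!addrA size_polyDl size_polyXn // ltnS.
rewrite (leq_trans (size_polyD _ _)) // geq_max (leq_trans (size_scale_leq _ _)) ?size_polyXn //=.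
rewrite (leq_trans (size_polyD _ _)) // geq_max (leq_trans (size_scale_leq _ _)) ?size_polyX //=.
by rewrite (leq_trans (size_polyC_leq1 _)).
Qed.

Let four0 : 4 != 0 :> L. Proof. by case: gE => _ /(_ 3%N). Qed.

Lemma pe2 X : X != O -> pe X ^+ 2 = cubic.[px X].
Proof.
case: X => -[[x y]|] h; last by rewrite -val_eqE.
move=> _; rewrite cubicE /pe /px /cA /cB /cC /=; move/eqP: h => h.
apply/eqP; rewrite -subr_eq0; apply/eqP; move/eqP: h; rewrite -subr_eq0 => /eqP h.
by rewrite -[RHS]h; field; rewrite two0 four0.
Qed.

Lemma point_of x z : z ^+ 2 = cubic.[x] -> exists X, [/\ X != O, px X = x & pe X = z].
Proof.
rewrite cubicE => h; pose y := z - (a1 E * x + a3 E) / 2.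
have hy : on_curve E (Some (x, y)).
  rewrite /on_curve -subr_eq0; apply/eqP.
  transitivity (z ^+ 2 - (x ^+ 3 + cA * x ^+ 2 + cB * x + cC)); last by rewrite h subrr.
  by rewrite /y /cA /cB /cC; field; rewrite two0 four0.
exists (Point hy); split; [by rewrite -val_eqE| by [] |].
by rewrite /pe /= /y subrK.
Qed.

Lemma point_at x : exists X, X != O /\ px X = x.
Proof.
case: gE => cl _ _.
have [|z] := @closed_root L cl ('X^2 - cubic.[x]%:P); first by rewrite size_XnsubC.
rewrite rootE !hornerE subr_eq0 => /eqP hz.
by have [X [X0 xX _]] := point_of hz; exists X.
Qed.

Lemma point_inj X Y : X != O -> Y != O -> px X = px Y -> pe X = pe Y -> X = Y.
Proof.
case: X Y => -[[x y]|] h [[[x' y']|] h'] //; rewrite -?val_eqE //= => _ _.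
rewrite /px /pe /= => e1 e2; apply: val_inj => /=.
by move: e2; rewrite e1 => /addIr ->.
Qed.

(** A double root x expresses [cB] and [cC] through x and [cA]; substituting makes the discriminant
    vanish identically. *)
Lemma cubic_sep x : cubic.[x] = 0 -> cubic^`().[x] != 0.
Proof.
case: gE => _ _ /negP nd; rewrite cubicE cubic_deriv => e1; apply/negP => /eqP e2.
have eB : cB = - 3 * x ^+ 2 - 2 * cA * x.
  by apply/eqP; rewrite -subr_eq0 -e2; apply/eqP; ring.
have eC : cC = 2 * x ^+ 3 + cA * x ^+ 2.
  by apply/eqP; rewrite -subr_eq0 -e1 eB; apply/eqP; ring.
apply: nd; rewrite /discriminant.
have -> : a4 E = - 3 * x ^+ 2 - 2 * cA * x - a1 E * a3 E / 2.
  by rewrite -eB /cB; field.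
have -> : a6 E = 2 * x ^+ 3 + cA * x ^+ 2 - a3 E ^+ 2 / 4.
  by rewrite -eC /cC; field.
by rewrite /cA; apply/eqP; field; rewrite two0 four0.
Qed.

Lemma popp_subproof X : on_curve E
  (if coords X is Some (x, y) then Some (x, - y - a1 E * x - a3 E) else None).
Proof.
case: X => -[[x y]|] //= /eqP h; rewrite -h; apply/eqP; ring.
Qed.
Definition popp X : point E := Point (popp_subproof X).

Lemma popp_px X : px (popp X) = px X.
Proof. by case: X => -[[x y]|]. Qed.

Lemma popp_pe X : pe (popp X) = - pe X.
Proof. by case: X => -[[x y]|] h; rewrite /pe /= ?oppr0 //; field. Qed.

Lemma poppO : popp O = O.
Proof. exact: val_inj. Qed.

Lemma popp_neq0 X : (popp X != O) = (X != O).
Proof. by case: X => -[[x y]|]. Qed.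

Lemma poppK : involutive popp.
Proof. by move=> [[[x y]|] h]; apply: val_inj => //=; congr (Some (_, _)); ring. Qed.

Lemma px_eq X Y : X != O -> Y != O -> px X = px Y -> Y = X \/ Y = popp X.
Proof.
move=> X0 Y0 e; have : (pe X - pe Y) * (pe X + pe Y) = 0.
  by rewrite -subr_sqr !pe2 // e subrr.
move/eqP; rewrite mulf_eq0 subr_eq0 addr_eq0 => /orP[] /eqP h.
  by left; apply: point_inj.
by right; apply: point_inj; rewrite ?popp_neq0 ?popp_px ?popp_pe // h opprK.
Qed.

Lemma add0p X : padd O X = X. Proof. by apply: val_inj; case: X => -[[x y]|]. Qed.
Lemma addp0 X : padd X O = X. Proof. by apply: val_inj; case: X => -[[x y]|]. Qed.

Lemma addpN X : padd X (popp X) = O.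
Proof. by apply: val_inj; case: X => -[[x y]|] //= h; rewrite !eqxx. Qed.

(** The slope in the new coordinates is the Weierstrass slope plus a1/2, which absorbs the terms in
    [a1] and [a3]. *)
Lemma padd_chord X Y (l := (pe Y - pe X) / (px Y - px X)) :
  X != O -> Y != O -> px X != px Y ->
  [/\ padd X Y != O, px (padd X Y) = l ^+ 2 - cA - px X - px Y
    & pe (padd X Y) = - (l * (px (padd X Y) - px X) + pe X)].
Proof.
case: X Y @l => -[[x y]|] h [[[x' y']|] h'] //=; rewrite /padd -!val_eqE //= => _ _.
rewrite /px /pe /= => nx; rewrite (negPf nx) /=.
have nx' : x' - x != 0 by rewrite subr_eq0 eq_sym.
set l := (y' - y) / _.
have -> : (y' + (a1 E * x' + a3 E) / 2 - (y + (a1 E * x + a3 E) / 2)) / (x' - x) = l + a1 E / 2.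
  by rewrite /l; field; rewrite nx' two0.
split=> //; first by rewrite /cA; field; rewrite two0 four0.
by field.
Qed.

Lemma padd_tangent X (l := cubic^`().[px X] / (2 * pe X)) :
  X != O -> pe X != 0 ->
  [/\ padd X X != O, px (padd X X) = l ^+ 2 - cA - px X - px X
    & pe (padd X X) = - (l * (px (padd X X) - px X) + pe X)].
Proof.
case: X @l => -[[x y]|] h //=; rewrite /padd -!val_eqE //= => _.
rewrite cubic_deriv /px /pe /= => ne; rewrite eqxx.
have n2 : 2 * (y + (a1 E * x + a3 E) / 2) = 2 * y + a1 E * x + a3 E by field.
have ne2 : 2 * y + a1 E * x + a3 E != 0 by rewrite -n2 mulf_neq0.
have -> : y == - y - a1 E * x - a3 E = false.
  apply: contraNF ne2 => /eqP e; apply/eqP; rewrite -!addrA mulrDl !mul1r {1}e; ring.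
rewrite /= n2; set l := _ / (2 * y + _ + _).
have -> : (3 * x ^+ 2 + 2 * cA * x + cB) / (2 * y + a1 E * x + a3 E) = l + a1 E / 2.
  by rewrite /l /cA /cB; field; rewrite two0 four0 ne2.
split=> //; first by rewrite /cA; field; rewrite two0 four0.
by field.
Qed.

Lemma pe0_popp X : X != O -> pe X = 0 -> popp X = X.
Proof.
by move=> X0 e; apply: point_inj; rewrite ?popp_neq0 ?popp_px ?popp_pe // e oppr0.
Qed.

End Coordinates.

Arguments point_at {L} E x.
(** * Rational functions and local rings *)

Section CharZero.
Variable L : fieldType.
Hypothesis charL : forall n, n.+1%:R != 0 :> L.

Lemma natr_inj_char0 : injective (fun n : nat => n%:R : L).
Proof.
have aux m n : (m <= n)%N -> m%:R = n%:R :> L -> m = n.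
  move=> mn /esym/eqP; rewrite -subr_eq0 -natrB // => h.
  have: (n - m == 0)%N by case: (n - m)%N h => // k; rewrite (negPf (charL k)).
  by rewrite subn_eq0 => nm; apply/eqP; rewrite eqn_leq mn.
by move=> m n /= e; case: (leqP m n) => [/aux->//|/ltnW/aux h]; rewrite h.
Qed.

Lemma fresh_elt (rs : seq L) : exists x, x \notin rs.
Proof.
apply/not_existsP => h.
have sub : {subset [seq n%:R : L | n <- iota 0 (size rs).+1] <= rs}.
  by move=> x _; apply/negPn/negP; apply: h.
have := uniq_leq_size (etrans (map_inj_uniq natr_inj_char0 _) (iota_uniq _ _)) sub.
by rewrite size_map size_iota ltnn.
Qed.

End CharZero.

Section Functions.
Variables (L : fieldType) (E : ecurve L).
Let gE := ecurveP E.
Implicit Types (X Y Z : point E) (phi psi u s : point E -> L) (A B C D : point E -> Prop).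
Notation O := (pzero E).
Notation ae := (@for_almost_all L E).
Notation cubic := (cubic E).

Lemma ae_all A : (forall X, A X) -> ae A.
Proof. by move=> h; exists nil. Qed.

Lemma ae1 A B : ae A -> (forall X, A X -> B X) -> ae B.
Proof. by move=> [s hs] h; exists s => X /hs/h. Qed.

Lemma ae2 A B C : ae A -> ae B -> (forall X, A X -> B X -> C X) -> ae C.
Proof.
move=> [s hs] [s' hs'] h; exists (s ++ s') => X.
by rewrite mem_cat negb_or => /andP[/hs a /hs' b]; apply: h.
Qed.

Lemma ae3 A B C D :
  ae A -> ae B -> ae C -> (forall X, A X -> B X -> C X -> D X) -> ae D.
Proof.
move=> hA hB hC h.
have hAB : ae (fun X => A X /\ B X) by apply: (ae2 hA hB).
by apply: (ae2 hAB hC) => X [a b]; apply: h.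
Qed.

Lemma ae_neq Y : ae (fun X => X != Y).
Proof. by exists [:: Y] => X; rewrite inE. Qed.

(** An abscissa is shared only by an affine point and its opposite. *)
Lemma ae_px (rs : seq L) : ae (fun X => px X \notin rs).
Proof.
have [F hF] := choice (point_at E).
exists (O :: [seq F r | r <- rs] ++ [seq popp (F r) | r <- rs]) => X.
rewrite inE mem_cat !negb_or => /and3P[X0 h1 h2].
apply/negP => xrs; have [F0 ex] := hF (px X).
by case: (px_eq F0 X0 ex) => e; [case/mapP: h1|case/mapP: h2]; exists (px X).
Qed.

Lemma ae_px_neq c : ae (fun X => px X != c).
Proof. by apply: (ae1 (ae_px [:: c])) => X; rewrite inE. Qed.

Lemma ae_poly (q : {poly L}) : q != 0 -> ae (fun X => q.[px X] != 0).
Proof.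
case: gE => cl _ _; have [rs eq_q] := closed_split cl q => q0.
apply: (ae1 (ae_px rs)) => X.
apply: contraNN => /eqP; rewrite eq_q hornerZ => /eqP.
by rewrite mulf_eq0 lead_coef_eq0 (negPf q0) /= -/(root _ _) root_prod_XsubC.
Qed.

Lemma ae_ex A : ae A -> exists2 X, X != O & A X.
Proof.
move=> [s hs]; have [_ ch _] := gE; have [x hx] := fresh_elt ch [seq px Y | Y <- s].
have [X [X0 eX]] := point_at E x; exists X => //; apply: hs.
by apply: contra hx => Xs; rewrite -eX; apply: map_f.
Qed.

(** The passage from generic points back to statements about constants; with [P] false it turns a
    contradiction at almost every point into a contradiction. *)
Lemma ae_const (P : Prop) : ae (fun _ => P) -> P.
Proof. by case/ae_ex. Qed.

(** Pigeonhole principle: each alternative holds almost everywhere or almost nowhere, and those of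
    the second kind can be discarded one by one. *)
Lemma ae_exists_in (T : eqType) (s : seq T) (R : T -> point E -> Prop) :
  (forall c, c \in s -> ae (fun X => R c X) \/ ae (fun X => ~ R c X)) ->
  ae (fun X => exists2 c, c \in s & R c X) -> exists2 c, c \in s & ae (R c).
Proof.
elim: s => [_ /ae_ex [X _ []] //|c s IHs] hs h.
have [a|na] := hs c (mem_head _ _); first by exists c; rewrite ?mem_head.
have [||c' c's a] := IHs.
- by move=> c' c's; apply: hs; rewrite inE c's orbT.
- apply: (ae2 h na) => X [c']; rewrite inE => /orP[/eqP->//|c's r] _.
  by exists c'.
by exists c' => //; rewrite inE c's orbT.
Qed.

Lemma ae_forall_in (T : eqType) (s : seq T) (R : T -> point E -> Prop) :
  (forall c, c \in s -> ae (R c)) -> ae (fun X => forall c, c \in s -> R c X).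
Proof.
elim: s => [|c s IHs] h; first by apply: ae_all.
have h1 := h c (mem_head _ _).
have h2 : ae (fun X => forall c, c \in s -> R c X).
  by apply: IHs => c' c's; apply: h; rewrite inE c's orbT.
by apply: (ae2 h1 h2) => X r1 r2 c'; rewrite inE => /orP[/eqP->//|/r2].
Qed.

Lemma ae_popp A : ae A -> ae (fun X => A (popp X)).
Proof.
move=> [s hs]; exists (map (@popp L E) s) => X h; apply: hs.
by apply: contra h => h; rewrite -[X]poppK map_f.
Qed.

Section Norm.
Variables a b : {poly L}.

(** The norm of a(x) + b(x) e down to L[x], where e^2 = [cubic]. *)
Definition norm := a ^+ 2 - b ^+ 2 * cubic.

Let size_sqr (q : {poly L}) : q != 0 -> size (q ^+ 2) = (size q).*2.-1.
Proof. by move=> q0; rewrite expr2 size_mul // addnn. Qed.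

(** The degree of a^2 is even and that of b^2 times the cubic is odd, so the leading terms cannot
    cancel. *)
Lemma size_norm : size norm = maxn (size a).*2.-1 (if b == 0 then 0 else (size b).*2.+2).
Proof.
have cubic0 : cubic != 0 by rewrite -size_poly_eq0 size_cubic.
have sa : size (a ^+ 2) = (size a).*2.-1.
  by have [->|/size_sqr//] := eqVneq a 0; rewrite expr0n size_poly0.
rewrite /norm; case: eqVneq => [->|b0]; first by rewrite expr0n mul0r subr0 sa maxn0.
have sb : size (b ^+ 2 * cubic) = (size b).*2.+2.
  rewrite size_mul ?expf_neq0 // size_sqr // size_cubic addnC.
  by have := b0; rewrite -size_poly_gt0; case: (size b) => // n _; rewrite doubleS.
case: (ltngtP (size (a ^+ 2)) (size (b ^+ 2 * cubic))) => h.
- by rewrite addrC size_polyDl size_polyN // sb; apply/esym/maxn_idPr; rewrite -sa -sb ltnW.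
- by rewrite size_polyDl ?size_polyN // sa; apply/esym/maxn_idPl; rewrite -sa -sb ltnW.
move: h; rewrite sa sb; case: (size a) => // n; rewrite doubleS /= => - [] /(congr1 odd).
by rewrite /= !odd_double.
Qed.

Lemma norm_eq0 : norm = 0 -> a = 0 /\ b = 0.
Proof.
move/eqP; rewrite -size_poly_eq0 size_norm -leqn0 geq_max !leqn0.
case: (eqVneq b 0) => [b0|_] /=; last by rewrite andbF.
rewrite andbT => /eqP h; split=> //; apply/eqP.
by rewrite -size_poly_eq0; case: (size a) h.
Qed.

Lemma norm_size2 : (size norm <= 2)%N -> (size a <= 1)%N /\ b = 0.
Proof.
rewrite size_norm geq_max; case: (eqVneq b 0) => [->|b0 /andP[_]] /=.
  by case: (size a) => [|[|n]].
by move: b0; rewrite -size_poly_gt0; case: (size b).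
Qed.

Lemma norm_size3 : (size norm <= 3)%N -> (size a <= 2)%N /\ b = 0.
Proof.
rewrite size_norm geq_max; case: (eqVneq b 0) => [->|b0 /andP[_]] /=.
  by case: (size a) => [|[|[|n]]].
by move: b0; rewrite -size_poly_gt0; case: (size b).
Qed.

Lemma normE X : X != O ->
  norm.[px X] = (a.[px X] + b.[px X] * pe X) * (a.[px X] - b.[px X] * pe X).
Proof.
by move=> X0; rewrite /norm !expr2 hornerD hornerN !hornerM -pe2 //; ring.
Qed.

End Norm.

(** Membership in the affine coordinate ring; the value at the origin is unconstrained. *)
Definition polyfun phi := exists a b : {poly L},
  forall X, X != O -> phi X = a.[px X] + b.[px X] * pe X.

Lemma polyfun_cst c : polyfun (fun=> c).
Proof. by exists c%:P, 0 => X _; rewrite !hornerE. Qed.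
Lemma polyfun_poly (q : {poly L}) : polyfun (fun X => q.[px X]).
Proof. by exists q, 0 => X _; rewrite !hornerE. Qed.
Lemma polyfun_px : polyfun (@px L E).
Proof. by exists 'X, 0 => X _; rewrite !hornerE. Qed.
Lemma polyfun_pe : polyfun (@pe L E).
Proof. by exists 0, 1 => X _; rewrite !hornerE. Qed.
Lemma polyfunD phi psi : polyfun phi -> polyfun psi -> polyfun (fun X => phi X + psi X).
Proof.
move=> [a [b h]] [a' [b' h']]; exists (a + a'), (b + b') => X X0.
by rewrite h // h' // !hornerD; ring.
Qed.
Lemma polyfunM phi psi : polyfun phi -> polyfun psi -> polyfun (fun X => phi X * psi X).
Proof.
move=> [a [b h]] [a' [b' h']]; exists (a * a' + b * b' * cubic), (a * b' + b * a') => X X0.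
by rewrite h // h' // !(hornerD, hornerM) -pe2 //; ring.
Qed.
Lemma polyfunN phi : polyfun phi -> polyfun (fun X => - phi X).
Proof. by move=> [a [b h]]; exists (- a), (- b) => X X0; rewrite h // !hornerN; ring. Qed.
Lemma polyfunB phi psi : polyfun phi -> polyfun psi -> polyfun (fun X => phi X - psi X).
Proof. by move=> h /polyfunN; apply: polyfunD. Qed.
Lemma polyfun_popp phi : polyfun phi -> polyfun (fun X => phi (popp X)).
Proof.
move=> [a [b h]]; exists a, (- b) => X X0.
by rewrite h ?popp_neq0 // popp_px popp_pe // !hornerN; ring.
Qed.

(** A zero of the function is a zero of its norm, a polynomial in x that has finitely many roots
    unless a = b = 0. *)
Lemma polyfun_zero phi : polyfun phi ->
  (forall X, X != O -> phi X = 0) \/ ae (fun X => phi X != 0).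
Proof.
move=> [a [b h]]; have [/norm_eq0[a0 b0]|n0] := eqVneq (norm a b) 0.
  by left=> X X0; rewrite h // a0 b0 !hornerE.
right; apply: (ae2 (ae_poly n0) (ae_neq O)) => X nX X0.
by apply: contraNneq nX => e; rewrite normE // -h // e mul0r.
Qed.

Lemma polyfun_ae phi psi : polyfun phi -> polyfun psi -> ae (fun X => phi X = psi X) ->
  forall X, X != O -> phi X = psi X.
Proof.
move=> h1 h2 h; case: (polyfun_zero (polyfunB h1 h2)) => [h3 X X0|h3].
  by apply/eqP; rewrite -subr_eq0 h3.
have [|X _ []] // := @ae_ex (fun=> False).
by apply: (ae2 h h3) => X ->; rewrite subrr eqxx.
Qed.

Definition rational phi := exists u s,
  [/\ polyfun u, polyfun s, ae (fun X => s X != 0) & ae (fun X => s X * phi X = u X)].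

Lemma rational_ae phi psi : ae (fun X => phi X = psi X) -> rational phi -> rational psi.
Proof.
move=> e [u [s [hu hs s0 h]]]; exists u, s; split=> //.
by apply: (ae2 e h) => X <-.
Qed.

Lemma rational_poly phi : polyfun phi -> rational phi.
Proof.
move=> h; exists phi, (fun=> 1); split=> //; first exact: polyfun_cst.
  by apply: ae_all => X; apply: oner_neq0.
by apply: ae_all => X; rewrite mul1r.
Qed.

Lemma rational_cst c : rational (fun=> c).
Proof. exact/rational_poly/polyfun_cst. Qed.
Lemma rational_px : rational (@px L E). Proof. exact/rational_poly/polyfun_px. Qed.
Lemma rational_pe : rational (@pe L E). Proof. exact/rational_poly/polyfun_pe. Qed.

Lemma rationalD phi psi : rational phi -> rational psi -> rational (fun X => phi X + psi X).
Proof.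
move=> [u [s [hu hs s0 h]]] [u' [s' [hu' hs' s0' h']]].
exists (fun X => s' X * u X + s X * u' X), (fun X => s X * s' X); split.
- by apply: polyfunD; apply: polyfunM.
- exact: polyfunM.
- by apply: (ae2 s0 s0') => X; apply: mulf_neq0.
by apply: (ae2 h h') => X <- <-; ring.
Qed.

Lemma rationalM phi psi : rational phi -> rational psi -> rational (fun X => phi X * psi X).
Proof.
move=> [u [s [hu hs s0 h]]] [u' [s' [hu' hs' s0' h']]].
exists (fun X => u X * u' X), (fun X => s X * s' X); split.
- exact: polyfunM.
- exact: polyfunM.
- by apply: (ae2 s0 s0') => X; apply: mulf_neq0.
by apply: (ae2 h h') => X <- <-; ring.
Qed.

Lemma rationalN phi : rational phi -> rational (fun X => - phi X).
Proof.
move/(rationalM (rational_cst (-1))); apply: rational_ae.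
by apply: ae_all => X; rewrite mulN1r.
Qed.

Lemma rationalB phi psi : rational phi -> rational psi -> rational (fun X => phi X - psi X).
Proof. by move=> h /rationalN; apply: rationalD. Qed.

Lemma rational_zero phi : rational phi -> ae (fun X => phi X = 0) \/ ae (fun X => phi X != 0).
Proof.
move=> [u [s [hu hs s0 h]]]; case: (polyfun_zero hu) => hu0; [left|right].
  apply: (ae3 s0 h (ae_neq O)) => X sX e X0; apply/eqP.
  by move: e; rewrite hu0 // => /eqP; rewrite mulf_eq0 (negPf sX).
by apply: (ae2 h hu0) => X e; apply: contraNneq => e'; rewrite -e e' mulr0.
Qed.

Lemma rationalV phi : rational phi -> rational (fun X => (phi X)^-1).
Proof.
move=> rphi; case: (rational_zero rphi) => h0.
  by apply: rational_ae (rational_cst 0); apply: (ae1 h0) => X ->; rewrite invr0.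
have [u [s [hu hs s0 h]]] := rphi; exists s, u; split=> //.
  by apply: (ae3 s0 h0 h) => X sX pX <-; apply: mulf_neq0.
by apply: (ae2 h h0) => X <- pX; rewrite mulfK.
Qed.

Lemma rationalX phi n : rational phi -> rational (fun X => phi X ^+ n).
Proof.
move=> h; elim: n => [|n IHn]; first exact: rational_cst.
by apply: rational_ae (rationalM h IHn); apply: ae_all => X; rewrite exprS.
Qed.

Lemma rational_prod (I : Type) (r : seq I) (F : I -> point E -> L) :
  (forall i, rational (F i)) -> rational (fun X => \prod_(i <- r) F i X).
Proof.
move=> h; elim: r => [|i r IHr].
  by apply: rational_ae (rational_cst 1); apply: ae_all => X; rewrite big_nil.
by apply: rational_ae (rationalM (h i) IHr); apply: ae_all => X; rewrite big_cons.
Qed.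

Lemma rational_eq phi psi : rational phi -> rational psi ->
  ae (fun X => phi X = psi X) \/ ae (fun X => phi X != psi X).
Proof.
move=> h1 h2; case: (rational_zero (rationalB h1 h2)) => h; [left|right].
  by apply: (ae1 h) => X /eqP; rewrite subr_eq0 => /eqP.
by apply: (ae1 h) => X; rewrite subr_eq0.
Qed.

Lemma rational_finite_values phi (cs : seq L) :
  rational phi -> ae (fun X => phi X \in cs) ->
  exists2 c, c \in cs & ae (fun X => phi X = c).
Proof.
move=> rphi h; apply: ae_exists_in => [c _|].
  case: (rational_eq rphi (rational_cst c)) => h'; [by left|right].
  by apply: (ae1 h') => X /eqP.
by apply: (ae1 h) => X hX; exists (phi X).
Qed.

(** The values are roots of X^n - c, hence finitely many, and a rational function takes one of them
    almost everywhere. *)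
Lemma rational_root phi n c : (0 < n)%N -> rational phi ->
  ae (fun X => phi X ^+ n = c) -> exists d, ae (fun X => phi X = d).
Proof.
case: gE => cl _ _ n0 rphi h; have [rs e] := closed_split cl ('X^n - c%:P).
have [|d _ hd] := rational_finite_values (cs := rs) rphi; last by exists d.
apply: (ae1 h) => X hX; rewrite -root_prod_XsubC.
have := e; rewrite lead_coefE (_ : size _ = n.+1) ?size_XnsubC //= coefB coefXn eqxx coefC.
rewrite -[n in n == 0](prednK n0) /= subr0 scale1r => <-.
by rewrite rootE hornerD hornerN hornerXn hornerC hX subrr.
Qed.

(* phi is regular at the affine point X0, with value c. *)
Definition val phi X0 (c : L) := exists u s,
  [/\ polyfun u, polyfun s, s X0 != 0, u X0 = c * s X0 & ae (fun X => s X * phi X = u X)].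

Lemma val_ae phi psi X0 c : ae (fun X => phi X = psi X) -> val phi X0 c -> val psi X0 c.
Proof.
move=> e [u [s [hu hs s0 us h]]]; exists u, s; split=> //.
by apply: (ae2 e h) => X <-.
Qed.

Lemma val_poly phi X0 : polyfun phi -> val phi X0 (phi X0).
Proof.
move=> h; exists phi, (fun=> 1); split; rewrite ?mulr1 ?oner_neq0 //.
  exact: polyfun_cst.
by apply: ae_all => X; rewrite mul1r.
Qed.

Lemma val_cst c X0 : val (fun=> c) X0 c.
Proof. exact/val_poly/polyfun_cst. Qed.

Lemma valD phi psi X0 c d : val phi X0 c -> val psi X0 d -> val (fun X => phi X + psi X) X0 (c + d).
Proof.
move=> [u [s [hu hs s0 us h]]] [u' [s' [hu' hs' s0' us' h']]].
exists (fun X => s' X * u X + s X * u' X), (fun X => s X * s' X); split.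
- by apply: polyfunD; apply: polyfunM.
- exact: polyfunM.
- exact: mulf_neq0.
- by rewrite us us'; ring.
by apply: (ae2 h h') => X <- <-; ring.
Qed.

Lemma valM phi psi X0 c d : val phi X0 c -> val psi X0 d -> val (fun X => phi X * psi X) X0 (c * d).
Proof.
move=> [u [s [hu hs s0 us h]]] [u' [s' [hu' hs' s0' us' h']]].
exists (fun X => u X * u' X), (fun X => s X * s' X); split.
- exact: polyfunM.
- exact: polyfunM.
- exact: mulf_neq0.
- by rewrite us us'; ring.
by apply: (ae2 h h') => X <- <-; ring.
Qed.

Lemma valN phi X0 c : val phi X0 c -> val (fun X => - phi X) X0 (- c).
Proof.
move/(valM (val_cst (-1) X0)); rewrite mulN1r; apply: val_ae.
by apply: ae_all => X; rewrite mulN1r.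
Qed.

Lemma valB phi psi X0 c d : val phi X0 c -> val psi X0 d -> val (fun X => phi X - psi X) X0 (c - d).
Proof. by move=> h /valN; apply: valD. Qed.

Lemma valX phi X0 c n : val phi X0 c -> val (fun X => phi X ^+ n) X0 (c ^+ n).
Proof.
move=> h; elim: n => [|n IHn]; first exact: val_cst.
by rewrite exprS; apply: val_ae (valM h IHn); apply: ae_all => X; rewrite exprS.
Qed.

Lemma val_rational phi X0 c : X0 != O -> val phi X0 c -> rational phi.
Proof.
move=> X00 [u [s [hu hs s0 us h]]]; exists u, s; split=> //.
by case: (polyfun_zero hs) => // h0; rewrite h0 ?eqxx in s0.
Qed.

Lemma val_nz phi X0 c : X0 != O -> val phi X0 c -> c != 0 -> ae (fun X => phi X != 0).
Proof.
move=> X00 h c0; case: (rational_zero (val_rational X00 h)) => // h0.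
have [u [s [hu hs s0 us {}h]]] := h.
have e : ae (fun X => u X = 0) by apply: (ae2 h h0) => X <- ->; rewrite mulr0.
have := polyfun_ae hu (polyfun_cst 0) e X00; rewrite us => /eqP.
by rewrite mulf_eq0 (negPf c0) (negPf s0).
Qed.

Lemma val_uniq phi X0 c d : X0 != O -> val phi X0 c -> val phi X0 d -> c = d.
Proof.
move=> X00 h1 h2; have := valB h1 h2; have [/eqP|n0] := eqVneq (c - d) 0.
  by rewrite subr_eq0 => /eqP.
by move/val_nz => /(_ X00 n0)/ae_ex [X _]; rewrite subrr eqxx.
Qed.

Lemma valV phi X0 c : X0 != O -> val phi X0 c -> c != 0 -> val (fun X => (phi X)^-1) X0 c^-1.
Proof.
move=> X00 h c0; have h0 := val_nz X00 h c0.
have [u [s [hu hs s0 us {}h]]] := h; exists s, u; split=> //.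
- by rewrite us mulf_neq0.
- by rewrite us mulKf.
by apply: (ae2 h h0) => X <- pX; rewrite mulfK.
Qed.

Lemma val_prod (I : Type) (r : seq I) (F : I -> point E -> L) (c : I -> L) X0 :
  (forall i, val (F i) X0 (c i)) -> val (fun X => \prod_(i <- r) F i X) X0 (\prod_(i <- r) c i).
Proof.
move=> h; elim: r => [|i r IHr].
  by rewrite big_nil; apply: val_ae (val_cst 1 X0); apply: ae_all => X; rewrite big_nil.
by rewrite big_cons; apply: val_ae (valM (h i) IHr); apply: ae_all => X; rewrite big_cons.
Qed.

Lemma val_popp phi X0 c : val phi X0 c -> val (fun X => phi (popp X)) (popp X0) c.
Proof.
move=> [u [s [hu hs s0 us h]]]; exists (fun X => u (popp X)), (fun X => s (popp X)).
by split; rewrite ?poppK //; [exact: polyfun_popp|exact: polyfun_popp|exact: (ae_popp h)].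
Qed.

Lemma val_horner phi X0 c (q : {poly L}) : val phi X0 c -> val (fun X => q.[phi X]) X0 q.[c].
Proof.
move=> h; elim/poly_ind: q => [|q d IHq].
  by rewrite horner0; apply: val_ae (val_cst 0 X0); apply: ae_all => X; rewrite horner0.
rewrite hornerMXaddC; apply: val_ae (valD (valM IHq h) (val_cst d X0)).
by apply: ae_all => X; rewrite hornerMXaddC.
Qed.

End Functions.

Arguments ae_px {L E} rs.
Arguments ae_px_neq {L E} c.
Arguments ae_poly {L E q} _.
Arguments ae_popp {L E A} _.
Arguments polyfun_cst {L E} c.
Arguments polyfun_poly {L E} q.
Arguments polyfun_px {L E}.
Arguments polyfun_pe {L E}.
Arguments rational_cst {L E} c.
Arguments rational_px {L E}.
Arguments rational_pe {L E}.
Arguments val_cst {L E} c X0.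
(** * Orders of vanishing *)

Section Orders.
Variables (L : fieldType) (E : ecurve L).
Let gE := ecurveP E.
Implicit Types (X Y Z : point E) (phi psi u s : point E -> L) (D : point E -> int).
Notation O := (pzero E).
Notation ae := (@for_almost_all L E).
Notation cubic := (cubic E).

Let two0 : 2 != 0 :> L. Proof. by case: gE => _ /(_ 1%N). Qed.

(* A uniformizer at X0: the ordinate at 2-torsion points, x - x(X0) elsewhere. *)
Definition unif X0 X : L := if pe X0 == 0 then pe X else px X - px X0.

Lemma unif0 X0 : unif X0 X0 = 0.
Proof. by rewrite /unif; case: eqP => // _; rewrite subrr. Qed.

Lemma polyfun_unif X0 : polyfun (unif X0).
Proof.
rewrite /unif; case: eqP => _; first exact: polyfun_pe.
by apply: polyfunB; [apply: polyfun_px|apply: polyfun_cst].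
Qed.

Lemma ae_pe : ae (fun X => pe X != 0).
Proof.
have c0 : cubic != 0 by rewrite -size_poly_eq0 size_cubic.
apply: (ae2 (ae_poly c0) (ae_neq O)) => X h X0.
by apply: contraNneq h => e; rewrite -pe2 // e expr0n.
Qed.

Lemma ae_unif X0 : ae (fun X => unif X0 X != 0).
Proof.
rewrite /unif; case: eqP => _; first exact: ae_pe.
by apply: (ae1 (ae_px_neq (px X0))) => X; rewrite subr_eq0.
Qed.

(** A relation, because the zero function has no order; existence for other rational functions is
    [ord_exists]. *)
Definition ord phi X0 (n : int) :=
  exists2 c, c != 0 & val (fun X => phi X * unif X0 X ^ (- n)) X0 c.

Lemma ord_ae phi psi X0 n : ae (fun X => phi X = psi X) -> ord phi X0 n -> ord psi X0 n.
Proof. by move=> e [c c0 h]; exists c => //; apply: val_ae h; apply: (ae1 e) => X ->. Qed.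

Lemma ord0_val phi X0 : ord phi X0 0 -> exists2 c, c != 0 & val phi X0 c.
Proof.
move=> [c c0 h]; exists c => //; apply: val_ae h.
by apply: ae_all => X; rewrite oppr0 expr0z mulr1.
Qed.

Lemma val_ord0 phi X0 c : c != 0 -> val phi X0 c -> ord phi X0 0.
Proof.
move=> c0 h; exists c => //; apply: val_ae h.
by apply: ae_all => X; rewrite oppr0 expr0z mulr1.
Qed.

Lemma ord_cst c X0 : c != 0 -> ord (fun=> c) X0 0.
Proof. by move=> c0; apply: (val_ord0 c0); apply: val_cst. Qed.

Lemma ordM phi psi X0 n m : ord phi X0 n -> ord psi X0 m ->
  ord (fun X => phi X * psi X) X0 (n + m).
Proof.
move=> [c c0 h] [d d0 h']; exists (c * d); first exact: mulf_neq0.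
apply: val_ae (valM h h'); apply: (ae1 (ae_unif X0)) => X t0.
by rewrite opprD expfzDr //; ring.
Qed.

Lemma ordV phi X0 n : X0 != O -> ord phi X0 n -> ord (fun X => (phi X)^-1) X0 (- n).
Proof.
move=> X00 [c c0 h]; exists c^-1; first exact: invr_neq0.
apply: val_ae (valV X00 h c0); apply: ae_all => X.
by rewrite invfM invr_expz.
Qed.

Lemma ordX phi X0 n k : ord phi X0 n -> ord (fun X => phi X ^+ k) X0 (n *+ k).
Proof.
move=> h; elim: k => [|k IHk].
  by apply: ord_ae (ord_cst X0 (oner_neq0 L)); apply: ae_all => X; rewrite expr0.
by rewrite mulrS; apply: ord_ae (ordM h IHk); apply: ae_all => X; rewrite exprS.
Qed.

Lemma ord_rational phi X0 n : X0 != O -> ord phi X0 n -> rational phi.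
Proof.
move=> X00 [c _ /(val_rational X00) h].
have ht : rational (fun X => unif X0 X ^ n).
  case: n {h} => n; first exact/rationalX/rational_poly/polyfun_unif.
  exact/rationalV/rationalX/rational_poly/polyfun_unif.
apply: rational_ae (rationalM h ht); apply: (ae1 (ae_unif X0)) => X t0.
by rewrite -mulrA -expfzDr // addNr expr0z mulr1.
Qed.

Lemma ord_nz phi X0 n : X0 != O -> ord phi X0 n -> ae (fun X => phi X != 0).
Proof.
move=> X00 [c c0 h]; apply: (ae1 (val_nz X00 h c0)) => X.
by apply: contraNneq => ->; rewrite mul0r.
Qed.

Lemma ord_pos_val phi X0 n : X0 != O -> ord phi X0 n -> 0 < n -> val phi X0 0.
Proof.
case: n => // -[|n] // X00 [c c0 h] _.
have ht : val (fun X => unif X0 X ^+ n.+1) X0 0.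
  by have := valX n.+1 (val_poly X0 (polyfun_unif X0)); rewrite unif0 exprS mul0r.
rewrite -(mulr0 c); apply: val_ae (valM h ht); apply: (ae1 (ae_unif X0)) => X t0.
by rewrite -mulrA exprnP -expfzDr // addNr expr0z mulr1.
Qed.

Lemma ord_ge0_val phi X0 n : X0 != O -> ord phi X0 n -> 0 <= n -> exists c, val phi X0 c.
Proof.
move=> X00 h; rewrite le_eqVlt => /orP[/eqP n0|n0]; last by exists 0; apply: ord_pos_val h n0.
by rewrite -n0 in h; have [c _ hc] := ord0_val h; exists c.
Qed.

Lemma ord_uniq phi X0 n m : X0 != O -> ord phi X0 n -> ord phi X0 m -> n = m.
Proof.
move=> X00.
have aux (k l : int) : ord phi X0 k -> ord phi X0 l -> ~ k < l.
  move=> hk hl kl.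
  have h1 : ord (fun=> 1) X0 (l - k).
    apply: ord_ae (ordM hl (ordV X00 hk)); apply: (ae1 (ord_nz X00 hk)) => X p0.
    exact: mulfV.
  have := ord_pos_val X00 h1; rewrite subr_gt0 => /(_ kl) h0.
  have := val_uniq X00 h0 (val_cst 1 X0) => /esym/eqP; by rewrite oner_eq0.
by move=> hn hm; case: (ltgtP n m) => // [/(aux _ _ hn hm)|/(aux _ _ hm hn)].
Qed.

Lemma ord_popp phi X0 n : X0 != O -> ord phi X0 n -> ord (fun X => phi (popp X)) (popp X0) n.
Proof.
move=> X00 [c c0 h]; have h' := val_popp h.
have [e|ne] := eqVneq (pe X0) 0; last first.
  exists c => //; apply: val_ae h'; apply: ae_all => X.
  by rewrite /unif !popp_pe oppr_eq0 (negPf ne) !popp_px.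
exists (c * (-1) ^ n); first by rewrite mulf_neq0 // expfz_neq0 // oppr_eq0 oner_eq0.
apply: val_ae (valM h' (val_cst ((-1) ^ n) _)); apply: ae_all => X.
rewrite /unif !popp_pe e oppr0 eqxx -mulrA; congr (_ * _).
by rewrite -[- pe X]mulN1r expfzMl mulrAC -expfzDr ?oppr_eq0 ?oner_eq0 // addNr expr0z mul1r.
Qed.

Lemma cubic_root_factor x : cubic.[x] = 0 ->
  exists2 q : {poly L}, cubic = q * ('X - x%:P) & q.[x] != 0.
Proof.
move=> h; have /factor_theorem [q e] : root cubic x by rewrite rootE h.
exists q => //; have := cubic_sep h.
by rewrite e derivM derivXsubC mulr1 hornerD hornerM !hornerE subrr mulr0 add0r.
Qed.

(** At a 2-torsion point e^2 = q(x) (x - x0) with q(x0) non-zero, as the cubic has simple roots; so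
    x - x0 is a unit times e^2. *)
Lemma ord_px X0 : X0 != O ->
  ord (fun X => px X - px X0) X0 (if pe X0 == 0 then 2 else 1).
Proof.
move=> X00; have e2 := pe2 X00; case: eqP => [e|/eqP ne]; last first.
  exists 1; rewrite ?oner_neq0 //; apply: val_ae (val_cst 1 X0).
  apply: (ae1 (ae_unif X0)) => X; rewrite /unif (negPf ne) => h.
  by rewrite exprN1 mulfV.
rewrite e expr0n /= in e2; have [q eq_q qx] := cubic_root_factor (esym e2).
exists q.[px X0]^-1; first exact: invr_neq0.
apply: val_ae (valV X00 (val_poly X0 (polyfun_poly _)) qx).
apply: (ae3 (ae_neq O) (ae_unif X0) (ae_px_neq (px X0))) => X hX t0; rewrite -subr_eq0 => x0.
have := pe2 hX; rewrite eq_q hornerM hornerXsubC => e3.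
move: t0; rewrite /unif e eqxx => t0.
have q0 : q.[px X] != 0.
  by apply: contraNneq t0 => h; rewrite h mul0r in e3; rewrite -sqrf_eq0 e3.
rewrite -invr_expz (_ : pe X ^ 2 = pe X ^+ 2) // e3 invfM mulrCA mulfV //.
by rewrite mulr1.
Qed.

Lemma ord_val_neq0 phi X0 : polyfun phi -> phi X0 != 0 -> ord phi X0 0.
Proof. by move=> h h0; apply: (val_ord0 h0); apply: val_poly. Qed.

(** The one-point divisor (Z), as a function of X. *)
Definition dl Z X : int := (X == Z)%:R.

Lemma ord_vertical Z X0 : Z != O -> X0 != O ->
  ord (fun X => px X - px Z) X0 (dl Z X0 + dl (popp Z) X0).
Proof.
move=> Z0 X00; rewrite /dl; have [e|ne] := eqVneq (px X0) (px Z); last first.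
  have -> : X0 == Z = false by apply: contraNF ne => /eqP ->.
  have -> : X0 == popp Z = false by apply: contraNF ne => /eqP ->; rewrite popp_px.
  apply: ord_val_neq0; last by rewrite subr_eq0.
  by apply: polyfunB; [apply: polyfun_px|apply: polyfun_cst].
have h := ord_px X00; rewrite e in h.
have [pz|pz] := eqVneq (pe X0) 0; [rewrite pz eqxx in h|rewrite (negPf pz) in h].
  have h1 : X0 = Z.
    apply: point_inj => //; rewrite pz; apply/esym/eqP.
    by rewrite -sqrf_eq0 pe2 // -e -pe2 // pz expr0n.
  by rewrite -h1 in h *; rewrite pe0_popp // eqxx.
case: (px_eq Z0 X00 (esym e)) => eX; rewrite eX eqxx in h *.
  suff -> : Z == popp Z = false by [].
  apply: contraNF pz => /eqP eZ; have := congr1 (@pe _ _) eZ; rewrite eX popp_pe //.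
  by move/eqP; rewrite -addr_eq0 -mulr2n -mulr_natl mulf_eq0 (negPf two0).
suff -> : popp Z == Z = false by [].
apply: contraNF pz => /eqP eZ; have := congr1 (@pe _ _) eZ; rewrite eX popp_pe oppr_eq0.
by move/esym/eqP; rewrite -addr_eq0 -mulr2n -mulr_natl mulf_eq0 (negPf two0).
Qed.

Lemma ord_poly_exists (q : {poly L}) X0 : X0 != O -> q != 0 ->
  exists n, ord (fun X => q.[px X]) X0 n.
Proof.
move=> X00 q0; have [m [r rx eq_q]] := multiplicity_XsubC q (px X0).
rewrite q0 /= in rx.
have hr : ord (fun X => r.[px X]) X0 0.
  by apply: ord_val_neq0; [apply: polyfun_poly | rewrite -rootE].
eexists; apply: ord_ae (ordM hr (ordX m (ord_px X00))).
by apply: ae_all => X; rewrite eq_q hornerM horner_exp hornerXsubC.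
Qed.

(** Induction on the sizes of a and b: common factors x - x0 are split off, and once b(x0) is
    non-zero the order can be read off directly. *)
Lemma ord_polyfun_exists phi X0 : X0 != O -> polyfun phi -> ae (fun X => phi X != 0) ->
  exists n, ord phi X0 n.
Proof.
move=> X00 [a [b hphi]] nz.
have {hphi} hphi : ae (fun X => a.[px X] + b.[px X] * pe X = phi X).
  by apply: (ae1 (ae_neq O)) => X h; rewrite hphi.
suff [n hn] : exists n, ord (fun X => a.[px X] + b.[px X] * pe X) X0 n.
  by exists n; apply: ord_ae hn.
have ab0 : ~ (a = 0 /\ b = 0).
  move=> [a0 b0]; apply: (@ae_const L E); apply: (ae2 hphi nz) => Y <-.
  by rewrite a0 b0 !hornerE eqxx.
have [k] := ubnP (size a + size b); elim: k => // k IHk in a b ab0 {hphi nz} *.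
move=> sz; pose x0 := px X0.
have pf : polyfun (fun X => a.[px X] + b.[px X] * pe X) by exists a, b.
have [w0|w0] := eqVneq (a.[x0] + b.[x0] * pe X0) 0; last by exists 0; apply: ord_val_neq0.
have [bx|bx] := eqVneq b.[x0] 0.
  have ax : a.[x0] = 0 by move: w0; rewrite bx mul0r addr0.
  have /factor_theorem [a' ea] : root a x0 by rewrite rootE ax.
  have /factor_theorem [b' eb] : root b x0 by rewrite rootE bx.
  have sz1 (q : {poly L}) : size (q * ('X - x0%:P)) = if q == 0 then 0 else (size q).+1.
    have [->|q0] := eqVneq q 0; first by rewrite mul0r size_poly0.
    by rewrite size_Mmonic ?monicXsubC // size_XsubC addn2.
  have [||n hn] := IHk a' b'.
  - by move=> [a0 b0]; apply: ab0; rewrite ea eb a0 b0 !mul0r.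
  - rewrite -ltnS (leq_trans _ sz) // ltnS ea eb !sz1.
    have := ab0; rewrite ea eb; case: eqVneq => [->|a0]; case: eqVneq => [->|b0] //.
    + by rewrite !mul0r => [[]].
    + by rewrite size_poly0 ltnS.
    + by rewrite size_poly0 !addn0.
    by rewrite addSn addnS ltnS leqnSn.
  eexists; apply: ord_ae (ordM hn (ord_px X00)); apply: ae_all => X.
  by rewrite ea eb !hornerM hornerXsubC -/x0; ring.
have [e0|e0] := eqVneq (pe X0) 0.
  have ax : a.[x0] = 0 by move: w0; rewrite e0 mulr0 addr0.
  have /factor_theorem [a' ea] : root a x0 by rewrite rootE ax.
  have e2 := pe2 X00; rewrite e0 expr0n /= in e2.
  have [q eq_q qx] := cubic_root_factor (esym e2).
  (* At a 2-torsion point, a + b e = e (e a' + q b) / q because e^2 = q (x - x0); the order is 1. *)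
  have h1 : ord (fun X => pe X * a'.[px X] + q.[px X] * b.[px X]) X0 0.
    apply: ord_val_neq0; last by rewrite e0 mul0r add0r mulf_neq0.
    by apply: polyfunD; apply: polyfunM; rewrite ?polyfun_pe //; try apply: polyfun_poly; apply: polyfun_pe.
  have h2 : ord (fun X => pe X) X0 1.
    exists 1; rewrite ?oner_neq0 //; apply: val_ae (val_cst 1 X0).
    by apply: (ae1 (ae_unif X0)) => X; rewrite /unif e0 eqxx exprN1 => t0; rewrite mulfV.
  have h3 : ord (fun X => q.[px X]) X0 0 by apply: ord_val_neq0 => //; apply: polyfun_poly.
  exists (1 + 0 + - 0); apply: ord_ae (ordM (ordM h2 h1) (ordV X00 h3)).
  apply: (ae2 (ae_neq O) (ord_nz X00 h3)) => X hX q0.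
  have := pe2 hX; rewrite eq_q hornerM hornerXsubC => e3.
  apply: (mulIf q0); rewrite mulfVK // ea hornerM hornerXsubC.
  by rewrite mulrDr mulrA -expr2 e3 -/x0; ring.
(* Away from 2-torsion the conjugate a - b e does not vanish at X0, so a + b e has the order of its
   norm, a polynomial in x. *)
have wbar : ord (fun X => a.[px X] - b.[px X] * pe X) X0 0.
  apply: ord_val_neq0; first by apply: polyfunB; [apply: polyfun_poly|];
    apply: polyfunM; [apply: polyfun_poly|apply: polyfun_pe].
  apply: contraNneq bx => h; have : 2 * b.[x0] * pe X0 = 0.
    by rewrite -[RHS](subrr 0) -{1}w0 -h; ring.
  by move/eqP; rewrite !mulf_eq0 (negPf two0) (negPf e0) orbF.
have n0 : norm E a b != 0 by apply/eqP => /norm_eq0.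
have [n hn] := ord_poly_exists X00 n0.
eexists; apply: ord_ae (ordM hn (ordV X00 wbar)).
apply: (ae2 (ae_neq O) (ord_nz X00 wbar)) => X hX w1.
by rewrite normE // mulfK.
Qed.

Lemma ord_exists phi X0 : X0 != O -> rational phi -> ae (fun X => phi X != 0) ->
  exists n, ord phi X0 n.
Proof.
move=> X00 [u [s [hu hs s0 h]]] p0.
have u0 : ae (fun X => u X != 0) by apply: (ae3 s0 p0 h) => X sX pX <-; apply: mulf_neq0.
have [n hn] := ord_polyfun_exists X00 hu u0.
have [m hm] := ord_polyfun_exists X00 hs s0.
exists (n - m); apply: ord_ae (ordM hn (ordV X00 hm)).
by apply: (ae2 s0 h) => X sX <-; rewrite mulrAC mulfV ?mul1r.
Qed.

Lemma regular_or_pole phi X0 : X0 != O -> rational phi ->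
  (exists c, val phi X0 c) \/ val (fun X => (phi X)^-1) X0 0.
Proof.
move=> X00 rphi; case: (rational_zero rphi) => h0.
  by left; exists 0; apply: val_ae (val_cst 0 X0); apply: (ae1 h0) => X ->.
have [n hn] := ord_exists X00 rphi h0; case: (leP 0 n) => hn0.
  by left; apply: ord_ge0_val hn hn0.
by right; apply: ord_pos_val (ordV X00 hn) _; rewrite ?oppr_gt0.
Qed.

(** Multiplying by the conjugate of the denominator turns the denominator into its norm, a
    polynomial in x. *)
Lemma rational_normal phi : rational phi -> exists d a b : {poly L}, d != 0 /\
  ae (fun X => d.[px X] * phi X = a.[px X] + b.[px X] * pe X).
Proof.
move=> [u [s [hu hs s0 h]]].
have [sa [sb es]] := hs; have [ua [ub eu]] := hu.
pose sbar X := sa.[px X] - sb.[px X] * pe X.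
have hsb : polyfun sbar.
  by apply: polyfunB; [|apply: polyfunM]; try apply: polyfun_poly; apply: polyfun_pe.
have [a [b e]] := polyfunM hu hsb.
exists (norm E sa sb), a, b; split.
  apply/eqP => /norm_eq0 [sa0 sb0]; have [X X0 /eqP[]] := ae_ex s0.
  by rewrite es // sa0 sb0 !horner0 mul0r addr0.
apply: (ae2 (ae_neq O) h) => X X0 eX; rewrite normE // -es // -e // -eX /sbar; ring.
Qed.

(** The coordinate ring is integrally closed. In d phi = a + b e, every root of d is a root of a and
    of b, since phi and its conjugate X -> phi(-X) are both regular there; the factor cancels and
    the degree of d drops. *)
Lemma regular_polyfun phi : rational phi -> (forall X, X != O -> exists c, val phi X c) ->
  exists2 psi, polyfun psi & ae (fun X => phi X = psi X).
Proof.
move=> rphi reg; have [d [a [b [d0 hd]]]] := rational_normal rphi.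
have [n] := ubnP (size d); elim: n => // n IHn in d a b d0 hd * => sz.
have [s1|s1] := leqP (size d) 1.
  have [dc edc] : exists dc, d = dc%:P by exists d`_0; apply: size1_polyC.
  have dc0 : dc != 0 by move: d0; rewrite edc polyC_eq0.
  exists (fun X => dc^-1 * (a.[px X] + b.[px X] * pe X)).
    by apply: polyfunM => //; [apply: polyfun_cst|exists a, b].
  by apply: (ae1 hd) => X; rewrite edc hornerC => <-; rewrite mulKf.
have [cl _ _] := gE; have [x /factor_theorem [d' ed]] := closed_root cl s1.
have [X0 [X00 ex]] := point_at E x.
have X00' : popp X0 != O by rewrite popp_neq0.
have [c hc] := reg _ X00; have [c' hc'] := reg _ X00'.
have := val_popp hc'; rewrite poppK => {}hc'.
have dx : d.[px X0] = 0 by rewrite ed hornerM hornerXsubC ex subrr mulr0.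
have hdb : ae (fun X => d.[px X] * phi (popp X) = a.[px X] - b.[px X] * pe X).
  by apply: (ae1 (ae_popp hd)) => X; rewrite popp_px popp_pe => ->; ring.
have vd q : val (fun X : point E => q.[px X]) X0 q.[px X0].
  by apply: val_poly; apply: polyfun_poly.
have ax : a.[px X0] = 0.
  have h1 := valM (vd d) (valD hc hc'); rewrite dx mul0r in h1.
  have h2 := valM (val_cst 2 X0) (vd a).
  have := val_uniq X00 h2 (val_ae _ h1) => h3.
  apply: (mulfI two0); rewrite mulr0 h3 //; apply: (ae2 hd hdb) => X e1 e2.
  by rewrite mulrDr e1 e2; ring.
have h1 := valM (vd d) (valB hc hc'); rewrite dx mul0r in h1.
have e1 : ae (fun X => d.[px X] * (phi X - phi (popp X)) = 2 * (b.[px X] * pe X)).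
  by apply: (ae2 hd hdb) => X e1 e2; rewrite mulrBr e1 e2; ring.
have bx : b.[px X0] = 0.
  have [e0|e0] := eqVneq (pe X0) 0; last first.
    have h2 := valM (val_cst 2 X0) (valM (vd b) (val_poly X0 (@polyfun_pe L E))).
    have /eqP := val_uniq X00 h2 (val_ae e1 h1).
    by rewrite !mulf_eq0 (negPf two0) (negPf e0) orbF => /eqP.
  (* Here e vanishes at X0, so d (phi - conjugate) = 2 b e says nothing about b(x0). Squaring and
     cancelling x - x0 gives 4 b^2 q = (x - x0) d'^2 (phi - conjugate)^2, where q(x0) is
     non-zero. *)
  have e2 := pe2 X00; rewrite e0 expr0n /= in e2.
  have [q eq_q qx] := cubic_root_factor (esym e2).
  have h2 := valM (val_cst 4 X0) (valM (valX 2 (vd b)) (vd q)).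
  have h3 := valM (vd (('X - x%:P) * d' ^+ 2)) (valX 2 (valB hc hc')).
  have := val_uniq X00 h2 (val_ae _ h3).
  rewrite hornerM hornerXsubC ex subrr !mul0r => /(_ _)/eqP.
  rewrite !mulf_eq0 -ex (negPf qx) orbF => h4; apply/eqP; move: h4.
  rewrite -[4]/(2 * 2)%:R natrM mulf_eq0 (negPf two0) /= orbb; apply.
  apply: (ae3 e1 (ae_px_neq x) (ae_neq O)) => X eX; rewrite -subr_eq0 => nx hX.
  have := pe2 hX; rewrite eq_q hornerM hornerXsubC ex => e3.
  apply: (mulfI nx); move: (congr1 (fun z => z ^+ 2) eX).
  rewrite /= ed !expr2 !hornerM !hornerXsubC -!expr2 !exprMn e3 => e4.
  transitivity (d'.[px X] ^+ 2 * (px X - x) ^+ 2 * (phi X - phi (popp X)) ^+ 2).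
    by ring.
  by rewrite e4; ring.
have /factor_theorem [a' ea] : root a x by rewrite rootE -ex ax.
have /factor_theorem [b' eb] : root b x by rewrite rootE -ex bx.
have d'0 : d' != 0 by apply: contraNneq d0; rewrite ed => ->; rewrite mul0r.
apply: (IHn d' a' b') => //.
  apply: (ae2 hd (ae_px_neq x)) => X; rewrite -subr_eq0 => e nx.
  apply: (mulIf nx); move: e; rewrite ed ea eb !hornerM !hornerXsubC => e.
  by rewrite mulrAC e; ring.
by rewrite -ltnS (leq_trans _ sz) // ed size_Mmonic ?monicXsubC // size_XsubC addn2 ltnS.
Qed.

End Orders.
(** * Divisors and the group law *)

Section Divisors.
Variables (L : fieldType) (E : ecurve L).
Let gE := ecurveP E.
Implicit Types (X Y Z A B R : point E) (phi psi u s : point E -> L) (D : point E -> int).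
Notation O := (pzero E).
Notation ae := (@for_almost_all L E).
Notation cubic := (cubic E).

Let two0 : 2 != 0 :> L. Proof. by case: gE => _ /(_ 1%N). Qed.

(* Only affine points: the order at the origin is determined by the others. *)
Definition hasdiv phi D := forall X, X != O -> ord phi X (D X).

Lemma hasdiv_eq phi D D' : (forall X, X != O -> D X = D' X) -> hasdiv phi D -> hasdiv phi D'.
Proof. by move=> e h X X0; rewrite -e //; apply: h. Qed.

Lemma hasdiv_ae phi psi D : ae (fun X => phi X = psi X) -> hasdiv phi D -> hasdiv psi D.
Proof. by move=> e h X X0; apply: ord_ae e (h X X0). Qed.

Lemma hasdivM phi psi D D' : hasdiv phi D -> hasdiv psi D' ->
  hasdiv (fun X => phi X * psi X) (fun X => D X + D' X).
Proof. by move=> h h' X X0; apply: ordM; [apply: h|apply: h']. Qed.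

Lemma hasdivV phi D : hasdiv phi D -> hasdiv (fun X => (phi X)^-1) (fun X => - D X).
Proof. by move=> h X X0; apply: ordV => //; apply: h. Qed.

Lemma hasdivX phi D n : hasdiv phi D -> hasdiv (fun X => phi X ^+ n) (fun X => D X *+ n).
Proof. by move=> h X X0; apply: ordX; apply: h. Qed.

Lemma hasdiv_cst c : c != 0 -> hasdiv (fun=> c) (fun=> 0).
Proof. by move=> c0 X X0; apply: ord_cst. Qed.

Lemma hasdiv_rational phi D : hasdiv phi D -> rational phi.
Proof.
have [X [X0 _]] := point_at E 0.
by move=> h; apply: ord_rational X0 (h X X0).
Qed.

Lemma hasdiv_nz phi D : hasdiv phi D -> ae (fun X => phi X != 0).
Proof.
have [X [X0 _]] := point_at E 0.
by move=> h; apply: ord_nz X0 (h X X0).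
Qed.

Lemma hasdiv_uniq phi D D' X : X != O -> hasdiv phi D -> hasdiv phi D' -> D X = D' X.
Proof. by move=> X0 h h'; apply: ord_uniq X0 (h X X0) (h' X X0). Qed.

Lemma hasdiv_regular phi D : hasdiv phi D -> (forall X, X != O -> 0 <= D X) ->
  exists2 psi, polyfun psi & ae (fun X => phi X = psi X).
Proof.
move=> h D0; apply: regular_polyfun (hasdiv_rational h) _ => X X0.
by apply: ord_ge0_val (h X X0) (D0 X X0).
Qed.

Lemma poly_ae_eq (q r : {poly L}) : ae (fun X => q.[px X] = r.[px X]) -> q = r.
Proof.
move=> h; apply/eqP; rewrite -subr_eq0; apply: contraT => /(@ae_poly _ E) h'.
exfalso; apply: (@ae_const L E); apply: (ae2 h h') => X e.
by rewrite hornerD hornerN e subrr eqxx.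
Qed.

(** The relation at X is multiplied by the one at -X, its conjugate under e -> -e. *)
Lemma norm_mul (a b a' b' q : {poly L}) :
  ae (fun X => (a.[px X] + b.[px X] * pe X) * (a'.[px X] + b'.[px X] * pe X) = q.[px X]) ->
  norm E a b * norm E a' b' = q ^+ 2.
Proof.
move=> h; apply: poly_ae_eq; apply: (ae3 h (ae_popp h) (ae_neq O)) => X e e' X0.
rewrite hornerM !normE // expr2 hornerM -{1}e.
have -> : q.[px X] = (a.[px X] - b.[px X] * pe X) * (a'.[px X] - b'.[px X] * pe X).
  by move: e'; rewrite popp_px popp_pe !mulrN.
by ring.
Qed.

Lemma dl_popp Z X : dl (popp Z) X = dl Z (popp X).
Proof. by rewrite /dl; congr (nat_of_bool _)%:R; apply/eqP/eqP => [->|<-]; rewrite poppK. Qed.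

Lemma dlO X : X != O -> dl O X = 0.
Proof. by rewrite /dl => /negPf->. Qed.

Lemma dl_ge0 Z X : 0 <= dl Z X.
Proof. by rewrite /dl ler0n. Qed.

Lemma dl_refl Z : dl Z Z = 1.
Proof. by rewrite /dl eqxx. Qed.

Lemma dl_gt0 Z X : 0 < dl Z X -> X = Z.
Proof. by rewrite /dl; case: eqP. Qed.

(** The vertical line through Z and -Z. The constant 1 at the origin keeps [hasdiv_vert] valid for
    all Z, as only affine points count. *)
Definition vert Z : {poly L} := if Z == O then 1 else 'X - (px Z)%:P.

Lemma hasdiv_vert Z : hasdiv (fun X => (vert Z).[px X]) (fun X => dl Z X + dl (popp Z) X).
Proof.
move=> X X0; rewrite /vert; have [->|Z0] := eqVneq Z O.
  rewrite poppO dlO // addr0; apply: ord_ae (ord_cst X (oner_neq0 L)).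
  by apply: ae_all => Y; rewrite hornerC.
apply: ord_ae (ord_vertical Z0 X0); apply: ae_all => Y; by rewrite hornerXsubC.
Qed.

Lemma size_vert Z : (0 < size (vert Z) <= 2)%N.
Proof. by rewrite /vert; case: ifP; rewrite ?size_poly1 ?size_XsubC. Qed.

Lemma vert_neq0 Z : vert Z != 0.
Proof. by rewrite -size_poly_gt0; case/andP: (size_vert Z). Qed.

(** A norm of degree at most 2 forces b = 0 and a of degree at most 1. So phi is a constant, and A
    and B are the origin, or a vertical line with divisor (R) + (-R), to be matched with (A) +
    (-B). *)
Lemma small_norm phi (a b : {poly L}) A B : hasdiv phi (fun X => dl A X + dl (popp B) X) ->
  ae (fun X => phi X = a.[px X] + b.[px X] * pe X) -> (size (norm E a b) <= 3)%N -> A = B.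
Proof.
move=> h e /norm_size3 [sa b0].
have {e} e : ae (fun X => phi X = a.[px X]).
  by apply: (ae1 e) => X; rewrite b0 horner0 mul0r addr0.
have a0 : a != 0.
  apply: contraTneq isT => a0; apply/negP => _; apply: (@ae_const L E).
  by apply: (ae2 e (hasdiv_nz h)) => X ->; rewrite a0 horner0 eqxx.
have {e} h := hasdiv_ae e h.
have [s1|s1] := leqP (size a) 1.
  have ea := size1_polyC s1; have c0 : a`_0 != 0 by rewrite -polyC_eq0 -ea.
  have {ea} h0 : hasdiv (fun X => a.[px X]) (fun=> 0).
    by apply: hasdiv_ae (hasdiv_cst c0); apply: ae_all => X; rewrite [in RHS]ea hornerC.
  have AO : A = O.
    apply/eqP; apply: contraT => AO; have := hasdiv_uniq AO h h0.
    rewrite dl_refl => /eqP; rewrite gt_eqF // ltr_wpDr // dl_ge0.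
  have : popp B = O.
    apply/eqP; apply: contraT => BO; have := hasdiv_uniq BO h h0.
    by rewrite dl_refl => /eqP; rewrite gt_eqF // ltr_pwDr // dl_ge0.
  by rewrite AO => /(congr1 (@popp L E)); rewrite poppK poppO.
have [cl _ _] := gE; have [r /factor_theorem [q eq_a]] := closed_root cl s1.
have [R [R0 eR]] := point_at E r.
have q0 : q != 0 by apply: contraNneq a0 => q0; rewrite eq_a q0 mul0r.
have sq : size q = 1%N.
  apply/eqP; rewrite eqn_leq size_poly_gt0 q0 andbT -ltnS.
  by move: sa; rewrite eq_a size_Mmonic ?monicXsubC // size_XsubC addn2.
have eq_q := size1_polyC (eq_leq sq); have c0 : q`_0 != 0 by rewrite -polyC_eq0 -eq_q.
have h1 : hasdiv (fun X => a.[px X]) (fun X => dl R X + dl (popp R) X).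
  apply: hasdiv_eq (fun X _ => add0r _) _.
  apply: hasdiv_ae (hasdivM (hasdiv_cst c0) (hasdiv_vert R)); apply: ae_all => X.
  by rewrite eq_a eq_q hornerM hornerC /vert (negPf R0) eR coefC.
have R0' : popp R != O by rewrite popp_neq0.
have e1 := hasdiv_uniq R0 h h1; have e2 := hasdiv_uniq R0' h h1.
have [RA|RA] := eqVneq R A.
  move: e2; rewrite -RA dl_refl addrC [RHS]addrC => /addIr e2.
  by have /dl_gt0 : 0 < dl (popp B) (popp R) by [rewrite e2]; move/(can_inj (@poppK L E)).
move: e1 e2; rewrite dl_refl [dl A R]/dl (negPf RA) add0r => e1.
have RB : R = popp B by apply: dl_gt0; rewrite e1 ltr_pwDl ?dl_ge0.
rewrite -RB dl_refl addrC => /addrI e2.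
have /dl_gt0 <- : 0 < dl A (popp R) by rewrite e2.
by rewrite RB poppK.
Qed.

(* Multiplying by a vertical line at B and dividing into one at A and one at B
   turns a function with divisor (A) - (B) into two polynomial functions whose
   norms have product of degree at most 4; one of them is constant or vertical. *)
Lemma hasdiv_point_inj phi A B : hasdiv phi (fun X => dl A X - dl B X) -> A = B.
Proof.
move=> h.
have h1 : hasdiv (fun X => phi X * (vert B).[px X]) (fun X => dl A X + dl (popp B) X).
  by apply: hasdiv_eq (hasdivM h (hasdiv_vert B)) => X _; rewrite addrA subrK.
have h2 : hasdiv (fun X => (vert A).[px X] / phi X) (fun X => dl B X + dl (popp A) X).
  apply: hasdiv_eq (hasdivM (hasdiv_vert A) (hasdivV h)) => X _.
  by ring.
have pos Z Z' X : X != O -> 0 <= dl Z X + dl Z' X by move=> _; rewrite addr_ge0 ?dl_ge0.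
have [psi1 [a [b e1]] a1] := hasdiv_regular h1 (pos A (popp B)).
have [psi2 [a' [b' e2]] a2] := hasdiv_regular h2 (pos B (popp A)).
have {e1} a1 : ae (fun X => phi X * (vert B).[px X] = a.[px X] + b.[px X] * pe X).
  by apply: (ae2 a1 (ae_neq O)) => X -> X0; apply: e1.
have {e2} a2 : ae (fun X => (vert A).[px X] / phi X = a'.[px X] + b'.[px X] * pe X).
  by apply: (ae2 a2 (ae_neq O)) => X -> X0; apply: e2.
have e : norm E a b * norm E a' b' = (vert A * vert B) ^+ 2.
  apply: norm_mul; apply: (ae3 a1 a2 (hasdiv_nz h)) => X <- <- p0.
  by rewrite hornerM; field.
have [s3|s3] := leqP (size (norm E a b)) 3; first exact: small_norm h1 a1 s3.
have [s3'|s3'] := leqP (size (norm E a' b')) 3; first exact/esym/(small_norm h2 a2 s3').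
(* Otherwise both norms have degree at least 3, whereas their product is a square of degree at most
   4. *)
exfalso; move/(congr1 (fun q : {poly L} => size q)): e.
rewrite size_mul -?size_poly_gt0 ?(ltn_trans _ s3) ?(ltn_trans _ s3') //.
rewrite expr2 !size_mul ?mulf_neq0 ?vert_neq0 //.
move: s3 s3' (size_vert A) (size_vert B).
case: (size (norm E a b)) => [|[|[|[|k]]]] // _; case: (size (norm E a' b')) => [|[|[|[|k']]]] // _.
by case: (size (vert A)) => [|[|[|]]] // _; case: (size (vert B)) => [|[|[|]]] // _; rewrite /= !addnS.
Qed.

(** Both phi and its inverse are polynomial functions, and their norms multiply to 1; a norm of
    degree 0 comes from a constant. *)
Lemma hasdiv_unit phi : hasdiv phi (fun=> 0) -> exists2 c, c != 0 & ae (fun X => phi X = c).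
Proof.
move=> h; have [psi1 [a [b e1]] a1] := hasdiv_regular h (fun _ _ => lexx 0).
have hV : hasdiv (fun X => (phi X)^-1) (fun=> 0).
  by apply: hasdiv_eq (hasdivV h) => X _; rewrite oppr0.
have [psi2 [a' [b' e2]] a2] := hasdiv_regular hV (fun _ _ => lexx 0).
have e : norm E a b * norm E a' b' = 1 ^+ 2.
  apply: norm_mul; have nz : ae (fun X => phi X != 0 /\ X != O) by apply: (ae2 (hasdiv_nz h) (ae_neq O)).
  apply: (ae3 a1 a2 nz) => X h1 h2 [p0 X0].
  by rewrite -e1 // -e2 // -h1 -h2 hornerC mulfV.
have n0 : norm E a b * norm E a' b' != 0 by rewrite e expr1n oner_neq0.
move: (n0); rewrite mulf_eq0 negb_or => /andP[n1 n2].
have sN : (size (norm E a b) <= 2)%N.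
  have := congr1 (fun q : {poly L} => size q) e; rewrite expr1n size_poly1 size_mul //.
  move: n1 n2; rewrite -!size_poly_gt0.
  by case: (size (norm E a b)) => [|[|n]] //; case: (size (norm E a' b')) => // n' _ _; rewrite addnS.
have [sa b0] := norm_size2 sN.
have hc : ae (fun X => phi X = a`_0).
  apply: (ae2 a1 (ae_neq O)) => X -> X0.
  by rewrite e1 // b0 horner0 mul0r addr0 (size1_polyC sa) hornerC coefC.
exists a`_0 => //; apply/eqP => c0; apply: (@ae_const L E).
by apply: (ae2 hc (hasdiv_nz h)) => X ->; rewrite c0 eqxx.
Qed.

Lemma hasdiv_same phi psi D : hasdiv phi D -> hasdiv psi D ->
  exists2 c, c != 0 & ae (fun X => phi X = c * psi X).
Proof.
move=> h h'; have [|c c0 hc] := @hasdiv_unit (fun X => phi X / psi X).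
  by apply: hasdiv_eq (hasdivM h (hasdivV h')) => X _; rewrite subrr.
exists c => //; apply: (ae2 hc (hasdiv_nz h')) => X <- p0; by rewrite divfK.
Qed.

(** The product l(X) l(-X) is, up to sign, a product of three vertical lines of known divisor. If
    l(-X) is non-zero, this gives the order of l at X; if both factors vanish, X = -X and the
    product has twice the order of l. *)
Lemma hasdiv_line Z1 Z2 Z3 (m k : L) : Z1 != O -> Z2 != O -> Z3 != O ->
  pe Z1 = m * px Z1 + k -> pe Z2 = m * px Z2 + k -> pe Z3 = m * px Z3 + k ->
  (forall x, (m * x + k) ^+ 2 - cubic.[x] = - ((x - px Z1) * (x - px Z2) * (x - px Z3))) ->
  hasdiv (fun X => pe X - (m * px X + k)) (fun X => dl Z1 X + dl Z2 X + dl Z3 X).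
Proof.
move=> Z10 Z20 Z30 e1 e2 e3 eP; pose l X := pe X - (m * px X + k).
have pl : polyfun l.
  apply: polyfunB; first exact: polyfun_pe.
  apply: polyfunD; last exact: polyfun_cst.
  by apply: polyfunM; [apply: polyfun_cst|apply: polyfun_px].
have plb := polyfun_popp pl.
have lb X : X != O -> l X * l (popp X) = - ((px X - px Z1) * (px X - px Z2) * (px X - px Z3)).
  by move=> X0; rewrite -eP -pe2 // /l popp_px popp_pe; ring.
have on X : X != O -> l X = 0 -> [|| X == Z1, X == Z2 | X == Z3].
  move=> X0 lX; have ex : pe X = m * px X + k by apply/eqP; rewrite -subr_eq0 -/(l X) lX.
  have := lb X X0; rewrite lX mul0r => /esym/eqP; rewrite oppr_eq0 !mulf_eq0 !subr_eq0 -orbA.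
  by case/or3P => /eqP e; apply/or3P; [constructor 1|constructor 2|constructor 3];
     apply/eqP/point_inj; rewrite // ex ?e1 ?e2 ?e3 e.
have off X : X != O -> l X != 0 -> dl Z1 X + dl Z2 X + dl Z3 X = 0.
  move=> X0; rewrite /dl; have [->|_] := eqVneq X Z1; first by rewrite /l e1 subrr eqxx.
  have [->|_] := eqVneq X Z2; first by rewrite /l e2 subrr eqxx.
  by have [->|_] := eqVneq X Z3; first by rewrite /l e3 subrr eqxx.
move=> X X0; have X0' : popp X != O by rewrite popp_neq0.
have [lX|lX] := eqVneq (l X) 0; last by rewrite off //; apply: ord_val_neq0.
have hP : ord (fun Y => l Y * l (popp Y)) X (dl Z1 X + dl Z2 X + dl Z3 X +
                                         (dl Z1 (popp X) + dl Z2 (popp X) + dl Z3 (popp X))).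
  have := ordM (ord_cst X (_ : -1 != 0)) (ordM (ordM (ord_vertical Z10 X0)
    (ord_vertical Z20 X0)) (ord_vertical Z30 X0)).
  rewrite oppr_eq0 oner_eq0 => /(_ isT) h.
  rewrite -!dl_popp; set n := (n in ord _ _ n) in h; set n' := (n in ord _ _ n).
  have <- : n = n' by rewrite /n /n'; ring.
  by apply: ord_ae h; apply: (ae1 (ae_neq O)) => Y Y0; rewrite lb // mulN1r.
have nzP := ord_nz X0 hP.
have nzl : ae (fun X => l X != 0).
  by apply: (ae1 nzP) => Y; rewrite mulf_eq0 negb_or => /andP[].
have [n hn] := ord_polyfun_exists X0 pl nzl.
have hn' : ord (fun Y => l (popp Y)) (popp X) n by apply: ord_popp.
have [lX'|lX'] := eqVneq (l (popp X)) 0; last first.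
  have h0 : ord (fun Y => l (popp Y)) X 0 by apply: ord_val_neq0.
  have := ord_uniq X0 hP (ordM hn h0); rewrite (off _ X0' lX') !addr0 => ->.
  exact: hn.
have pX : popp X = X.
  apply: pe0_popp => //; apply: (mulfI two0); rewrite mulr0.
  have := congr2 (fun a b => a - b) lX lX'; rewrite /l popp_px popp_pe subrr => <-; ring.
rewrite pX in hn' hP; have := ord_uniq X0 hP (ordM hn hn').
rewrite -!mulr2n => e; suff -> : dl Z1 X + dl Z2 X + dl Z3 X = n by [].
apply/eqP; move/eqP: e; rewrite -subr_eq0 -mulrnBl mulrn_eq0 /= subr_eq0; exact.
Qed.

Lemma padd_line X Y : X != O -> Y != O -> Y != popp X ->
  exists m k, [/\ padd X Y != O, pe X = m * px X + k, pe Y = m * px Y + k,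
    - pe (padd X Y) = m * px (padd X Y) + k &
    forall x, (m * x + k) ^+ 2 - cubic.[x]
            = - ((x - px X) * (x - px Y) * (x - px (padd X Y)))].
Proof.
move=> X0 Y0 nYX.
(* These relations hold for the chord and for the tangent alike, and suffice for comparing
   coefficients; [cC] is eliminated because X lies on the curve. *)
have [m [S0 e1 e2 [e3 e4]]] : exists m, [/\ padd X Y != O,
    px (padd X Y) = m ^+ 2 - cA E - px X - px Y,
    pe (padd X Y) = - (m * (px (padd X Y) - px X) + pe X) &
    pe Y = pe X + m * (px Y - px X) /\
    cB E = m * (2 * pe X + m * (px Y - px X))
           - (px Y ^+ 2 + px X * px Y + px X ^+ 2 + cA E * (px X + px Y))].
  have [e|ne] := eqVneq (px X) (px Y).
    have eY : Y = X by case: (px_eq X0 Y0 e) => // eY; rewrite eY eqxx in nYX.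
    have p0 : pe X != 0 by apply: contraNneq nYX => p0; rewrite eY pe0_popp.
    rewrite eY; have [S0 e1 e2] := padd_tangent X0 p0; eexists; split; eauto.
    split; first by ring.
    rewrite cubic_deriv; field; by rewrite two0 p0.
  have nx : px Y - px X != 0 by rewrite subr_eq0 eq_sym.
  have [S0 e1 e2] := padd_chord X0 Y0 ne; eexists; split; eauto.
  split; first by field.
  have h1 := pe2 X0; have h2 := pe2 Y0; rewrite !cubicE in h1 h2.
  apply: (mulIf nx); rewrite mulrBl.
  have -> (q : L) : (pe Y - pe X) / (px Y - px X) * (2 * pe X + q) * (px Y - px X)
      = (pe Y - pe X) * (2 * pe X + q) by field.
  rewrite divfK //.
  have -> : (pe Y - pe X) * (2 * pe X + (pe Y - pe X)) = pe Y ^+ 2 - pe X ^+ 2 by ring.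
  by rewrite h1 h2; ring.
exists m, (pe X - m * px X); split=> //; [by ring|by rewrite e3; ring|by rewrite e2; ring|].
move=> x; have eC : cC E = pe X ^+ 2 - px X ^+ 3 - cA E * px X ^+ 2 - cB E * px X.
  by rewrite pe2 // cubicE; ring.
by rewrite cubicE eC e4 e1; ring.
Qed.

(** The line through X and Y divided by the vertical line through X + Y. *)
Lemma hasdiv_add X Y :
  exists phi, hasdiv phi (fun Z => dl X Z + dl Y Z - dl (padd X Y) Z).
Proof.
have [->|X0] := eqVneq X O.
  exists (fun=> 1); rewrite add0p; apply: hasdiv_eq (hasdiv_cst (oner_neq0 L)) => Z Z0.
  by rewrite dlO // add0r subrr.
have [->|Y0] := eqVneq Y O.
  exists (fun=> 1); rewrite addp0; apply: hasdiv_eq (hasdiv_cst (oner_neq0 L)) => Z Z0.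
  by rewrite dlO // addr0 subrr.
have [->|nYX] := eqVneq Y (popp X).
  eexists; apply: hasdiv_eq (hasdiv_vert X) => Z Z0.
  by rewrite addpN dlO // subr0.
have [m [k [S0 e1 e2 e3 eP]]] := padd_line X0 Y0 nYX.
have S0' : popp (padd X Y) != O by rewrite popp_neq0.
have h := @hasdiv_line X Y (popp (padd X Y)) m k X0 Y0 S0' e1 e2.
rewrite popp_px popp_pe in h; have {}h := h e3 eP.
eexists; apply: hasdiv_eq (hasdivM h (hasdivV (hasdiv_vert (padd X Y)))) => Z Z0.
ring.
Qed.

Lemma paddC : commutative (@padd L E).
Proof.
move=> X Y; have [f hf] := hasdiv_add X Y; have [g hg] := hasdiv_add Y X.
apply/esym; apply: hasdiv_point_inj (hasdiv_eq _ (hasdivM hf (hasdivV hg))) => Z _.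
ring.
Qed.

(** In the quotient of the functions attached to the two bracketings, everything cancels but (X + (Y
    + Z)) - ((X + Y) + Z). *)
Lemma paddA : associative (@padd L E).
Proof.
move=> X Y Z.
have [f1 h1] := hasdiv_add X Y; have [f2 h2] := hasdiv_add (padd X Y) Z.
have [f3 h3] := hasdiv_add Y Z; have [f4 h4] := hasdiv_add X (padd Y Z).
have h := hasdivM (hasdivM h1 h2) (hasdivV (hasdivM h3 h4)).
apply: hasdiv_point_inj (hasdiv_eq _ h) => W _; ring.
Qed.

End Divisors.

(** * The abelian group of points *)

Section GroupStructure.
Variables (L : fieldType) (E : ecurve L).
Lemma addNp : left_inverse (pzero E) (@popp L E) (@padd L E).
Proof. by move=> X; rewrite paddC addpN. Qed.

HB.instance Definition _ :=
  GRing.isZmodule.Build (point E) (@paddA L E) (@paddC L E) (@add0p L E) addNp.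
End GroupStructure.

(** * Multiplication by n as a rational map *)

Section RationalMaps.
Variables (L : fieldType) (E : ecurve L).
Let gE := ecurveP E.
Implicit Types (X Y Z S : point E) (phi psi : point E -> L) (M N : point E -> point E).
Implicit Types (A B : point E -> Prop).
Notation ae := (@for_almost_all L E).
Notation cubic := (cubic E).

Let four0 : 4 != 0 :> L. Proof. by case: gE => _ /(_ 3%N). Qed.

Lemma paddE X Y : padd X Y = X + Y. Proof. by []. Qed.
Lemma poppE X : popp X = - X. Proof. by []. Qed.

Lemma pmulE n X : pmul n X = X *+ n.
Proof. by elim: n => // n IHn; rewrite mulrS -IHn. Qed.

Lemma torsionE n X : torsion n X = (X *+ n == 0).
Proof. by rewrite /torsion pmulE. Qed.

Lemma rational_horner phi (q : {poly L}) : rational phi -> rational (fun X => q.[phi X]).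
Proof.
move=> h; elim/poly_ind: q => [|q d IHq].
  by apply: rational_ae (rational_cst 0); apply: ae_all => X; rewrite horner0.
apply: rational_ae (rationalD (rationalM IHq h) (rational_cst d)).
by apply: ae_all => X; rewrite hornerMXaddC.
Qed.

(** The last clause, finiteness of the fibres, is what lets statements about almost all points be
    pulled back along [M]. *)
Definition ratmap M :=
  [/\ rational (fun X => px (M X)), rational (fun X => pe (M X))
    & forall Z, ae (fun X => M X != Z)].

Lemma ratmap_ae M A : ratmap M -> ae A -> ae (fun X => A (M X)).
Proof.
move=> [_ _ fin] [s hs]; suff h : ae (fun X => M X \notin s) by apply: (ae1 h) => X /hs.
elim: s {hs} => [|Z s IHs]; first exact: ae_all.
by apply: (ae2 (fin Z) IHs) => X nZ ns; rewrite inE negb_or nZ.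
Qed.

Lemma ratmap_comp M phi : ratmap M -> rational phi -> rational (fun X => phi (M X)).
Proof.
move=> hM; have [hx he _] := hM.
have pr u : polyfun u -> rational (fun X => u (M X)).
  move=> [a [b e]].
  have h := rationalD (rational_horner a hx) (rationalM (rational_horner b hx) he).
  apply: rational_ae h; apply: (ae1 (ratmap_ae hM (ae_neq (pzero E)))) => X X0.
  by rewrite e.
move=> [u [s [/pr hu /pr hs s0 e]]].
apply: rational_ae (rationalM hu (rationalV hs)).
apply: (ae2 (ratmap_ae hM s0) (ratmap_ae hM e)) => X s1 <-.
by rewrite mulrC mulKf.
Qed.

Lemma ratmap_id : ratmap id.
Proof. by split; [apply: rational_px|apply: rational_pe|move=> Z; apply: ae_neq]. Qed.

Lemma ratmap_opp : ratmap -%R.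
Proof.
split.
- by apply: rational_ae rational_px; apply: ae_all => X; rewrite -poppE popp_px.
- apply: rational_ae (rationalN rational_pe); apply: ae_all => X.
  by rewrite -poppE popp_pe.
by move=> Z; apply: (ae1 (ae_neq (- Z))) => X; rewrite eqr_oppLR.
Qed.

Lemma ratmap_comp2 M N : ratmap M -> ratmap N -> ratmap (fun X => M (N X)).
Proof.
move=> [h1 h2 h3] hN; split.
- exact: (ratmap_comp hN h1).
- exact: (ratmap_comp hN h2).
by move=> Z; apply: (ratmap_ae hN (h3 Z)).
Qed.

Lemma rational_sum M N : rational (fun X => px (M X)) -> rational (fun X => pe (M X)) ->
  rational (fun X => px (N X)) -> rational (fun X => pe (N X)) ->
  ae (fun X => [/\ M X != 0, N X != 0 & px (M X) != px (N X)]) ->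
  rational (fun X => px (M X + N X)) /\ rational (fun X => pe (M X + N X)).
Proof.
move=> hx he hx' he' ne.
have hl := rationalM (rationalB he' he) (rationalV (rationalB hx' hx)).
have h1 : rational (fun X => px (M X + N X)).
  have h := rationalB (rationalB (rationalB (rationalX 2 hl) (rational_cst (cA E))) hx) hx'.
  apply: rational_ae h; apply: (ae1 ne) => X [MX NX nx].
  by have [_ ->] := padd_chord MX NX nx.
split=> //.
apply: rational_ae (rationalN (rationalD (rationalM hl (rationalB h1 hx)) he)).
by apply: (ae1 ne) => X [MX NX nx]; have [_ _ ->] := padd_chord MX NX nx.
Qed.

Lemma ratmap_add S : ratmap (fun X => X + S).
Proof.
have fin Z : ae (fun X => X + S != Z).
  by apply: (ae1 (ae_neq (Z - S))) => X; rewrite -[Z in _ + _ != Z](subrK S) (inj_eq (addIr _)).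
have [S0|S0] := eqVneq S 0.
  by split=> //; [apply: rational_ae rational_px|apply: rational_ae rational_pe];
    apply: ae_all => X; rewrite S0 addr0.
have [|h1 h2] := @rational_sum id (fun=> S) rational_px rational_pe
                   (rational_cst (px S)) (rational_cst (pe S)); last by split.
by apply: (ae2 (ae_neq (pzero E)) (ae_px_neq (px S))) => X.
Qed.

(** By the duplication formula, x(2X) = x(Y) amounts to f'(x)^2 = 4 f(x) (2x + w), with f the cubic
    and w = cA + x(Y): a monic quartic equation in x. *)
Lemma double_surj Y : exists X, X + X = Y.
Proof.
have [->|Y0] := eqVneq Y 0; first by exists 0; rewrite addr0.
have [cl _ _] := gE; pose a := cA E; pose b := cB E; pose c := cC E; pose w := a + px Y.
have [x hx] := cl 4%N (fun i => - nth 0 [:: b ^+ 2 - 4 * c * w; 4 * a * b - 8 * c - 4 * b * w;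
                        4 * a ^+ 2 - 2 * b - 4 * a * w; 4 * a - 4 * w] i) isT.
have {hx} hx : cubic^`().[x] ^+ 2 = 4 * cubic.[x] * (2 * x + w).
  rewrite !big_ord_recr big_ord0 /= in hx.
  apply/eqP; rewrite -subr_eq0 cubic_deriv cubicE -/a -/b -/c.
  have -> : (3 * x ^+ 2 + 2 * a * x + b) ^+ 2 - 4 * (x ^+ 3 + a * x ^+ 2 + b * x + c) * (2 * x + w)
     = x ^+ 4 + (4 * a - 4 * w) * x ^+ 3 + (4 * a ^+ 2 - 2 * b - 4 * a * w) * x ^+ 2
       + (4 * a * b - 8 * c - 4 * b * w) * x + (b ^+ 2 - 4 * c * w) by ring.
  by rewrite hx; apply/eqP; ring.
have [X [X0 eX]] := point_at E x.
(* If f(x) = 0, the quartic equation would give f'(x) = 0 too. *)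
have p0 : pe X != 0.
  apply/eqP => p0; have := pe2 X0; rewrite p0 expr0n /= eX => /esym f0.
  by move: hx; rewrite f0 mulr0 mul0r => /eqP; rewrite sqrf_eq0 (negPf (cubic_sep f0)).
have [S0 e1 _] := padd_tangent X0 p0.
have e : px (X + X) = px Y.
  rewrite -paddE e1 exprMn exprVn exprMn eX hx -eX -pe2 //.
  by rewrite /w -/a; field; rewrite p0 four0.
case: (px_eq S0 Y0 e) => ->; first by exists X.
by exists (- X); rewrite poppE opprD.
Qed.

Lemma mulrn_gcd (V : zmodType) (x : V) m n : x *+ m = 0 -> x *+ n = 0 -> x *+ gcdn m n = 0.
Proof.
move=> hm hn; have [->|m0] := posnP m; first by rewrite gcd0n.
have [a _ /dvdnP [q e]] := Bezoutl n m0.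
have : x *+ (gcdn m n + a * n) = 0 by rewrite e mulnC mulrnA hm mul0rn.
by rewrite mulrnDr mulnC mulrnA hn mul0rn addr0.
Qed.

Lemma order_two_power (V : zmodType) (x : V) j n :
  x *+ 2 ^ j.+1 = 0 -> x *+ 2 ^ j != 0 -> x *+ n = 0 -> (2 ^ j.+1 %| n)%N.
Proof.
move=> h1 h2 h3; have h4 := mulrn_gcd h1 h3.
have /(dvdn_pfactor _ _ (isT : prime 2)) [i ij e] := dvdn_gcdl (2 ^ j.+1) n.
move: ij; rewrite leq_eqVlt => /orP[/eqP ij|ij]; first by rewrite -{1}ij -e dvdn_gcdr.
by rewrite ltnS in ij; move: h2; rewrite -(subnK ij) expnD mulnC mulrnA -e h4 mul0rn eqxx.
Qed.

Lemma exists_order_two_power j : exists X, X *+ 2 ^ j.+1 = 0 /\ X *+ 2 ^ j != 0.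
Proof.
elim: j => [|j [X [h1 h2]]].
  have [cl _ _] := gE.
  have [|e /eqP he] := @closed_root L cl cubic; first by rewrite size_cubic.
  have [|X [X0 eX pX]] := @point_of L E e 0; first by rewrite he expr0n.
  by exists X; rewrite expn1 mulr2n -{2}(pe0_popp X0 pX) poppE subrr.
have [Y eY] := double_surj X; exists Y.
by rewrite expnS mulrnA mulr2n eY h1 [in X in X != _]expnS mulrnA mulr2n eY h2.
Qed.

Lemma big_order_two_power (s : seq (point E)) (N : nat) :
  exists X j, [/\ (N <= j)%N, X \notin s, X *+ 2 ^ j.+1 = 0 & X *+ 2 ^ j != 0].
Proof.
have [F hF] := choice exists_order_two_power.
have injF : injective F.
  have aux i j : F i = F j -> (i <= j)%N.
    move=> e; have [h1 h2] := hF i; have [h3 _] := hF j; rewrite -e in h3.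
    by have := order_two_power h1 h2 h3; rewrite dvdn_Pexp2l // ltnS.
  by move=> i j e; apply/eqP; rewrite eqn_leq !aux.
apply/not_existsP => h.
have sub : {subset [seq F j | j <- iota N (size s).+1] <= s}.
  move=> X /mapP [j]; rewrite mem_iota => /andP[Nj _] ->.
  apply/negPn/negP => Fs; apply: (h (F j)); exists j; have [h1 h2] := hF j; by split.
have := uniq_leq_size (etrans (map_inj_uniq injF _) (iota_uniq _ _)) sub.
by rewrite size_map size_iota ltnn.
Qed.

(** A point whose order is a power of 2 above m + 1 is killed neither by m - 1 nor by m + 1. *)
Lemma mulrn_not_pm m : (1 < m)%N -> ~ ae (fun X => X *+ m = X \/ X *+ m = - X).
Proof.
move=> m1 [s hs]; have [X [j [mj Xs h1 h2]]] := big_order_two_power s m.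
have lt : (m.+1 < 2 ^ j.+1)%N.
  by rewrite (leq_trans _ (ltn_expl _ _)) // ltnS.
have [k em] : exists k, m = k.+2 by case: m m1 {hs mj lt} => [|[|k]] // _; exists k.
case: (hs X Xs) => e.
  have /(order_two_power h1 h2)/dvdn_leq : X *+ m.-1 = 0.
    by move: e; rewrite em /= [X *+ k.+2]mulrS => /eqP; rewrite -subr_eq0 addrAC subrr add0r => /eqP.
  rewrite em /= => /(_ isT); rewrite leqNgt; rewrite em in lt.
  by rewrite (ltn_trans _ lt) // ltnS.
have /(order_two_power h1 h2)/dvdn_leq : X *+ m.+1 = 0 by rewrite mulrS e subrr.
by move=> /(_ isT); rewrite leqNgt lt.
Qed.

(** A non-empty fibre is a translate of the kernel. *)
Lemma mulrn_fiber n : ae (fun X => X *+ n != 0) -> forall Z, ae (fun X => X *+ n != Z).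
Proof.
move=> h Z; have [[X1 e]|ne] := pselect (exists X1, X1 *+ n = Z).
  apply: (ae1 (ratmap_ae (ratmap_add (- X1)) h)) => X.
  by rewrite mulrnBl e subr_eq0.
by apply: ae_all => X; apply/eqP => e; apply: ne; exists X.
Qed.

(** Doubling uses the tangent formula; afterwards the chord formula applies to X and nX, because
    x(X) = x(nX) almost everywhere would mean nX = X or nX = -X, against [mulrn_not_pm]. *)
Lemma ratmap_mulrn n : (0 < n)%N -> ratmap (fun X => X *+ n).
Proof.
have O0 := @ae_neq L E 0.
case: n => // n _; elim: n => [|n IHn]; first exact: ratmap_id.
have [hx he fin] := IHn.
suff [h1 h2 h3] : [/\ rational (fun X => px (X *+ n.+2)),
                      rational (fun X => pe (X *+ n.+2)) & ae (fun X => X *+ n.+2 != 0)].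
  by split=> //; apply: mulrn_fiber.
case: n => [|n] in IHn hx he fin *.
  have hl := rationalM (rationalM (rational_cst 2^-1) (rational_poly (polyfun_poly cubic^`())))
                       (rationalV (@rational_pe L E)).
  have eX := @padd_tangent L E.
  have h1 : rational (fun X => px (X *+ 2)).
    have h := rationalB (rationalB (rationalB (rationalX 2 hl) (rational_cst (cA E)))
      rational_px) rational_px.
    apply: rational_ae h; apply: (ae2 O0 (@ae_pe L E)) => X X0 p0.
    rewrite (mulr2n X) -paddE; have [_ -> _] := eX X X0 p0.
    by rewrite invfM; congr (_ - _ - _ - _); ring.
  split=> //.
    apply: rational_ae (rationalN (rationalD (rationalM hl (rationalB h1 rational_px)) rational_pe)).
    apply: (ae2 O0 (@ae_pe L E)) => X X0 p0.
    rewrite (mulr2n X) -paddE; have [_ _ ->] := eX X X0 p0.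
    by rewrite invfM; congr (- (_ + _)); ring.
  apply: (ae2 O0 (@ae_pe L E)) => X X0 p0.
  by rewrite (mulr2n X); have [] := eX X X0 p0.
have ne : ae (fun X => px X != px (X *+ n.+2)).
  case: (rational_eq rational_px hx) => // e; exfalso.
  apply: (@mulrn_not_pm n.+2) => //; apply: (ae3 O0 e (fin 0)) => X X0 eX nX.
  exact: px_eq X0 nX eX.
have [|h1 h2] := @rational_sum id (fun X => X *+ n.+2) rational_px rational_pe hx he.
  by apply: (ae3 O0 ne (fin 0)) => X X0 eX nX.
split.
- by apply: rational_ae h1; apply: ae_all => X; rewrite mulrS.
- by apply: rational_ae h2; apply: ae_all => X; rewrite mulrS.
apply: (ae1 ne) => X; apply: contraNneq; rewrite mulrS => /eqP.
by rewrite addr_eq0 => /eqP {1}->; rewrite -poppE popp_px.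
Qed.

End RationalMaps.
(** * Descent of invariant functions along multiplication by n *)

Section RatioDescent.
Variable L : fieldType.
Hypothesis closedL : GRing.closed_field_axiom L.
Hypothesis charL : forall n, n.+1%:R != 0 :> L.
Implicit Types (A B a b d q : {poly L}) (C : {poly {poly L}}) (rs U : seq L).

Lemma deriv_eq0 q : q^`() = 0 -> (size q <= 1)%N.
Proof.
move=> h; apply/leq_sizeP => -[//|i] _; have := coef_deriv q i.
by rewrite h coef0 => /esym/eqP; rewrite -mulr_natr mulf_eq0 (negPf (charL i)) orbF => /eqP.
Qed.

Lemma poly_roots q : q != 0 -> exists rs, forall x, root q x -> x \in rs.
Proof.
move=> q0; have [rs e] := closed_split closedL q; exists rs => x.
by rewrite e rootZ ?lead_coef_eq0 // root_prod_XsubC.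
Qed.

Lemma poly_fin_eq0 q rs : (forall x, x \notin rs -> q.[x] = 0) -> q = 0.
Proof.
move=> h; apply/eqP; apply: contraT => q0; have [rs' h'] := poly_roots q0.
have [x] := fresh_elt charL (rs ++ rs').
rewrite mem_cat negb_or => /andP[/h e /negP []].
by apply: h'; rewrite rootE e.
Qed.

Lemma coprimep_closed A B : (forall x, A.[x] = 0 -> B.[x] != 0) -> coprimep A B.
Proof.
move=> h; rewrite coprimep_def; have [s1|s1|//] := ltngtP (size (gcdp A B)) 1.
  move: s1; rewrite ltnS leqn0 size_poly_eq0 gcdp_eq0 => /andP[/eqP A0 /eqP B0].
  by have := h 0; rewrite A0 B0 horner0 eqxx => /(_ erefl).
have [x] := closed_root closedL s1; rewrite root_gcd => /andP[/eqP /h + hB].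
by rewrite (eqP hB) eqxx.
Qed.

Variables (A B : {poly L}).
Hypothesis cop : coprimep A B.

Let cop_root x : A.[x] = 0 -> B.[x] != 0.
Proof.
move=> hA; apply/negP => hB; have : root (gcdp A B) x by rewrite root_gcd !rootE hA eqxx.
by move: cop; rewrite coprimep_def => /size_poly1P [c c0 ->]; rewrite rootC (negPf c0).
Qed.

(* A(t) - u B(t), as a polynomial in t over L[u] *)
Definition pencil : {poly {poly L}} := map_poly polyC A - 'X *: map_poly polyC B.

Definition eval2 (u t : L) C : L := C.[t%:P].[u].

Lemma eval2D u t C C' : eval2 u t (C + C') = eval2 u t C + eval2 u t C'.
Proof. by rewrite /eval2 !hornerD. Qed.
Lemma eval2M u t C C' : eval2 u t (C * C') = eval2 u t C * eval2 u t C'.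
Proof. by rewrite /eval2 !hornerM. Qed.
Lemma eval2Z u t d C : eval2 u t (d *: C) = d.[u] * eval2 u t C.
Proof. by rewrite /eval2 hornerZ hornerM. Qed.
Lemma eval2C u t d : eval2 u t d%:P = d.[u].
Proof. by rewrite /eval2 hornerC. Qed.
Lemma eval2_map u t d : eval2 u t (map_poly polyC d) = d.[t].
Proof. by rewrite /eval2 horner_map /= hornerC. Qed.

Lemma eval2_pencil u t : eval2 u t pencil = A.[t] - u * B.[t].
Proof.
by rewrite /pencil -scaleNr eval2D eval2Z !eval2_map hornerN hornerX mulNr.
Qed.

Lemma pencil_root_neq0 x : pencil.[x%:P] != 0.
Proof.
apply/eqP => h; have e u : A.[x] - u * B.[x] = 0.
  by rewrite -eval2_pencil /eval2 h horner0.
have e0 := e 0; rewrite mul0r subr0 in e0.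
have := e 1; rewrite e0 mul1r sub0r => /eqP; rewrite oppr_eq0.
by rewrite (negPf (cop_root e0)).
Qed.

(** d(t) is invertible modulo the pencil over L(u): at a root x of d the pencil is A(x) - u B(x), a
    non-zero polynomial in u by coprimality. The roots of d are treated one at a time. *)
Lemma bezout_pencil d : d != 0 -> exists C C' b,
  b != 0 /\ C * map_poly polyC d + C' * pencil = b%:P.
Proof.
have [n] := ubnP (size d); elim: n => // n IHn in d * => sz d0.
have [s1|s1] := leqP (size d) 1.
  exists 1, 0, d; split=> //; rewrite mul1r mul0r addr0.
  by rewrite (size1_polyC s1) map_polyC.
have [x /factor_theorem [q eq_d]] := closed_root closedL s1.
have q0 : q != 0 by apply: contraNneq d0; rewrite eq_d => ->; rewrite mul0r.
have [|C [C' [b [b0 e]]]] := IHn q _ q0.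
  by rewrite -ltnS (leq_trans _ sz) // eq_d size_Mmonic ?monicXsubC // size_XsubC addn2 ltnS.
set g := pencil.[x%:P].
have /factor_theorem [Q eQ] : root (pencil - g%:P) x%:P.
  by rewrite rootE hornerD hornerN hornerC subrr.
exists (- Q * C), (b%:P + g%:P * C' - pencil * C'), (g * b); split.
  by rewrite mulf_neq0 ?pencil_root_neq0.
rewrite eq_d rmorphM /= map_polyXsubC polyCM.
transitivity ((g%:P - pencil) * (C * map_poly polyC q) + (b%:P + g%:P * C' - pencil * C') * pencil).
  by rewrite -[g%:P - pencil]opprB eQ; ring.
have -> : C * map_poly polyC q = b%:P - C' * pencil by rewrite -e addrK.
by ring.
Qed.

Lemma pencil_neq0 : pencil != 0.
Proof. by have := pencil_root_neq0 0; apply: contraNneq => ->; rewrite horner0. Qed.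

(* 1, t, ..., t^(n-1) span L(t) over L(A/B), where n is the degree of A/B. *)
Lemma pencil_repr a d : d != 0 -> exists b C, [/\ b != 0, (size C < size pencil)%N &
  forall u t, A.[t] = u * B.[t] -> b.[u] * a.[t] = d.[t] * eval2 u t C].
Proof.
move=> d0; have [C [C' [b [b0 e]]]] := bezout_pencil d0.
pose W := C * map_poly polyC a.
exists (lead_coef pencil ^+ scalp W pencil * b), (W %% pencil); split.
- by rewrite mulf_neq0 // expf_neq0 // lead_coef_eq0 pencil_neq0.
- by rewrite ltn_modp pencil_neq0.
move=> u t ht; have g0 : eval2 u t pencil = 0 by rewrite eval2_pencil ht subrr.
have := congr1 (eval2 u t) (Pdiv.Idomain.divp_eq W pencil).
rewrite eval2Z eval2D !eval2M g0 mulr0 add0r => <-.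
have := congr1 (eval2 u t) e; rewrite eval2D !eval2M g0 mulr0 addr0 eval2C !eval2_map => eb.
by rewrite hornerM -eb; ring.
Qed.

Lemma pencil_map u : map_poly (horner_eval u) pencil = A - u *: B.
Proof.
apply/polyP => i; rewrite coef_map /pencil !coefB coefZ !coef_map /= /horner_eval.
by rewrite coefZ hornerD hornerN hornerM hornerX !hornerC.
Qed.

Hypothesis nonconst : (1 < size pencil)%N.

(** If A' B = A B', coprimality makes A divide A' and B divide B'; in characteristic 0 both are then
    constant. *)
Lemma wronskian_neq0 : A^`() * B - A * B^`() != 0.
Proof.
apply/negP; rewrite subr_eq0 => /eqP e.
have div0 q : q %| q^`() -> (size q <= 1)%N.
  move=> h; apply: deriv_eq0; apply/eqP; apply: contraTT h => h.
  have q0 : q != 0 by apply: contraNneq h => ->; rewrite deriv0.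
  by apply: contraL (lt_size_deriv q0) => /dvdp_leq -/(_ h); rewrite -leqNgt.
have sA : (size A <= 1)%N.
  by apply: div0; rewrite -(Gauss_dvdpl _ cop) e dvdp_mulr.
have sB : (size B <= 1)%N.
  by apply: div0; rewrite -(Gauss_dvdpr _ (_ : coprimep B A)) 1?coprimep_sym // -e dvdp_mull.
move: nonconst; rewrite ltnNge => /negP; apply.
rewrite /pencil (size1_polyC sA) (size1_polyC sB) !map_polyC /=.
by rewrite -mul_polyC -polyCM -polyCB size_polyC_leq1.
Qed.

(** A double root of A - u B is a root of the Wronskian. So u has to avoid the values of A/B at
    those roots and on [U], and the roots of the leading coefficient of the pencil, where the degree
    drops. *)
Lemma generic_fiber U : exists bad : seq L, forall u, u \notin bad -> exists ts : seq L,
  [/\ uniq ts, size ts = (size pencil).-1 &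
      forall t, t \in ts -> A.[t] = u * B.[t] /\ t \notin U].
Proof.
have [rw hw] := poly_roots wronskian_neq0.
have [rl hl] : exists rs, forall x, root (lead_coef pencil) x -> x \in rs.
  by apply: poly_roots; rewrite lead_coef_eq0 pencil_neq0.
exists (rl ++ [seq A.[t] / B.[t] | t <- rw ++ U]) => u.
rewrite mem_cat negb_or => /andP[ul uU].
have lu : (lead_coef pencil).[u] != 0 by apply: contraNN ul => h; apply: hl.
have sq : size (A - u *: B) = size pencil.
  by rewrite -pencil_map size_map_poly_id0.
have good t : (A - u *: B).[t] = 0 -> A.[t] = u * B.[t] /\ t \notin rw ++ U.
  rewrite hornerD hornerN hornerZ => /eqP; rewrite subr_eq0 => /eqP ht; split=> //.
  apply: contraNN uU => tU; apply/mapP; exists t => //.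
  have Bt : B.[t] != 0.
    apply/eqP => Bt; have A0 : A.[t] = 0 by rewrite ht Bt mulr0.
    by have := cop_root A0; rewrite Bt eqxx.
  by rewrite ht mulfK.
have [ts ets] := closed_split closedL (A - u *: B).
have q0 : A - u *: B != 0 by rewrite -size_poly_gt0 sq (ltn_trans _ nonconst).
have lq : lead_coef (A - u *: B) != 0 by rewrite lead_coef_eq0.
exists ts; split.
- rewrite -separable_prod_XsubC; have : separable_poly (A - u *: B); last first.
    by rewrite ets (eqp_separable (eqp_scale _ lq)).
  rewrite separable_poly.unlock; apply: coprimep_closed => t /good [ht].
  rewrite mem_cat negb_or => /andP[tw _]; apply: contraNN tw => /eqP h'.
  apply: hw; rewrite rootE hornerD hornerN !hornerM ht.
  move: h'; rewrite derivB derivZ hornerD hornerN hornerZ => /eqP; rewrite subr_eq0 => /eqP ->.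
  by apply/eqP; ring.
- by have := sq; rewrite ets size_scale // size_prod_XsubC => <-.
move=> t tts; have [|ht] := good t; last by rewrite mem_cat negb_or => /andP[].
by apply/eqP; rewrite -rootE ets rootZ // root_prod_XsubC.
Qed.

(** A rational function a/d that is constant on the fibres of A/B is a function of u = A/B. Over
    L(u) it is a polynomial in t of degree below that of the pencil; for generic u it takes one
    value at as many points as that degree, so its non-constant coefficients vanish. *)
Lemma ratio_descent a d U : d != 0 ->
  (forall t t', t \notin U -> t' \notin U -> A.[t] * B.[t'] = A.[t'] * B.[t] ->
     a.[t] * d.[t'] = a.[t'] * d.[t]) ->
  exists b c, b != 0 /\ forall u t, A.[t] = u * B.[t] -> b.[u] * a.[t] = d.[t] * c.[u].
Proof.
move=> d0 H; have [b [C [b0 sC hC]]] := pencil_repr a d0.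
have [rd hd] := poly_roots d0; have [bad hbad] := generic_fiber (U ++ rd).
suff eC : C = (C`_0)%:P.
  by exists b, C`_0; split=> // u t ht; rewrite hC // {1}eC eval2C.
suff h i : C`_i.+1 = 0.
  by apply/polyP => -[|i]; rewrite coefC ?eqxx //= h.
apply: (@poly_fin_eq0 _ bad) => u /hbad [ts [uts sts hts]].
have [t1 t1ts] : exists t1, t1 \in ts.
  case: ts sts {uts hts} => [e|t1 ts _]; last by exists t1; rewrite mem_head.
  by move: nonconst; case: (size pencil) e => [|[|]].
have dts t : t \in ts -> [/\ A.[t] = u * B.[t], t \notin U & d.[t] != 0].
  move=> /hts [ht]; rewrite mem_cat negb_or => /andP[tU trd]; split=> //.
  by apply: contraNN trd => h; apply: hd.
have [ht1 t1U dt1] := dts _ t1ts.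
pose r := b.[u] * a.[t1] / d.[t1].
pose q := map_poly (horner_eval u) C - r%:P.
have q0 : q = 0.
  apply: (@roots_geq_poly_eq0 _ q ts) => //.
    apply/allP => t tts; have [ht tU dt] := dts _ tts.
    rewrite rootE hornerD hornerN hornerC subr_eq0.
    have -> : (map_poly (horner_eval u) C).[t] = eval2 u t C.
      by rewrite /eval2 -[in LHS](hornerC t u) -/(horner_eval u t%:P) horner_map.
    apply/eqP/(mulfI dt); rewrite -hC // /r.
    have := H t t1 tU t1U; rewrite ht ht1 mulrAC => /(_ erefl) e.
    apply: (mulIf dt1); transitivity (b.[u] * (a.[t1] * d.[t])).
      by rewrite -e mulrA.
    by field.
  have sp : ((size pencil).-1.+1 = size pencil)%N by rewrite prednK // (ltn_trans _ nonconst).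
  rewrite sts -ltnS sp.
  rewrite (leq_ltn_trans (size_polyD _ _)) // gtn_max size_polyN.
  rewrite (leq_ltn_trans (size_poly _ _)) //=.
  by rewrite (leq_ltn_trans (size_polyC_leq1 _)).
have := congr1 (fun q : {poly L} => q`_i.+1) q0.
by rewrite /= coefB coefC subr0 coef0 coef_map.
Qed.

End RatioDescent.

(** * Functions invariant under n-torsion, and divisibility of the group of points *)

Section Multiplication.
Variables (L : fieldType) (E : ecurve L).
Let gE := ecurveP E.
Let closedL : GRing.closed_field_axiom L. Proof. by case: gE. Qed.
Let charL : forall n, n.+1%:R != 0 :> L. Proof. by case: gE. Qed.
Implicit Types (X Y Z S : point E) (phi psi : point E -> L).
Implicit Types (A B : point E -> Prop).
Notation ae := (@for_almost_all L E).

Let two0 : 2 != 0 :> L. Proof. exact: charL 1%N. Qed.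

Lemma even_rational phi : rational phi -> ae (fun X => phi (- X) = phi X) ->
  exists d a : {poly L}, d != 0 /\ ae (fun X => d.[px X] * phi X = a.[px X]).
Proof.
move=> rphi ev; have [d [a [b [d0 h]]]] := rational_normal rphi.
exists d, a; split=> //; apply: (ae3 h (ae_popp h) ev) => X e.
rewrite popp_px popp_pe poppE => e' ev'; rewrite ev' in e'.
apply: (mulfI two0); transitivity (d.[px X] * phi X + d.[px X] * phi X); first by ring.
by rewrite {1}e e'; ring.
Qed.

Variable n : nat.
Hypothesis n0 : (0 < n)%N.

(** x(nX) is an even function, hence a fraction in x(X), here in lowest terms. Were it constant, nX
    would lie almost always in one pair of opposite points, against finiteness of the fibres. *)
Lemma mulrn_px_coprime : exists a b : {poly L}, [/\ coprimep a b, b != 0,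
  (1 < size (pencil a b))%N & ae (fun X => b.[px X] * px (X *+ n) = a.[px X])].
Proof.
have [hx _ fin] := @ratmap_mulrn L E n n0.
have [|d [a [d0 h]]] := even_rational hx.
  by apply: ae_all => X; rewrite mulNrn -poppE popp_px.
pose g := gcdp a d; have g0 : g != 0 by rewrite gcdp_eq0 negb_and d0 orbT.
have ea : a = a %/ g * g by rewrite divpK // dvdp_gcdl.
have ed : d = d %/ g * g by rewrite divpK // dvdp_gcdr.
have h' : ae (fun X => (d %/ g).[px X] * px (X *+ n) = (a %/ g).[px X]).
  apply: (ae2 h (ae_poly g0)) => X + gx; rewrite {1}ed {1}ea !hornerM mulrAC.
  exact: mulIf.
have dg0 : d %/ g != 0 by apply: contraNneq d0 => e; rewrite ed e mul0r.
exists (a %/ g), (d %/ g); split=> //; first by rewrite coprimep_div_gcd // d0 orbT.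
rewrite ltnNge; apply/negP => s1.
have sz1 (q : {poly L}) : (forall i, q`_i.+1 = 0) -> q = (q`_0)%:P.
  by move=> e; apply/polyP => -[|i]; rewrite coefC ?eqxx //= e.
have c i : (a %/ g)`_i.+1 = 0 /\ (d %/ g)`_i.+1 = 0.
  have /(congr1 (fun q : {poly L} => (q`_0, q`_1))) : (pencil (a %/ g) (d %/ g))`_i.+1 = 0.
    by move/leq_sizeP: s1; apply.
  rewrite /pencil coefB coefZ !coef_map /= !coefB !coefXM !coefC /=.
  by rewrite subr0 sub0r => -[-> /eqP]; rewrite oppr_eq0 => /eqP.
have eda := sz1 _ (fun i => (c i).1); have edd := sz1 _ (fun i => (c i).2).
set u := (a %/ g)`_0 in eda; set w := (d %/ g)`_0 in edd.
have w0 : w != 0 by move: dg0; rewrite edd polyC_eq0.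
have [Z [Z0 eZ]] := point_at E (u / w).
have hZ : ae (fun X => X *+ n != 0 /\ X *+ n != - Z) by apply: (ae2 (fin 0) (fin (- Z))).
apply: (@ae_const L E); apply: (ae3 h' (fin Z) hZ) => X + nZ [nX nZ'].
 rewrite eda edd !hornerC => e.
have exZ : px Z = px (X *+ n) by rewrite eZ -e mulrC mulKf.
by case: (px_eq Z0 nX exZ) => e'; [move: nZ|move: nZ']; rewrite e' eqxx.
Qed.

Lemma torsion_finite : exists s : seq (point E), forall S, S *+ n = 0 -> S \in s.
Proof.
have [_ _ /(_ 0) [s hs]] := @ratmap_mulrn L E n n0; exists s => S e.
by apply: contraT => /hs; rewrite e eqxx.
Qed.

Lemma mulrn_px_eq X X' : X *+ n != 0 -> X' *+ n != 0 -> px (X *+ n) = px (X' *+ n) ->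
  exists S, S *+ n = 0 /\ (X' = X + S \/ X' = - X + S).
Proof.
move=> nX nX' e; case: (px_eq nX nX' e) => eX; [exists (X' - X)|exists (X' + X)].
  by rewrite mulrnBl eX subrr; split=> //; left; rewrite addrC subrK.
by rewrite mulrnDl eX poppE addNr; split=> //; right; rewrite addrC addrK.
Qed.

(** Equality of x(nX) and x(nX') means X' = S + X or X' = S - X with S an n-torsion point, so phi
    agrees at X and X'; [ratio_descent] then makes it a function of x(nX). *)
Lemma descent_even phi : rational phi -> ae (fun X => phi (- X) = phi X) ->
  (forall S, S *+ n = 0 -> ae (fun X => phi (X + S) = phi X)) ->
  exists2 psi, rational psi & ae (fun X => phi X = psi (X *+ n)).
Proof.
move=> rphi ev inv; have [d [a [d0 hphi]]] := even_rational rphi ev.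
have [A [B [cop B0 nc hR]]] := mulrn_px_coprime.
have hn := @ratmap_mulrn L E n n0; have [_ _ fin] := hn.
have [T hT] := torsion_finite.
have inv' : ae (fun X => forall S, S \in T -> S *+ n = 0 -> phi (X + S) = phi X).
  apply: ae_forall_in => S _; have [e|ne] := eqVneq (S *+ n) 0.
    by apply: (ae1 (inv S e)) => X ->.
  by apply: ae_all => X e; rewrite e eqxx in ne.
have : ae (fun X => [/\ d.[px X] * phi X = a.[px X], B.[px X] * px (X *+ n) = A.[px X],
    phi (- X) = phi X & forall S, S *+ n = 0 -> phi (X + S) = phi X] /\
    [/\ X *+ n != 0, d.[px X] != 0 & B.[px X] != 0]).
  have h1 : ae (fun X => [/\ d.[px X] * phi X = a.[px X],
      B.[px X] * px (X *+ n) = A.[px X] & phi (- X) = phi X]) by apply: (ae3 hphi hR ev).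
  have h2 : ae (fun X => [/\ X *+ n != 0, d.[px X] != 0 & B.[px X] != 0]).
    by apply: (ae3 (fin 0) (ae_poly d0) (ae_poly B0)).
  apply: (ae3 h1 h2 inv') => X [? ? ?] ? i; split=> //; split=> // S eS.
  exact: i (hT _ eS) eS.
move=> [s hs]; pose U := [seq px X | X <- s].
have pt t : t \notin U -> exists2 X, px X = t & X \notin s /\ - X \notin s.
  move=> tU; have [X [_ eX]] := point_at E t; exists X => //.
  split; apply: contraNN tU => Xs; apply/mapP; [by exists X|exists (- X) => //].
  by rewrite -poppE popp_px.
have H t t' : t \notin U -> t' \notin U -> A.[t] * B.[t'] = A.[t'] * B.[t] ->
    a.[t] * d.[t'] = a.[t'] * d.[t].
  move=> /pt [X <- [/hs [[h1 h2 h3 h4] [k1 k2 k3]] /hs [[_ _ _ h4'] _]]].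
  move=> /pt [X' <- [/hs [[l1 l2 l3 l4] [m1 m2 m3]] _]] e.
  have ex : px (X *+ n) = px (X' *+ n).
    apply: (mulfI k3); apply: (mulfI m3); rewrite h2 mulrCA l2 mulrC e; ring.
  have [S [S0 eX']] := mulrn_px_eq k1 m1 ex.
  have ep : phi X' = phi X by case: eX' => ->; [rewrite h4|rewrite h4' // h3].
  by rewrite -h1 -l1 ep; ring.
have [b [c [b0 hbc]]] := ratio_descent closedL charL cop nc d0 H.
exists (fun X => c.[px X] / b.[px X]).
  by apply: rationalM; [|apply: rationalV]; apply/rational_poly/polyfun_poly.
have hb := ratmap_ae hn (ae_poly b0).
apply: (ae2 hb (ex_intro _ s hs)) => X bX [[h1 h2 h3 h4] [k1 k2 k3]].
have /hbc : A.[px X] = px (X *+ n) * B.[px X] by rewrite mulrC.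
rewrite -h1 => e; apply: (mulfI k2); apply: (mulfI bX); rewrite e; field; exact: bX.
Qed.

(** Split into even and odd parts; the odd part becomes even when multiplied by e(nX), the ordinate
    of nX, which is itself a function of nX. *)
Lemma descent phi : rational phi ->
  (forall S, S *+ n = 0 -> ae (fun X => phi (X + S) = phi X)) ->
  exists2 psi, rational psi & ae (fun X => phi X = psi (X *+ n)).
Proof.
move=> rphi inv; have ropp := ratmap_comp (@ratmap_opp L E) rphi.
have hn := @ratmap_mulrn L E n n0.
have inv' S : S *+ n = 0 -> ae (fun X => phi (- (X + S)) = phi (- X)).
  move=> eS; have eS' : (- S) *+ n = 0 by rewrite mulNrn eS oppr0.
  by apply: (ae1 (ae_popp (inv _ eS'))) => X; rewrite poppE -opprD.
have [|||p1 r1 e1] := @descent_even (fun X => phi X + phi (- X)).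
- exact: rationalD.
- by apply: ae_all => X; rewrite opprK addrC.
- by move=> S eS; apply: (ae2 (inv S eS) (inv' S eS)) => X -> ->.
have rodd : rational (fun X => (phi X - phi (- X)) * pe (X *+ n)).
  by apply: rationalM; [apply: rationalB|apply: (ratmap_comp hn rational_pe)].
have [||p2 r2 e2] := descent_even rodd.
- by apply: ae_all => X; rewrite opprK mulNrn -poppE popp_pe; ring.
- move=> S eS; apply: (ae2 (inv S eS) (inv' S eS)) => X -> ->.
  by rewrite mulrnDl eS addr0.
exists (fun X => (p1 X + p2 X / pe X) / 2).
  apply: rationalM; last exact: rational_cst.
  by apply: rationalD => //; apply: rationalM => //; apply: rationalV; apply: rational_pe.
apply: (ae3 e1 e2 (ratmap_ae hn (@ae_pe L E))) => X <- <- p0.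
by field; rewrite p0 two0.
Qed.

(** Generic fibres are non-empty, so the image contains almost all points; being a subgroup it
    contains Y = Z + (Y - Z) for a suitable Z. *)
Lemma mulrn_surj Y : exists X, X *+ n = Y.
Proof.
have [A [B [cop B0 nc hR]]] := mulrn_px_coprime.
have [_ _ fin] := @ratmap_mulrn L E n n0.
have [s hs] : ae (fun X => [/\ B.[px X] * px (X *+ n) = A.[px X], X *+ n != 0 &
    B.[px X] != 0]) by apply: (ae3 hR (fin 0) (ae_poly B0)).
have [bad hbad] := generic_fiber closedL charL cop nc [seq px X | X <- s].
have im : ae (fun Y => exists X, X *+ n = Y).
  apply: (ae2 (ae_px bad) (ae_neq (pzero E))) => Z /hbad [ts [_ sts hts]] Z0.
  case: ts sts hts => [e|t ts _ /(_ t (mem_head _ _)) [ht tU]].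
    by move: nc; case: (size (pencil A B)) e => [|[|]].
  have [X [X0 eX]] := point_at E t.
  have /hs [h1 nX bX] : X \notin s by apply: contraNN tU => Xs; apply/mapP; exists X.
  have eZ : px (X *+ n) = px Z.
    by apply: (mulfI bX); rewrite h1 eX ht mulrC -eX.
  case: (px_eq nX Z0 eZ) => ->; first by exists X.
  by exists (- X); rewrite mulNrn.
have im' : ae (fun Z => exists X, X *+ n = Y - Z).
  by apply: (ae1 (ratmap_ae (ratmap_comp2 (ratmap_add Y) (@ratmap_opp L E)) im)) => Z; rewrite addrC.
have [|Z _ [[X1 e1] [X2 e2]]] := @ae_ex L E
    (fun Z => (exists X, X *+ n = Z) /\ exists X, X *+ n = Y - Z).
  by apply: (ae2 im im').
by exists (X1 + X2); rewrite mulrnDl e1 e2 addrC subrK.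
Qed.

End Multiplication.

(** * Existence of non-zero torsion points of odd order *)

Section Torsion.
Variables (L : fieldType) (E : ecurve L).
Let gE := ecurveP E.
Let closedL : GRing.closed_field_axiom L. Proof. by case: gE. Qed.
Let charL : forall n, n.+1%:R != 0 :> L. Proof. by case: gE. Qed.
Implicit Types (X Y Z S : point E).
Notation ae := (@for_almost_all L E).

Definition order2 j X := X *+ 2 ^ j.+1 = 0 /\ X *+ 2 ^ j != 0.

Lemma order2_odd j X m : odd m -> order2 j X -> order2 j (X *+ m).
Proof.
move=> om [h1 h2]; split; first by rewrite mulrnAC h1 mul0rn.
rewrite mulrnAC; apply: contraNneq h2 => e; rewrite -mulrnA in e.
have := order_two_power h1 _ e; have [//|n2 /(_ isT)] := eqVneq (X *+ 2 ^ j) 0.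
by rewrite expnSr dvdn_pmul2l ?expn_gt0 // dvdn2 om.
Qed.

Lemma order2_uniq j j' X : order2 j X -> order2 j' X -> j = j'.
Proof.
move=> [h1 h2] [h1' h2']; apply/eqP; rewrite eqn_leq.
have := order_two_power h1 h2 h1'; have := order_two_power h1' h2' h1.
by rewrite !dvdn_Pexp2l // !ltnS => -> ->.
Qed.

Lemma order2_avoid (s : seq (point E)) :
  exists J, forall j X, (J <= j)%N -> order2 j X -> X \notin s.
Proof.
elim: s => [|Z s [J hJ]]; first by exists 0%N.
have [[j0 hj0]|nj] := pselect (exists j0, order2 j0 Z).
  exists (maxn J j0.+1) => j X; rewrite geq_max => /andP[Jj jj] oX.
  rewrite inE negb_or (hJ j) // andbT; apply/eqP => eX.
  by move: jj; rewrite eX in oX; rewrite (order2_uniq oX hj0) ltnn.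
exists J => j X Jj oX; rewrite inE negb_or (hJ j) // andbT.
by apply/eqP => eX; apply: nj; exists j; rewrite -eX.
Qed.

(* If x(nX) is a Moebius transform of x(X), then so is x(n^k X); for n^k = 1
   modulo 2^(j+1) it fixes the abscissas of the points of order 2^(j+1), hence is
   the identity, and n^k X = X or -X for all points of large 2-power order. *)
Lemma mulrn_px_not_moebius n (a b c d : L) : odd n -> (1 < n)%N -> a * d - b * c != 0 ->
  ~ ae (fun X => px (X *+ n) * (c * px X + d) = a * px X + b).
Proof.
move=> on n1 det [s hs]; have [J hJ] := order2_avoid (0 :: s).
have iter k : exists a b c d, a * d - b * c != 0 /\ forall j X, (J <= j)%N -> order2 j X ->
    px (X *+ n ^ k) * (c * px X + d) = a * px X + b.
  elim: k => [|k [a' [b' [c' [d' [det' IHk]]]]]].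
    exists 1, 0, 0, 1; split; first by rewrite mulr1 mul0r subr0 oner_neq0.
    by move=> j X _ _; rewrite expn0 mulr1n; ring.
  exists (a' * a + b' * c), (a' * b + b' * d), (c' * a + d' * c), (c' * b + d' * d); split.
    have -> : (a' * a + b' * c) * (c' * b + d' * d) - (a' * b + b' * d) * (c' * a + d' * c)
      = (a' * d' - b' * c') * (a * d - b * c) by ring.
    exact: mulf_neq0.
  move=> j X Jj oX; have := hJ j X Jj oX; rewrite inE negb_or => /andP[_ /hs e].
  have := IHk j _ Jj (order2_odd on oX); rewrite -mulrnA -expnS => e'.
  set y := px (X *+ n) in e e'; set w := px (X *+ n ^ k.+1) in e' *.
  transitivity (w * (c' * (a * px X + b) + d' * (c * px X + d))); first by ring.
  transitivity (w * (c' * y + d') * (c * px X + d)); first by rewrite -e; ring.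
  rewrite e'; transitivity (a' * (y * (c * px X + d)) + b' * (c * px X + d)); first by ring.
  by rewrite e; ring.
(* By Euler's theorem n^k = 1 modulo 2^(j+1). The bound 3 makes the order at least 16, which
   separates the abscissas of X, 3X and 5X. *)
pose j := maxn J 3; pose k := totient (2 ^ j.+1).
have Jj : (J <= j)%N by rewrite leq_maxl.
have nk X : order2 j X -> X *+ n ^ k = X.
  move=> [h1 _]; have := @Euler_exp_totient n (2 ^ j.+1).
  rewrite coprimeXr ?coprimen2 // => /(_ isT); rewrite -/k [(1 %% _)%N]modn_small ?ltn_exp2l //.
    by move=> e; rewrite (divn_eq (n ^ k) (2 ^ j.+1)) e mulnC mulrnDr mulrnA h1 mul0rn add0r.
  by rewrite -{1}(expn0 2) ltn_exp2l.
have [a' [b' [c' [d' [det' hk]]]]] := iter k.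
have [X [oX1 oX2]] := @exists_order_two_power L E j.
have oX : order2 j X by [].
(* Its roots are the fixed points of the Moebius map of the iterate; three of them force that map to
   be the identity. *)
pose q : {poly L} := c' *: 'X^2 + (d' - a') *: 'X - b'%:P.
have rq m : odd m -> root q (px (X *+ m)).
  move=> om; have o' := order2_odd om oX; have := hk j _ Jj o'; rewrite (nk _ o') => e.
  rewrite rootE /q hornerD hornerN hornerD !hornerZ hornerXn hornerX hornerC subr_eq0.
  apply/eqP; set x := px (X *+ m) in e *.
  by transitivity (x * (c' * x + d') - a' * x); [ring|rewrite e; ring].
have aff i m Y : order2 i Y -> odd m -> Y *+ m != 0.
  move=> oY om; have [_] := order2_odd om oY.
  by apply: contraNneq => ->; rewrite mul0rn.
have sep i m m' Y : order2 i Y -> odd m -> odd m' -> (m < m')%N -> (m + m' < 2 ^ i.+1)%N ->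
    px (Y *+ m) != px (Y *+ m').
  move=> oY om om' mm' lt; have [h1 h2] := oY.
  have {h1 h2} dv r : (0 < r)%N -> (r < 2 ^ i.+1)%N -> Y *+ r != 0.
    move=> r0 rlt; apply/eqP => /(order_two_power h1 h2)/(dvdn_leq r0).
    by rewrite leqNgt rlt.
  apply/eqP => e; case: (px_eq (aff _ _ _ oY om) (aff _ _ _ oY om') e) => e'.
    have := dv (m' - m)%N; rewrite subn_gt0 mm' mulrnBr ?(ltnW mm') // e' subrr eqxx.
    by move=> /(_ isT (leq_ltn_trans (leq_subr _ _) (leq_ltn_trans (leq_addl _ _) lt))).
  have := dv (m + m')%N; rewrite mulrnDr e' poppE subrr eqxx lt addn_gt0 (leq_trans _ mm') ?orbT //.
  by move=> /(_ isT isT).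
have j16 : (16 <= 2 ^ j.+1)%N by rewrite -[16%N]/(2 ^ 4)%N leq_exp2l // ltnS leq_maxr.
have q0 : q = 0.
  apply: (@roots_geq_poly_eq0 _ q [:: px (X *+ 1); px (X *+ 3); px (X *+ 5)]).
  - by rewrite /= !rq.
  - by rewrite /= !inE !negb_or !(sep _ _ _ _ oX) //; apply: leq_trans j16.
  rewrite /q -addrA (leq_trans (size_polyD _ _)) // geq_max.
  rewrite (leq_trans (size_scale_leq _ _)) ?size_polyXn //=.
  rewrite (leq_trans (size_polyD _ _)) // geq_max size_polyN.
  rewrite (leq_trans (size_scale_leq _ _)) ?size_polyX //=.
  by rewrite (leq_trans (size_polyC_leq1 _)).
have qi i : q`_i = 0 by rewrite q0 coef0.
have c0 : c' = 0 by have := qi 2%N; rewrite /q !coefE /= mulr1 mulr0 addr0 subr0.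
have b0 : b' = 0.
  by have := qi 0%N; rewrite /q !coefE /= !mulr0 addr0 sub0r => /eqP; rewrite oppr_eq0 => /eqP.
have a0 : d' = a'.
  by have := qi 1%N; rewrite /q !coefE /= mulr0 mulr1 add0r subr0 => /eqP; rewrite subr_eq0 => /eqP.
rewrite c0 b0 a0 mul0r subr0 mulf_eq0 orbb in det'.
(* Now n^k Y and Y share their abscissa for every Y of large 2-power order; an order beyond n^k + 1
   refutes this. *)
pose i := maxn J (n ^ k).+1.
have [Y [oY1 oY2]] := @exists_order_two_power L E i; have oY : order2 i Y by [].
have k0 : (0 < k)%N by rewrite totient_gt0 expn_gt0.
have nk1 : (1 < n ^ k)%N by rewrite -(exp1n k) ltn_exp2r.
have nki : (1 + n ^ k < 2 ^ i.+1)%N.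
  have ki : (n ^ k < i)%N by rewrite leq_maxr.
  by rewrite add1n; apply: leq_ltn_trans ki (leq_ltn_trans (leqnSn _) (ltn_expl _ _)).
have onk : odd (n ^ k) by rewrite oddX on orbT.
have := sep i 1%N (n ^ k)%N Y oY isT onk nk1 nki; rewrite mulr1n.
have := hk i Y (leq_maxl _ _) oY; rewrite c0 b0 a0 mul0r add0r addr0 mulrC => /(mulfI det') ->.
by rewrite eqxx.
Qed.

(** Without n-torsion, two points with the same x(nX) agree up to sign. A generic fibre then has a
    single abscissa, so A/B has degree 1. *)
Lemma exists_torsion n : odd n -> (1 < n)%N -> exists2 T : point E, T != 0 & T *+ n = 0.
Proof.
move=> on n1; apply: contrapT => notors.
have inj X : X *+ n = 0 -> X = 0.
  by move=> e; apply: contrapT => /eqP X0; apply: notors; exists X.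
have n0 : (0 < n)%N by apply: ltn_trans n1.
have [A [B [cop B0 nc hR]]] := mulrn_px_coprime E n0.
have [_ _ fin] := @ratmap_mulrn L E n n0.
have [s hs] : ae (fun X => [/\ B.[px X] * px (X *+ n) = A.[px X], X *+ n != 0 &
    B.[px X] != 0]) by apply: (ae3 hR (fin 0) (ae_poly B0)).
have [bad hbad] := generic_fiber closedL charL cop nc [seq px X | X <- s].
have [u /hbad [ts [uts sts hts]]] := fresh_elt charL bad.
have one t t' : t \in ts -> t' \in ts -> t = t'.
  move=> /hts [ht tU] /hts [ht' tU'].
  have [X [X0 eX]] := point_at E t; have [X' [X0' eX']] := point_at E t'.
  have /hs [h1 nX bX] : X \notin s by apply: contraNN tU => Xs; apply/mapP; exists X.
  have /hs [h2 nX' bX'] : X' \notin s by apply: contraNN tU' => Xs; apply/mapP; exists X'.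
  have eu : px (X *+ n) = px (X' *+ n).
    transitivity u; [apply: (mulfI bX)|apply/esym; apply: (mulfI bX')].
      by rewrite h1 eX ht mulrC -eX.
    by rewrite h2 eX' ht' mulrC -eX'.
  have [S [/inj S0]] := mulrn_px_eq nX nX' eu.
  by rewrite S0 !addr0 -eX -eX' => -[->//|->]; rewrite -poppE popp_px.
have sP : size (pencil A B) = 2.
  have : (size ts <= 1)%N.
    case: ts uts one {sts hts} => [|t [|t' ts]] // + one.
    have -> : t = t' by apply: one; rewrite !inE eqxx ?orbT.
    by rewrite /= inE eqxx.
  by rewrite sts; case: (size (pencil A B)) nc => [|[|[|]]].
have coef2 i : A`_i.+2 = 0 /\ B`_i.+2 = 0.
  have /(congr1 (fun q : {poly L} => (q`_0, q`_1))) : (pencil A B)`_i.+2 = 0.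
    by have /leq_sizeP h := eq_leq sP; rewrite h.
  rewrite /pencil coefB coefZ !coef_map /= !coefB !coefXM !coefC /=.
  by rewrite subr0 sub0r => -[-> /eqP]; rewrite oppr_eq0 => /eqP.
have lin (q : {poly L}) : (forall i, q`_i.+2 = 0) -> forall x, q.[x] = q`_1 * x + q`_0.
  move=> e x; have -> : q = q`_1 *: 'X + (q`_0)%:P.
    by apply/polyP => -[|[|i]]; rewrite !coefE //= ?e ?mulr0 ?mulr1 ?addr0 ?add0r.
  by rewrite hornerD hornerZ hornerX hornerC !coefE /= !mulr0 !mulr1 !addr0 add0r.
have linA := lin A (fun i => (coef2 i).1); have linB := lin B (fun i => (coef2 i).2).
apply: (@mulrn_px_not_moebius n A`_1 A`_0 B`_1 B`_0) => //; last first.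
  by apply: (ae1 hR) => X; rewrite linA linB mulrC.
(* With zero determinant, the root of a non-constant B is also a root of A, and a constant B makes A
   constant: coprimality or the degree is violated. *)
apply/eqP => det; have noroot x : A.[x] = 0 -> B.[x] = 0 -> False.
  move=> hA hB; have : root (gcdp A B) x by rewrite root_gcd !rootE hA hB eqxx.
  by move: cop; rewrite coprimep_def => /size_poly1P [c c0 ->]; rewrite rootC (negPf c0).
have [B1|B1] := eqVneq B`_1 0.
  have Bz : B`_0 != 0.
    apply: contraNneq B0 => B00; apply/eqP/polyP => -[|[|i]]; rewrite coef0 //.
    by case: (coef2 i).
  move: det; rewrite B1 mulr0 subr0 => /eqP; rewrite mulf_eq0 (negPf Bz) orbF => /eqP A1.
  have c1 i : (pencil A B)`_i.+1 = 0.
    rewrite /pencil coefB coefZ !coef_map /=; case: i => [|i]; first by rewrite A1 B1 mulr0 subr0.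
    by have [-> ->] := coef2 i; rewrite mulr0 subr0.
  by have := lead_coefE (pencil A B); rewrite sP c1 => /eqP; rewrite lead_coef_eq0 -size_poly_eq0 sP.
apply: (noroot (- B`_0 / B`_1)); rewrite ?linA ?linB; last by field.
apply: (mulfI B1); rewrite mulr0; transitivity (- (A`_1 * B`_0 - A`_0 * B`_1)); first by field.
by rewrite det oppr0.
Qed.

End Torsion.
(** * Orders in terms of ideals of the coordinate ring *)

Section CoordinateRing.
Variables (L : fieldType) (E : ecurve L).
Let gE := ecurveP E.
Let charL : forall n, n.+1%:R != 0 :> L. Proof. by case: gE. Qed.
Let two0 : 2 != 0 :> L. Proof. exact: charL 1%N. Qed.
Let four0 : 4 != 0 :> L. Proof. exact: charL 3%N. Qed.
Implicit Types (X Y T : point E) (phi psi : point E -> L) (u v w : coord_ring E).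
Notation O := (pzero E).
Notation ae := (@for_almost_all L E).
Notation W := (weierstrass_poly E).
Notation cubic := (cubic E).

Definition py X : L := pe X - (a1 E * px X + a3 E) / 2.

Lemma coords_px_py X : X != O -> coords X = Some (px X, py X).
Proof. by case: X => -[[x y]|] h // _; rewrite /py /px /pe /= addrK. Qed.

Definition cev u X : L := reg_eval u (px X) (py X).

Lemma weierstrass_poly_root X : X != O -> W.[(py X)%:P].[px X] = 0.
Proof.
move=> X0; rewrite /weierstrass_poly.
rewrite !(hornerD, hornerN, hornerM, hornerC, hornerX, hornerXn, hornerZ) /=.
rewrite -!expr2.
transitivity (pe X ^+ 2 - cubic.[px X]); last by rewrite pe2 // subrr.
by rewrite cubicE /py /cA /cB /cC; field; rewrite ?two0 ?four0.
Qed.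

Lemma size_coord_ring u : (size (u : {poly {poly L}}) <= 2)%N.
Proof.
have e : size (mk_monic W) = 3.
  rewrite mk_monic_weierstrass_poly /weierstrass_poly -addrA size_polyDl size_polyXn // ltnS.
  rewrite (leq_trans (size_polyD _ _)) // geq_max size_polyN.
  rewrite (leq_trans (size_scale_leq _ _)) ?size_polyX //.
  by rewrite (leq_trans (size_polyC_leq1 _)).
exact: leq_trans (size_npoly u) (eq_leq (congr1 predn e)).
Qed.

Lemma cev_in (q : {poly {poly L}}) X : X != O ->
  cev (in_qpoly W q) X = q.[(py X)%:P].[px X].
Proof.
move=> X0; rewrite /cev /reg_eval /=.
have mW := monic_mk_monic W.
rewrite {2}(Pdiv.RingMonic.rdivp_eq mW q) mk_monic_weierstrass_poly.
by rewrite !hornerD !hornerM weierstrass_poly_root // mulr0 add0r.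
Qed.

Lemma cevM u v X : X != O -> cev (u * v) X = cev u X * cev v X.
Proof. by move=> X0; rewrite [u * v]/(qpoly_mul u v) cev_in // !hornerM. Qed.

Lemma cevD u v X : cev (u + v) X = cev u X + cev v X.
Proof. by rewrite /cev /reg_eval -!hornerD. Qed.

Lemma cevN u X : cev (- u) X = - cev u X.
Proof. by rewrite /cev /reg_eval -!hornerN. Qed.

Lemma cev1 X : cev 1 X = 1.
Proof. by rewrite /cev /reg_eval /= !hornerC. Qed.

Lemma cev0 X : cev 0 X = 0.
Proof. by rewrite /cev /reg_eval /= !horner0. Qed.

Lemma cevX u n X : X != O -> cev (u ^+ n) X = cev u X ^+ n.
Proof.
by move=> X0; elim: n => [|n IHn]; rewrite ?expr0 ?cev1 // !exprS cevM // IHn.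
Qed.

Lemma cev_sum (I : Type) (r : seq I) (F : I -> coord_ring E) X :
  cev (\sum_(i <- r) F i) X = \sum_(i <- r) cev (F i) X.
Proof.
by elim: r => [|i r IHr]; rewrite ?big_nil ?cev0 // !big_cons cevD IHr.
Qed.

Lemma cev_coef u X :
  cev u X = ((u : {poly {poly L}})`_0).[px X] + ((u : {poly {poly L}})`_1).[px X] * py X.
Proof.
rewrite /cev /reg_eval (horner_coef_wide _ (size_coord_ring u)).
by rewrite !big_ord_recr big_ord0 /= add0r expr0 mulr1 expr1 hornerD hornerM hornerC.
Qed.

Lemma polyfun_cev u : polyfun (cev u).
Proof.
set a := (u : {poly {poly L}})`_0; set b := (u : {poly {poly L}})`_1.
exists (a - b * ((a1 E / 2) *: 'X + (a3 E / 2)%:P)), b => X X0.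
rewrite cev_coef -/a -/b hornerD hornerN hornerM hornerD hornerZ hornerX hornerC /py.
ring.
Qed.

Lemma cev_surj phi : polyfun phi -> exists u, forall X, X != O -> cev u X = phi X.
Proof.
move=> [a [b h]].
exists (in_qpoly W ((a + b * ((a1 E / 2) *: 'X + (a3 E / 2)%:P))%:P + b *: 'X)) => X X0.
rewrite cev_in // hornerD hornerZ hornerX hornerC hornerD hornerM hornerC.
rewrite hornerD hornerM hornerD hornerZ hornerX hornerC h // /py.
ring.
Qed.

(** A difference that vanishes at all affine points has norm zero, hence zero coefficients. *)
Lemma cev_inj u v : (forall X, X != O -> cev u X = cev v X) -> u = v.
Proof.
move=> h; apply/eqP; rewrite -subr_eq0; apply/eqP.
have {h} : forall X, X != O -> cev (u - v) X = 0.
  by move=> X X0; rewrite cevD cevN h // subrr.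
move: (u - v) => {u}v h.
set a' := (v : {poly {poly L}})`_0; set b' := (v : {poly {poly L}})`_1.
pose l := (a1 E / 2) *: 'X + (a3 E / 2)%:P : {poly L}.
have n0 : norm E (a' - b' * l) b' = 0.
  apply: (@poly_ae_eq _ E); apply: (ae1 (ae_neq O)) => X X0; rewrite horner0 normE //.
  have -> : (a' - b' * l).[px X] + b'.[px X] * pe X = cev v X.
    rewrite cev_coef -/a' -/b' hornerD hornerN hornerM hornerD hornerZ hornerX hornerC /py.
    ring.
  by rewrite h // mul0r.
have [ea eb] := norm_eq0 n0.
have ea' : a' = 0 by move: ea; rewrite eb mul0r subr0.
apply: val_inj; apply/polyP => i /=; rewrite coef0.
case: i => [|[|i]] //; rewrite nth_default // (leq_trans (size_coord_ring v)) //.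
Qed.

Let I := @in_ideal_pow L E.

Lemma ideal_pow_add x y m u v : I x y m u -> I x y m v -> I x y m (u + v).
Proof.
move=> [c ->] [d ->]; exists (fun i => c i + d i); rewrite -big_split /=.
by apply: eq_bigr => i _; rewrite !mulrDl.
Qed.

Lemma ideal_pow_mul x y m u v : I x y m v -> I x y m (u * v).
Proof.
move=> [c ->]; exists (fun i => u * c i); rewrite mulr_sumr.
by apply: eq_bigr => i _; rewrite !mulrA.
Qed.

(** Such a u = a + b y equals k (x - x0) + b (y - y0), because a + b y0 is divisible by x - x0; the
    binomial theorem does the rest. *)
Lemma ideal_pow_exp X m u : X != O -> cev u X = 0 -> I (px X) (py X) m (u ^+ m).
Proof.
move=> X0 uX; set x := px X; set y := py X.
set P := in_qpoly W ('X - x%:P)%:P; set Q := in_qpoly W ('X - y%:P%:P).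
set b := (u : {poly {poly L}})`_1.
have [k ek] : exists k : {poly L}, (u : {poly {poly L}})`_0 + b * y%:P = k * ('X - x%:P).
  by apply/factor_theorem; rewrite rootE hornerD hornerM hornerC -cev_coef uX.
have -> : u = in_qpoly W k%:P * P + in_qpoly W b%:P * Q.
  apply: cev_inj => Z Z0; rewrite cevD !cevM // !cev_in // !hornerC.
  have := congr1 (fun q : {poly L} => q.[px Z]) ek.
  rewrite /= hornerD !hornerM !hornerC hornerXsubC => e.
  rewrite cev_coef !(hornerD, hornerN, hornerX, hornerC) -e; ring.
rewrite exprDn; exists (fun i => in_qpoly W k%:P ^+ i * in_qpoly W b%:P ^+ (m - i) *+ 'C(m, i)).
rewrite (reindex_inj rev_ord_inj) /=; apply: eq_bigr => i _.
have im : (i <= m)%N by rewrite -ltnS.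
rewrite subSS subKn // bin_sub // !exprMn.
rewrite !mulrnAl; congr (_ *+ _); ring.
Qed.

Lemma ord_ge phi X0 n m : X0 != O -> ord phi X0 n ->
  (exists c, val (fun X => phi X * unif X0 X ^ (- m)) X0 c) <-> m <= n.
Proof.
move=> X00 h; have h1 : ord (fun X => phi X * unif X0 X ^ (- m)) X0 (n - m).
  have [c c0 hc] := h; exists c => //; apply: val_ae hc.
  apply: (ae1 (@ae_unif _ E X0)) => X t0; rewrite -mulrA -expfzDr //.
  by congr (_ * _ ^ _); ring.
split=> [[c hc]|mn]; last by apply: ord_ge0_val X00 h1 _; rewrite subr_ge0.
rewrite leNgt; apply/negP => nm.
have h2 := ordV X00 h1; have [|] := ltP 0 (- (n - m)); last by rewrite oppr_le0 subr_ge0 leNgt nm.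
move=> /(ord_pos_val X00 h2) h3.
have h4 : val (fun=> 1) X0 (c * 0).
  by apply: val_ae (valM hc h3); apply: (ae1 (ord_nz X00 h1)) => X p0; apply: mulfV.
have := val_uniq X00 h4 (val_cst 1 X0); rewrite mulr0 => /esym/eqP.
by rewrite oner_eq0.
Qed.

Lemma val0_ord_gt0 phi X n : X != O -> val phi X 0 -> ord phi X n -> 0 < n.
Proof.
move=> X0 hX hn; rewrite ltNge; apply/negP => n0.
have [|c hc] := ord_ge0_val X0 (ordV X0 hn); first by rewrite oppr_ge0.
have h4 : val (fun=> 1) X (0 * c).
  by apply: val_ae (valM hX hc); apply: (ae1 (ord_nz X0 hn)) => Y; apply: mulfV.
have := val_uniq X0 h4 (val_cst 1 X); rewrite mul0r => /esym/eqP.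
by rewrite oner_eq0.
Qed.

Lemma vanish_div phi X : X != O -> polyfun phi -> phi X = 0 ->
  exists c, val (fun Y => phi Y * (unif X Y)^-1) X c.
Proof.
move=> X0 pphi pX; case: (polyfun_zero pphi) => [h0|h0].
  exists 0; apply: val_ae (val_cst 0 X); apply: (ae1 (ae_neq O)) => Y Y0.
  by rewrite h0 // mul0r.
have [n hn] := ord_polyfun_exists X0 pphi h0.
apply: (proj2 (ord_ge 1 X0 hn)); apply: val0_ord_gt0 hn => //.
by rewrite -pX; apply: val_poly.
Qed.

(** The m-th power of the maximal ideal at X consists of the functions of order at least m there,
    which links the ideal-theoretic order to [ord]. *)
Lemma ideal_pow_val X m u : X != O ->
  I (px X) (py X) m u <-> exists c, val (fun Y => cev u Y * unif X Y ^ (- m%:Z)) X c.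
Proof.
move=> X0; set x := px X; set y := py X.
have tpos : ae (fun Y => unif X Y != 0) by apply: ae_unif.
split; last first.
  move=> [c [w [s [pw ps sX wX h]]]].
  have [w' ew] := cev_surj pw; have [s' es] := cev_surj ps.
  have [t' et] := cev_surj (@polyfun_unif _ E X).
  have e : s' * u = w' * t' ^+ m.
    apply: cev_inj; apply: polyfun_ae; try exact: polyfun_cev.
    apply: (ae3 h tpos (ae_neq O)) => Y e t0 Y0.
    rewrite !cevM // cevX // ew // es // et // -e -!mulrA; congr (_ * _).
    by rewrite exprnP -expfzDr // addNr expr0z mulr1.
  have sX' : cev s' X != 0 by rewrite es.
  pose s0 := in_qpoly W (cev s' X)%:P%:P; pose n' := s0 - s'.
  have es0 Y : Y != O -> cev s0 Y = cev s' X by move=> Y0; rewrite cev_in // !hornerC.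
  have n'X : cev n' X = 0 by rewrite cevD cevN es0 // subrr.
  have tX : cev t' X = 0 by rewrite et // unif0.
  (* The denominator [s'] need not be invertible, but s' = s0 - n' divides s0^m - n'^m. With s' u =
     w' t'^m this puts s0^m u in the ideal power, as t' and n' vanish at X; s0 is a non-zero
     constant. *)
  have key : s0 ^+ m * u = (\sum_(i < m) s0 ^+ (m.-1 - i) * n' ^+ i) * w' * t' ^+ m + u * n' ^+ m.
    rewrite -mulrA -e mulrA -[u * _]mulrC -mulrDl; congr (_ * _).
    have : s' = s0 - n' by rewrite /n' opprB addrC subrK.
    by move=> ->; rewrite mulrC -subrXX subrK.
  have -> : u = in_qpoly W (cev s' X)^-1%:P%:P ^+ m * (s0 ^+ m * u).
    apply: cev_inj => Y Y0; rewrite !cevM // !cevX // es0 // cev_in // !hornerC.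
    by rewrite mulrA -exprMn mulVf // expr1n mul1r.
  apply: ideal_pow_mul; rewrite key; apply: ideal_pow_add; apply: ideal_pow_mul; exact: ideal_pow_exp.
move=> [c ->].
have vP : exists d, val (fun Y => (px Y - x) * (unif X Y)^-1) X d.
  apply: (@vanish_div (fun Y => px Y - x)) => //; last by rewrite subrr.
  by apply: polyfunB; [apply: polyfun_px|apply: polyfun_cst].
have vQ : exists d, val (fun Y => (py Y - y) * (unif X Y)^-1) X d.
  apply: (@vanish_div (fun Y => py Y - y)) => //; last by rewrite subrr.
  apply: polyfunB; last exact: polyfun_cst.
  apply: polyfunB; first exact: polyfun_pe.
  apply: polyfunM; last exact: polyfun_cst.
  by apply: polyfunD; [apply: polyfunM|]; try apply: polyfun_cst; apply: polyfun_px.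
have [d hd] := vP; have [d' hd'] := vQ.
have vsum (J : Type) (r : seq J) (F : J -> point E -> L) :
    (forall i, exists c, val (F i) X c) -> exists c, val (fun Y => \sum_(i <- r) F i Y) X c.
  move=> hF; elim: r => [|i r [c1 IHr]].
    by exists 0; apply: val_ae (val_cst 0 X); apply: ae_all => Y; rewrite big_nil.
  have [c2 hc2] := hF i; exists (c2 + c1); apply: val_ae (valD hc2 IHr).
  by apply: ae_all => Y; rewrite big_cons.
have [c0 hc0] := vsum _ (index_enum 'I_m.+1) (fun i Y => cev (c i) Y *
   ((px Y - x) * (unif X Y)^-1) ^+ i * ((py Y - y) * (unif X Y)^-1) ^+ (m - i))
   (fun i => ex_intro _ _ (valM (valM (val_poly X (polyfun_cev (c i))) (valX i hd)) (valX (m - i) hd'))).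
exists c0; apply: val_ae hc0; apply: (ae2 tpos (ae_neq O)) => Y t0 Y0.
rewrite cev_sum mulr_suml; apply: eq_bigr => i _.
rewrite !cevM // !cevX // !cev_in // !(hornerC, hornerD, hornerN, hornerX) !exprMn.
have im : (i <= m)%N by rewrite -ltnS.
have -> : unif X Y ^ (- m%:Z) = (unif X Y)^-1 ^+ i * (unif X Y)^-1 ^+ (m - i).
  by rewrite -exprD subnKC // exprVn exprnN.
by ring.
Qed.

Lemma reg_order_ord T u n : T != O -> reg_order u T n -> ord (cev u) T n.
Proof.
move=> T0; rewrite /reg_order (coords_px_py T0) => -[m [-> h1 h2]].
have u0 : ae (fun X => cev u X != 0).
  case: (polyfun_zero (polyfun_cev u)) => // h0; exfalso; apply: h2.
  have -> : u = 0 by apply: cev_inj => X X0; rewrite h0 // cev0.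
  by exists (fun=> 0); rewrite big1 // => i _; rewrite !mul0r.
have [k hk] := ord_polyfun_exists T0 (polyfun_cev u) u0.
have h1' := proj1 (ord_ge m T0 hk) (proj1 (ideal_pow_val m u T0) h1).
suff -> : m%:Z = k by [].
apply/eqP; rewrite eq_le h1' /= leNgt; apply/negP => mk.
by apply: h2; apply/(proj2 (ideal_pow_val m.+1 u T0)); apply: (proj2 (ord_ge m.+1 T0 hk)).
Qed.

Lemma rat_eval_cev (f : ratfun E) X : X != O ->
  rat_eval f X = cev (rat_num f) X / cev (rat_den f) X.
Proof. by move=> X0; rewrite /rat_eval (coords_px_py X0). Qed.

Lemma rational_rat_eval (f : ratfun E) : rational (rat_eval f).
Proof.
apply: rational_ae (rationalM (rational_poly (polyfun_cev (rat_num f)))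
  (rationalV (rational_poly (polyfun_cev (rat_den f))))).
by apply: (ae1 (ae_neq O)) => X X0; rewrite rat_eval_cev.
Qed.

Lemma has_divisor_hasdiv (f : ratfun E) (D : point E -> int) :
  has_divisor f D -> hasdiv (rat_eval f) D.
Proof.
move=> h X X0; have [n [m [hn hm ->]]] := h X.
have := ordM (reg_order_ord X0 hn) (ordV X0 (reg_order_ord X0 hm)).
by apply: ord_ae; apply: (ae1 (ae_neq O)) => Y Y0; rewrite rat_eval_cev.
Qed.

End CoordinateRing.
(** * Translations and poles *)

Section Translations.
Variables (L : fieldType) (E : ecurve L).
Let gE := ecurveP E.
Let charL : forall n, n.+1%:R != 0 :> L. Proof. by case: gE. Qed.
Let two0 : 2 != 0 :> L. Proof. exact: charL 1%N. Qed.
Implicit Types (X Y Z S T : point E) (phi psi : point E -> L) (M : point E -> point E).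
Notation ae := (@for_almost_all L E).
Notation cubic := (cubic E).

Lemma val_comp phi M X0 c : ratmap M -> M X0 != 0 ->
  val (fun X => px (M X)) X0 (px (M X0)) -> val (fun X => pe (M X)) X0 (pe (M X0)) ->
  val phi (M X0) c -> val (fun X => phi (M X)) X0 c.
Proof.
move=> hM MX0 vx ve [u [s [pu ps s0 us h]]].
have aeM := ratmap_ae hM (ae_neq (pzero E)).
have vp w : polyfun w -> val (fun X => w (M X)) X0 (w (M X0)).
  move=> [a [b e]]; rewrite e //.
  have := valD (val_horner a vx) (valM (val_horner b vx) ve).
  by apply: val_ae; apply: (ae1 aeM) => X MX; rewrite e.
have vu := vp u pu; have [u1 [s1 [pu1 ps1 s10 us1 h1]]] := vu.
have vs := vp s ps; have [u2 [s2 [pu2 ps2 s20 us2 h2]]] := vs.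
exists (fun X => u1 X * s2 X), (fun X => s1 X * u2 X); split.
- exact: polyfunM.
- exact: polyfunM.
- by rewrite us2 !mulf_neq0.
- by rewrite us1 us2 us; ring.
apply: (ae3 h1 h2 (ratmap_ae hM h)) => X e1 e2 e3.
by rewrite -e2 -e1 -e3; ring.
Qed.

(** The chord formula serves at generic X; only the slope needs care, being 0/0 at X0 = S. *)
Lemma val_translate S X0 : X0 != 0 -> X0 != - S ->
  val (fun X => px (X + S)) X0 (px (X0 + S)) /\ val (fun X => pe (X + S)) X0 (pe (X0 + S)).
Proof.
move=> X00 nS; have [->|S0] := eqVneq S 0.
  rewrite addr0; split.
    by apply: val_ae (val_poly X0 polyfun_px); apply: ae_all => X; rewrite addr0.
  by apply: val_ae (val_poly X0 polyfun_pe); apply: ae_all => X; rewrite addr0.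
have vpx : val (@px L E) X0 (px X0) := val_poly X0 polyfun_px.
have vpe : val (@pe L E) X0 (pe X0) := val_poly X0 polyfun_pe.
have generic : ae (fun X => X != 0 /\ px X != px S).
  by apply: (ae2 (ae_neq (pzero E)) (ae_px_neq (px S))).
suff [l [vl e1 e2]] : exists l,
    [/\ val (fun X => (pe S - pe X) / (px S - px X)) X0 l,
        px (X0 + S) = l ^+ 2 - cA E - px X0 - px S
      & pe (X0 + S) = - (l * (px (X0 + S) - px X0) + pe X0)].
  have vx : val (fun X => px (X + S)) X0 (px (X0 + S)).
    rewrite e1; apply: val_ae (valB (valB (valB (valX 2 vl) (val_cst (cA E) X0)) vpx)
      (val_cst (px S) X0)).
    by apply: (ae1 generic) => X [X0' nx]; have [_ -> _] := padd_chord X0' S0 nx.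
  split=> //; rewrite e2; apply: val_ae (valN (valD (valM vl (valB vx vpx)) vpe)).
  by apply: (ae1 generic) => X [X0' nx]; have [_ _ ->] := padd_chord X0' S0 nx.
have [e|ne] := eqVneq (px X0) (px S); last first.
  have [_ e1 e2] := padd_chord X00 S0 ne; eexists; split; [|exact: e1|exact: e2].
  apply: valM; first exact: valB (val_cst _ _) vpe.
  by apply: valV => //; [exact: valB (val_cst _ _) vpx|rewrite subr_eq0 eq_sym].
have eX : X0 = S.
  by case: (px_eq S0 X00 (esym e)) => // e'; rewrite e' poppE eqxx in nS.
subst S; have p0 : pe X0 != 0.
  by apply: contraNneq nS => p0; rewrite -poppE pe0_popp.
have [_ e1 e2] := padd_tangent X00 p0; exists (cubic^`().[px X0] / (2 * pe X0)); split=> //.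
(* With f(x) - f(x0) = q(x) (x - x0) the chord slope equals q(x) / (e0 + e), which is regular at X0
   and gives the tangent slope there. *)
have /factor_theorem [q eq_q] : root (cubic - cubic.[px X0]%:P) (px X0).
  by rewrite rootE hornerD hornerN hornerC subrr.
have qX : q.[px X0] = cubic^`().[px X0].
  have -> : cubic = q * ('X - (px X0)%:P) + cubic.[px X0]%:P by rewrite -eq_q subrK.
  rewrite derivD derivC addr0 derivM derivXsubC mulr1 hornerD hornerM hornerXsubC subrr.
  by rewrite mulr0 add0r.
have vd : val (fun X => pe X0 + pe X) X0 (2 * pe X0).
  by rewrite mulr_natl mulr2n; apply: valD (val_cst _ _) vpe.
have d0 : 2 * pe X0 != 0 by rewrite mulf_neq0.
rewrite -qX; apply: val_ae (valM (val_horner q vpx) (valV X00 vd d0)).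
apply: (ae2 generic (val_nz X00 vd d0)) => X [X0' nx] pp.
have nx' : px X0 - px X != 0 by rewrite subr_eq0 eq_sym.
have := congr1 (fun r : {poly L} => r.[px X]) eq_q.
rewrite /= hornerD hornerN hornerC hornerM hornerXsubC -!pe2 // => e3.
apply: (mulIf pp); apply: (mulIf nx'); rewrite mulfVK // mulrAC mulfVK //.
transitivity (- (q.[px X] * (px X - px X0))); first by ring.
by rewrite -e3; ring.
Qed.

(** Multiplied by (x(T) - x)^2, the chord formula for x(X + T) takes the non-zero value (2 e(T))^2
    at -T, where e(T) is the ordinate of T. *)
Lemma translate_pole T : T != 0 -> pe T != 0 -> val (fun X => (px (X + T))^-1) (- T) 0.
Proof.
move=> T0 p0; set X0 := - T; have X00 : X0 != 0 by rewrite oppr_eq0.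
have vpx := val_poly X0 (@polyfun_px L E); have vpe := val_poly X0 (@polyfun_pe L E).
have eX : px X0 = px T by rewrite /X0 -poppE popp_px.
have ep : pe X0 = - pe T by rewrite /X0 -poppE popp_pe.
rewrite eX in vpx; rewrite ep in vpe.
have vd := valB (val_cst (px T) X0) vpx; rewrite subrr in vd.
have vn := valB (val_cst (pe T) X0) vpe; rewrite opprK in vn.
have vD := valB (valX 2 vn)
  (valM (valX 2 vd) (valD (valD (val_cst (cA E) X0) vpx) (val_cst (px T) X0))).
rewrite expr0n mul0r subr0 in vD.
have D0 : (pe T + pe T) ^+ 2 != 0.
  by rewrite sqrf_eq0 -mulr2n -mulr_natl mulf_neq0.
have := valM (valX 2 vd) (valV X00 vD D0); rewrite expr0n mul0r.
apply: val_ae; apply: (ae2 (ae_neq (pzero E)) (ae_px_neq (px T))) => X X0' nx.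
have [_ -> _] := padd_chord X0' T0 nx.
have d0 : px T - px X != 0 by rewrite subr_eq0 eq_sym.
rewrite -[in RHS](mulfK (expf_neq0 2 d0) (_ - _ - _ - _)) invfM invrK mulrC; congr (_^-1 * _).
by field.
Qed.

Lemma ord_add_lt phi psi X0 n m : X0 != 0 -> ord phi X0 n -> ord psi X0 m -> n < m ->
  ord (fun X => phi X + psi X) X0 n.
Proof.
move=> X00 [c c0 hc] h' nm.
have h2 : ord (fun X => psi X * unif X0 X ^ (- n)) X0 (m - n).
  have [d d0 hd] := h'; exists d => //; apply: val_ae hd.
  apply: (ae1 (@ae_unif _ E X0)) => X t0; rewrite -mulrA -expfzDr //.
  by congr (_ * _ ^ _); ring.
have h3 := ord_pos_val X00 h2; rewrite subr_gt0 in h3.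
exists c => //; rewrite -[c]addr0; apply: val_ae (valD hc (h3 nm)).
by apply: ae_all => X; rewrite mulrDl.
Qed.

Lemma val_ord_ge0 phi X0 c n : X0 != 0 -> val phi X0 c -> ord phi X0 n -> 0 <= n.
Proof.
move=> X00 h hn; apply: (proj1 (ord_ge 0 X00 hn)); exists c; apply: val_ae h.
by apply: ae_all => X; rewrite oppr0 expr0z mulr1.
Qed.

(** The leading term dominates: q(xi) / xi^d has value [lead_coef q] where 1/xi vanishes. *)
Lemma ord_horner_pole (xi : point E -> L) X0 m (q : {poly L}) :
  X0 != 0 -> ord xi X0 (- m) -> 0 < m ->
  q != 0 -> ord (fun X => q.[xi X]) X0 (- (m *+ (size q).-1)).
Proof.
move=> X00 hm m0 q0; set d := (size q).-1.
have sq : size q = d.+1 by rewrite prednK // size_poly_gt0.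
have nz := ord_nz X00 hm.
have v0 : val (fun X => (xi X)^-1) X0 0.
  by apply: ord_pos_val (ordV X00 hm) _ => //; rewrite opprK.
have vsum k (F : 'I_k -> L) : val (fun X => \sum_(i < k) F i * (xi X)^-1 ^+ (k - i)) X0 0.
  have gen (r : seq 'I_k) : val (fun X => \sum_(i <- r) F i * (xi X)^-1 ^+ (k - i)) X0 0.
    elim: r => [|i r IHr].
      by apply: val_ae (val_cst 0 X0); apply: ae_all => X; rewrite big_nil.
    have := valD (valM (val_cst (F i) X0) (valX (k - i) v0)) IHr.
    rewrite expr0n subn_eq0 leqNgt ltn_ord /= mulr0 addr0; apply: val_ae.
    by apply: ae_all => X; rewrite big_cons.
  exact: gen.
have h : ord (fun X => q.[xi X] * (xi X)^-1 ^+ d) X0 0.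
  apply: (@val_ord0 _ _ _ _ (0 + lead_coef q)); first by rewrite add0r lead_coef_eq0.
  apply: val_ae (valD (vsum d (fun i => q`_i)) (val_cst (lead_coef q) X0)).
  apply: (ae1 nz) => X x0; rewrite horner_coef sq big_ord_recr /= mulrDl mulr_suml.
  congr (_ + _); last by rewrite lead_coefE -/d exprVn mulfK // expf_neq0.
  apply: eq_bigr => i _; rewrite -mulrA; congr (_ * _).
  have -> : (xi X)^-1 ^+ d = (xi X)^-1 ^+ i * (xi X)^-1 ^+ (d - i).
    by rewrite -exprD subnKC // ltnW.
  by rewrite mulrA -exprMn mulfV // expr1n mul1r.
have := ordM h (ordX d hm); rewrite add0r mulNrn; apply: ord_ae.
by apply: (ae1 nz) => X x0; rewrite -mulrA -exprMn mulVf // expr1n mulr1.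
Qed.

(* A(x) and B(x) y have pole orders of different parities at a point sent to the origin. *)
Lemma polyfun_pole_const phi M X0 c : X0 != 0 -> polyfun phi -> ratmap M ->
  val (fun X => (px (M X))^-1) X0 0 -> val (fun X => phi (M X)) X0 c ->
  exists d, ae (fun X => phi X = d).
Proof.
move=> X00 [a [b e]] hM pole reg; have [rx re _] := hM.
have aeM := ratmap_ae hM (ae_neq (pzero E)).
have nzx : ae (fun X => px (M X) != 0) := ratmap_ae hM (ae_px_neq 0).
have nze : ae (fun X => pe (M X) != 0) := ratmap_ae hM (@ae_pe _ E).
have [n hn] := ord_exists X00 rx nzx; have [k hk] := ord_exists X00 re nze.
have n0 : n < 0 by have := val0_ord_gt0 X00 pole (ordV X00 hn); rewrite oppr_gt0.
pose m := - n; have m0 : 0 < m by rewrite oppr_gt0.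
have hm : ord (fun X => px (M X)) X0 (- m) by rewrite opprK.
(* From e^2 = f(x). Orders are compared after doubling, so that nothing has to be divided by 2. *)
have {hn} ek : k *+ 2 = - (m *+ 3).
  apply: (ord_uniq X00 (ordX 2 hk)).
  have c0 : cubic != 0 by rewrite -size_poly_eq0 size_cubic.
  have := ord_horner_pole X00 hm m0 c0; rewrite size_cubic /=; apply: ord_ae.
  by apply: (ae1 aeM) => X MX; rewrite pe2.
have {reg} reg : val (fun X => a.[px (M X)] + b.[px (M X)] * pe (M X)) X0 c.
  by apply: val_ae reg; apply: (ae1 aeM) => X MX; rewrite e.
have [b0|b0] := eqVneq b 0.
  have [s1|s1] := leqP (size a) 1.
    exists a`_0; apply: (ae1 (ae_neq (pzero E))) => X XO.
    by rewrite e // b0 horner0 mul0r addr0 (size1_polyC s1) hornerC coefC.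
  have a0 : a != 0 by rewrite -size_poly_gt0 (ltn_trans _ s1).
  have reg' : val (fun X => a.[px (M X)]) X0 c.
    by apply: val_ae reg; apply: ae_all => X; rewrite b0 horner0 mul0r addr0.
  have := val_ord_ge0 X00 reg' (ord_horner_pole X00 hm m0 a0).
  by rewrite oppr_ge0 leNgt pmulrn_rgt0 // -subn1 subn_gt0 s1.
exfalso; have hb := ordM (ord_horner_pole X00 hm m0 b0) hk.
set o2 := (_ + k) in hb.
have e2 : o2 *+ 2 = - (m *+ ((size b).-1.*2 + 3)).
  by rewrite /o2 mulrnDl ek mulNrn -mulrnA muln2 [in RHS]mulrnDr [RHS]opprD.
have o2neg : o2 < 0 by rewrite -(pmulrn_llt0 _ (isT : (0 < 2)%N)) e2 oppr_lt0 pmulrn_lgt0 // addn3.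
have [a0|a0] := eqVneq a 0.
  have reg' : val (fun X => b.[px (M X)] * pe (M X)) X0 c.
    by apply: val_ae reg; apply: ae_all => X; rewrite a0 horner0 add0r.
  by have := val_ord_ge0 X00 reg' hb; rewrite leNgt o2neg.
have ha := ord_horner_pole X00 hm m0 a0; set o1 := - _ in ha.
have e1 : o1 *+ 2 = - (m *+ (size a).-1.*2) by rewrite /o1 mulNrn -mulrnA muln2.
have [lt|lt|eq12] := ltgtP o1 o2.
- have := val_ord_ge0 X00 reg (ord_add_lt X00 ha hb lt).
  by rewrite leNgt (lt_trans lt o2neg).
- have reg' : val (fun X => b.[px (M X)] * pe (M X) + a.[px (M X)]) X0 c.
    by apply: val_ae reg; apply: ae_all => X; rewrite addrC.
  have := val_ord_ge0 X00 reg' (ord_add_lt X00 hb ha lt).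
  by rewrite leNgt o2neg.
have /eqP := congr1 (fun z => z *+ 2) eq12; rewrite e1 e2 eqr_opp => /eqP e3.
have : ((size a).-1.*2 = (size b).-1.*2 + 3)%N.
  have /eqP : m * ((size a).-1.*2%:R - ((size b).-1.*2 + 3)%:R) = 0.
    by rewrite mulrBr !mulr_natr e3 subrr.
  by rewrite mulf_eq0 gt_eqF //= subr_eq0 eqr_nat => /eqP.
by move/(congr1 odd); rewrite oddD !odd_double.
Qed.

(* If phi is invariant under translation by T and regular off the group generated by T,
   regularity spreads from -T down to T, and invariance forbids a pole at the origin. *)
Lemma invariant_regular_const phi T p : (0 < p)%N -> T *+ p = 0 -> T != 0 -> pe T != 0 ->
  rational phi -> ae (fun X => phi (X + T) = phi X) ->
  (forall X, (forall i, X != T *+ i) -> exists c, val phi X c) ->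
  (exists c, val phi (- T) c) -> exists d, ae (fun X => phi X = d).
Proof.
move=> pp Tp T0 p0 rphi inv out regT.
have reg_shift X : X != 0 -> X != - T -> (exists c, val phi (X + T) c) -> exists c, val phi X c.
  move=> X0 XT [c hc]; exists c; have [v1 v2] := val_translate X0 XT.
  have XT' : X + T != 0 by rewrite addr_eq0.
  exact: val_ae inv (val_comp (ratmap_add T) XT' v1 v2 hc).
have reg i : T *+ i != 0 -> exists c, val phi (- (T *+ i)) c.
  elim: i => [|i IHi]; first by rewrite mulr0n eqxx.
  move=> Ti; have [i0|i0] := eqVneq (T *+ i) 0; first by rewrite mulrS i0 addr0.
  apply: reg_shift; first by rewrite oppr_eq0.
    by rewrite eqr_opp mulrS -subr_eq0 addrAC subrr add0r.
  by rewrite mulrS opprD addrAC addNr add0r; apply: IHi.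
have regall X : X != 0 -> exists c, val phi X c.
  move=> X0; have [[i ei]|ni] := pselect (exists i, X = T *+ i); last first.
    by apply: out => i; apply/eqP => e; apply: ni; exists i.
  have [j ej] : exists j, X = - (T *+ j).
    exists (i * p.-1)%N; apply/eqP; rewrite -addr_eq0 ei mulrnA.
    by rewrite -mulrS prednK // mulrnAC Tp mul0rn.
  by rewrite ej; apply: reg; rewrite -oppr_eq0 -ej.
have [psi ppsi epsi] := regular_polyfun rphi regall.
have [c hc] := regT; have nT0 : - T != 0 by rewrite oppr_eq0.
have hc' : val (fun X => psi (X + T)) (- T) c.
  apply: val_ae hc; apply: (ae2 inv (ratmap_ae (ratmap_add T) epsi)) => X <-.
  by [].
have [d hd] := polyfun_pole_const nT0 ppsi (ratmap_add T) (translate_pole T0 p0) hc'.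
by exists d; apply: (ae2 epsi hd) => X ->.
Qed.

End Translations.
(** * The Weil pairing *)

Section WeilPairing.
Variables (L : fieldType) (E : ecurve L).
Let gE := ecurveP E.
Let closedL : GRing.closed_field_axiom L. Proof. by case: gE. Qed.
Let charL : forall n, n.+1%:R != 0 :> L. Proof. by case: gE. Qed.
Implicit Types (X Y Z S T : point E) (phi psi : point E -> L).
Notation ae := (@for_almost_all L E).

Variable p : nat.
Hypotheses (p_prime : prime p) (p_odd : odd p).
Variable e : point E -> point E -> L.
Hypothesis he : weil_pairing p e.

Let p0 : (0 < p)%N. Proof. exact: prime_gt0. Qed.
Let rp := @ratmap_mulrn L E p p0.

Lemma same_pow phi psi c : rational phi -> rational psi -> c != 0 -> ae (fun X => psi X != 0) ->
  ae (fun X => phi X ^+ p = c * psi X ^+ p) -> exists2 d, d != 0 & ae (fun X => phi X = d * psi X).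
Proof.
move=> rphi rpsi c0 nz h.
have [||d hd] := @rational_root L E (fun X => phi X / psi X) p c p0.
- exact/rationalM/rationalV.
- by apply: (ae2 h nz) => X hX nX; rewrite exprMn exprVn hX mulfK // expf_neq0.
have hd' : ae (fun X => phi X = d * psi X) by apply: (ae2 hd nz) => X <- nX; rewrite divfK.
exists d => //; apply/eqP => d0; apply: (@ae_const L E).
apply: (ae3 hd' h nz) => X; rewrite d0 mul0r => ->; rewrite expr0n gtn_eqF // => /esym/eqP.
by rewrite mulf_eq0 (negPf c0) expf_eq0 p0 => /= ->.
Qed.

Definition weil_functions T (f g : point E -> L) :=
  [/\ hasdiv f (fun X => dl T X *+ p), rational g, ae (fun X => g X != 0),
      ae (fun X => f (X *+ p) = g X ^+ p) &
      forall S, S *+ p = 0 -> ae (fun X => g (X + S) = e S T * g X)].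

(** [weil_pairing] supplies f and g anew for each S. Two choices of f have the same divisor, so the
    choices of g differ by a constant, which cancels in g(X + S) / g(X); one pair serves all S. *)
Lemma weil_functions_exist T : T *+ p = 0 -> exists f g, weil_functions T f g.
Proof.
move=> Tp.
have data S : S *+ p = 0 -> exists f g, [/\ hasdiv f (fun X => dl T X *+ p), rational g,
    ae (fun X => g X != 0), ae (fun X => f (X *+ p) = g X ^+ p) &
    ae (fun X => g (X + S) = e S T * g X)].
  move=> Sp; have [||f [g [hdiv h1 h2]]] := he (S := S) (T := T).
  - by rewrite torsionE Sp.
  - by rewrite torsionE Tp.
  exists (rat_eval f), (rat_eval g).
  have hf : hasdiv (rat_eval f) (fun X => dl T X *+ p).
    apply: hasdiv_eq (has_divisor_hasdiv hdiv) => X X0.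
    rewrite (negPf X0) mulr0n subr0 /dl.
    by case: eqP => _; rewrite ?mulr0n ?mul0rn // !mulr1n natz.
  have h1' : ae (fun X => rat_eval f (X *+ p) = rat_eval g X ^+ p).
    by apply: (ae1 h1) => X; rewrite pmulE.
  split=> //; first exact: rational_rat_eval.
  apply: (ae2 h1' (ratmap_ae rp (hasdiv_nz hf))) => X ->.
  by rewrite expf_eq0 p0.
have [f [g [hf rg g0 fg _]]] := data 0 (mul0rn _ _).
exists f, g; split=> // S Sp; have [f1 [g1 [hf1 rg1 g10 fg1 gS]]] := data S Sp.
have [c c0 hc] := hasdiv_same hf hf1.
have [d d0 hd] : exists2 d, d != 0 & ae (fun X => g X = d * g1 X).
  apply: (same_pow rg rg1 c0 g10); apply: (ae3 fg fg1 (ratmap_ae rp hc)) => X <- <- ->.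
  by [].
apply: (ae3 hd gS (ratmap_ae (ratmap_add S) hd)) => X e1 e2 e3.
by rewrite e3 e2 e1; ring.
Qed.

Lemma weil_root S T : S *+ p = 0 -> T *+ p = 0 -> e S T ^+ p = 1.
Proof.
move=> Sp Tp; have [f [g [hf rg g0 fg gS]]] := weil_functions_exist Tp.
have h : ae (fun X => g (X + S) ^+ p = g X ^+ p).
  apply: (ae2 fg (ratmap_ae (ratmap_add S) fg)) => X <- <-.
  by rewrite mulrnDl Sp addr0.
apply: (@ae_const L E); apply: (ae3 g0 (gS S Sp) h) => X gX ->.
rewrite exprMn -[RHS]mul1r => /eqP.
by rewrite (inj_eq (mulIf (expf_neq0 p gX))) => /eqP.
Qed.

Lemma weil_add_l S1 S2 T : S1 *+ p = 0 -> S2 *+ p = 0 -> T *+ p = 0 ->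
  e (S1 + S2) T = e S1 T * e S2 T.
Proof.
move=> Sp1 Sp2 Tp; have [f [g [hf rg g0 fg gS]]] := weil_functions_exist Tp.
have Sp : (S1 + S2) *+ p = 0 by rewrite mulrnDl Sp1 Sp2 addr0.
apply: (@ae_const L E).
have h : ae (fun X => g (X + (S1 + S2)) = e S1 T * e S2 T * g X).
  apply: (ae2 (gS S1 Sp1) (ratmap_ae (ratmap_add S1) (gS S2 Sp2))) => X e1.
  by rewrite -addrA => ->; rewrite e1; ring.
apply: (ae3 g0 (gS _ Sp) h) => X gX -> /eqP.
by rewrite (inj_eq (mulIf gX)) => /eqP.
Qed.

(** Let h have divisor (T1) + (T2) - (T1 + T2). Then f1 f2 is a multiple of f3 h^p, so g1 g2 is a
    multiple of g3(X) h(pX), and h(pX) does not change under translation by S. *)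
Lemma weil_add_r S T1 T2 : S *+ p = 0 -> T1 *+ p = 0 -> T2 *+ p = 0 ->
  e S (T1 + T2) = e S T1 * e S T2.
Proof.
move=> Sp Tp1 Tp2; have Tp : (T1 + T2) *+ p = 0 by rewrite mulrnDl Tp1 Tp2 addr0.
have [f1 [g1 [hf1 rg1 g10 fg1 gS1]]] := weil_functions_exist Tp1.
have [f2 [g2 [hf2 rg2 g20 fg2 gS2]]] := weil_functions_exist Tp2.
have [f3 [g3 [hf3 rg3 g30 fg3 gS3]]] := weil_functions_exist Tp.
have [h hh] := hasdiv_add T1 T2.
have h12 := hasdivM hf1 hf2.
have h3 : hasdiv (fun X => f3 X * h X ^+ p) (fun X => dl T1 X *+ p + dl T2 X *+ p).
  by apply: hasdiv_eq (hasdivM hf3 (hasdivX p hh)) => X _; rewrite -!mulrnDl addrC subrK.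
have [c c0 hc] := hasdiv_same h12 h3.
have rh := ratmap_comp rp (hasdiv_rational hh).
have nzh := ratmap_ae rp (hasdiv_nz hh).
have [||d d0 hd] := @same_pow (fun X => g1 X * g2 X) (fun X => g3 X * h (X *+ p)) c
   (rationalM rg1 rg2) (rationalM rg3 rh) c0.
- by apply: (ae2 g30 nzh) => X; apply: mulf_neq0.
- have h' := ae2 fg1 fg2 (C := fun X => f1 (X *+ p) * f2 (X *+ p) = (g1 X * g2 X) ^+ p).
  have {}h' := h' (fun X a b => etrans (congr2 *%R a b) (esym (exprMn _ _ _))).
  apply: (ae3 h' fg3 (ratmap_ae rp hc)) => X <- e3 ->.
  by rewrite e3 exprMn.
have hs1 : ae (fun X => g1 (X + S) * g2 (X + S) = e S T1 * e S T2 * (g1 X * g2 X)).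
  by apply: (ae2 (gS1 S Sp) (gS2 S Sp)) => X -> ->; ring.
have hs2 : ae (fun X => g1 (X + S) * g2 (X + S) = e S (T1 + T2) * (g1 X * g2 X)).
  apply: (ae3 hd (ratmap_ae (ratmap_add S) hd) (gS3 S Sp)) => X -> -> ->.
  by rewrite mulrnDl Sp addr0; ring.
apply: (@ae_const L E).
have g12 : ae (fun X => g1 X * g2 X != 0) by apply: (ae2 g10 g20) => X; apply: mulf_neq0.
apply: (ae3 g12 hs1 hs2) => X gX -> /eqP.
by rewrite (inj_eq (mulIf gX)) => /eqP.
Qed.

Lemma torsion_pe_neq0 T : T != 0 -> T *+ p = 0 -> pe T != 0.
Proof.
move=> T0 Tp; apply/eqP => h; move: T0; have := pe0_popp _ h.
case: eqP => // /eqP T0 /(_ isT) eT; have T2 : T *+ 2 = 0 by rewrite mulr2n -{2}eT poppE subrr.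
have := mulrn_gcd T2 Tp; rewrite (eqP (_ : coprime 2 p)) ?coprime2n // mulr1n => e0.
by rewrite e0 eqxx in T0.
Qed.

Lemma orbit_prod (T : point E) (F : point E -> L) X : T *+ p = 0 ->
  \prod_(i < p) F (X + T + T *+ i) = \prod_(i < p) F (X + T *+ i).
Proof.
move=> Tp; rewrite -(prednK p0) big_ord_recr big_ord_recl /= mulrC; congr (_ * _).
  by rewrite -addrA -mulrS prednK // Tp mulr0n.
by apply: eq_bigr => i _; rewrite /bump /= add1n mulrS addrA.
Qed.

(** Choose T' with pT' = T. The product [G] of the g(X + iT') has p-th power [Pi](pX), where [Pi] is
    the product of the f(X + iT). Once [Pi] is constant so is [G], and comparing [G] at X and X + T'
    gives g(X + T) = g(X). *)
Lemma weil_alternating T : T *+ p = 0 -> e T T = 1.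
Proof.
move=> Tp; have [f [g [hf rg g0 fg gS]]] := weil_functions_exist Tp.
have rf := hasdiv_rational hf.
have [T0|T0] := eqVneq T 0.
  apply: (@ae_const L E); apply: (ae2 g0 (gS T Tp)) => X gX.
  by rewrite {1}T0 addr0 => /eqP; rewrite -{1}[g X]mul1r (inj_eq (mulIf gX)) => /eqP ->.
pose Pi X := \prod_(i < p) f (X + T *+ i).
have rPi : rational Pi.
  by apply: rational_prod => i; apply: (ratmap_comp (ratmap_add (T *+ i)) rf).
have [d hd] : exists d, ae (fun X => Pi X = d).
  have nP := torsion_pe_neq0 T0 Tp.
  have inv : ae (fun X => Pi (X + T) = Pi X) by apply: ae_all => X; apply: orbit_prod.
  have out X : (forall i, X != T *+ i) -> exists2 c, c != 0 & val Pi X c.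
    move=> nX; have X0 : X != 0 by have := nX 0%N.
    have [i|c hc] := @choice 'I_p L (fun i c => c != 0 /\ val (fun Y => f (Y + T *+ i)) X c).
      have nXi k : X + T *+ i != T *+ k.
        have h := nX (k + (p - i))%N; apply: contraNneq h => h.
        by rewrite mulrnDr -h -addrA -mulrnDr subnKC ?(ltnW (ltn_ord i)) // Tp addr0.
      have X1 : X + T *+ i != 0 by have := nXi 0%N.
      have := hf _ X1; rewrite /dl (negPf (nXi 1%N)) mul0rn => /ord0_val [c c0 hc].
      have nS : X != - (T *+ i) by rewrite -addr_eq0.
      have [v1 v2] := val_translate X0 nS.
      by exists c; split=> //; apply: (val_comp (ratmap_add _) X1 v1 v2 hc).
    exists (\prod_(i < p) c i); first by apply/prodf_neq0 => i _; case: (hc i).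
    by apply: val_prod => i; case: (hc i).
  have nT0 : - T != 0 by rewrite oppr_eq0.
  (* The order of [Pi] at -T is not computed: if it has a pole there, its inverse is regular and
     satisfies the same hypotheses. *)
  case: (regular_or_pole nT0 rPi) => [regT|pole].
    apply: (invariant_regular_const p0 Tp T0 nP rPi inv) => // X /out [c _ hc].
    by exists c.
  have [||| |d hd] := @invariant_regular_const L E (fun X => (Pi X)^-1) T p p0 Tp T0 nP.
  - exact: rationalV.
  - by apply: (ae1 inv) => X ->.
  - move=> X nX; have [c c0 hc] := out X nX; exists c^-1; apply: valV => //.
    by have := nX 0%N.
  - by exists 0.
  by exists d^-1; apply: (ae1 hd) => X <-; rewrite invrK.
have [T' eT'] := @mulrn_surj L E p p0 T.
pose G X := \prod_(i < p) g (X + T' *+ i).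
have rG : rational G.
  by apply: rational_prod => i; apply: (ratmap_comp (ratmap_add (T' *+ i)) rg).
have prod_ae (R : 'I_p -> point E -> Prop) : (forall i, ae (R i)) -> ae (fun X => forall i, R i X).
  move=> hR; have h := ae_forall_in (s := index_enum 'I_p) (fun i _ => hR i).
  by apply: (ae1 h) => X hX i; apply: hX; rewrite mem_index_enum.
have GP : ae (fun X => G X ^+ p = d).
  have h1 := prod_ae _ (fun i => ratmap_ae (ratmap_add (T' *+ i)) fg).
  apply: (ae2 h1 (ratmap_ae rp hd)) => X e1 <-.
  rewrite -prodrXl; apply: eq_bigr => i _; rewrite -e1.
  by rewrite mulrnDl mulrnAC eT'.
have [c hG] := rational_root p0 rG GP.
have gnz : ae (fun X => forall i : 'I_p, g (X + T' *+ i) != 0).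
  by apply: prod_ae => i; apply: (ratmap_ae (ratmap_add _) g0).
(* Passing from X to X + T' in [G] replaces the factor g(X) by g(X + pT'). *)
have inv : ae (fun X => g (X + T) = g X).
  apply: (ae3 hG (ratmap_ae (ratmap_add T') hG) gnz) => X <- + nz.
  rewrite /G => h.
  have nz' : \prod_(i < p.-1) g (X + T' *+ i.+1) != 0.
    apply/prodf_neq0 => i _; have ip : (i.+1 < p)%N by rewrite -ltn_predRL ltn_ord.
    exact: nz (Ordinal ip).
  apply: (mulIf nz'); move: h; rewrite -(prednK p0) big_ord_recr big_ord_recl /= mulr0n addr0.
  rewrite -addrA -mulrS prednK // eT' mulrC => h.
  have eP : \prod_(i < p.-1) g (X + T' + T' *+ i) = \prod_(i < p.-1) g (X + T' *+ i.+1).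
    by apply: eq_bigr => i _; rewrite mulrS addrA.
  by rewrite -{1}eP h.
apply: (@ae_const L E); apply: (ae3 g0 (gS T Tp) inv) => X gX -> /eqP.
by rewrite -{2}[g X]mul1r (inj_eq (mulIf gX)) => /eqP.
Qed.

Lemma weil_nondegenerate T : T *+ p = 0 -> (forall S, S *+ p = 0 -> e S T = 1) -> T = 0.
Proof.
move=> Tp triv; have [f [g [hf rg g0 fg gS]]] := weil_functions_exist Tp.
have [|h rh eh] := @descent L E p p0 g rg.
  by move=> S Sp; apply: (ae1 (gS S Sp)) => X ->; rewrite triv // mul1r.
have fh : ae (fun X => f X = h X ^+ p).
  case: (rational_eq (hasdiv_rational hf) (rationalX p rh)) => // ne.
  exfalso; apply: (@ae_const L E).
  by apply: (ae3 (ratmap_ae rp ne) fg eh) => X ne' e1 e2; rewrite e1 e2 eqxx in ne'.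
have nzh : ae (fun X => h X != 0).
  by apply: (ae2 fh (hasdiv_nz hf)) => X ->; rewrite expf_eq0 p0.
apply: (@hasdiv_point_inj L E h) => X X0; have [n hn] := ord_exists X0 rh nzh.
suff -> : dl T X - dl 0 X = n by [].
have h1 : ord f X (n *+ p) by apply: ord_ae (ordX p hn); apply: (ae1 fh) => Y ->.
have := ord_uniq X0 h1 (hf X X0) => /eqP; rewrite -subr_eq0 -mulrnBl mulrn_eq0.
by rewrite (gtn_eqF p0) /= subr_eq0 dlO // subr0 => /eqP ->.
Qed.

End WeilPairing.
(** * Expansion of the star power *)

Section FiniteSums.
Variables (L : fieldType) (E : ecurve L).
Implicit Types (X Y Z R S T : point E).

Variables (p : nat) (p0 : (0 < p)%N) (e rho : point E -> point E -> L).

Lemma sum_indicator (I : eqType) (s : seq I) (u : I) (F : I -> L) : uniq s ->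
  \sum_(U <- s) F U * (U == u)%:R = (u \in s)%:R * F u.
Proof.
move=> us; rewrite (eq_bigr (fun U => if U == u then F u else 0)); last first.
  by move=> U _; case: eqP => [->|_]; rewrite ?mulr1 ?mulr0.
rewrite -big_mkcond /= -big_filter; have [ui|ui] := boolP (u \in s).
  by rewrite filter_pred1_uniq // big_seq1 mul1r.
rewrite mul0r big1_seq // => U; rewrite mem_filter => /andP[_ /andP[/eqP -> us']].
by rewrite us' in ui.
Qed.

Lemma star_expand (I J : finType) (c : I -> L) (R : I -> point E) (S : J -> point E)
    (f g : point E -> L) T :
  (forall i, R i *+ p = 0) -> (forall j, S j *+ p = 0) ->
  (forall X, f X = \sum_i c i * delta (R i) X) -> (forall X, g X = \sum_j delta (S j) X) ->
  star p e rho f g T =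
    \sum_i \sum_j c i * (eps p e (R i) (S j) * rho (R i) (S j)) * delta (R i + S j) T.
Proof.
move=> Rp Sp ef eg; rewrite /star; set A := (X in \sum_(_ \in X) _).
(* A sum over a set is a genuine sum only when the support is finite, which finiteness of E[p]
   provides. *)
have finA : finite_set A.
  have [s hs] := torsion_finite E p0.
  apply: (@sub_finite_set _ _ [set` [seq (X, Y) | X <- s, Y <- s]]); last exact: finite_seq.
  move=> [X Y] /= []; rewrite !torsionE => /eqP/hs X1 /eqP/hs Y1 _.
  by apply/allpairsP; exists (X, Y).
rewrite (fsbig_finite _ _ finA) /=; set s := finmap.enum_fset _.
have us : uniq s by apply: finmap.fset_uniq.
transitivity (\sum_(U <- s) \sum_i \sum_j
    (c i * (eps p e U.1 U.2 * rho U.1 U.2)) * (U == (R i, S j))%:R).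
  apply: eq_bigr => U _; rewrite ef eg mulr_sumr mulr_suml; apply: eq_bigr => i _.
  rewrite mulr_sumr; apply: eq_bigr => j _; rewrite /delta -pair_eqE /=.
  by case: (U.1 == R i); case: (U.2 == S j); rewrite /= ?mulr0 ?mul0r // ?mulr1; ring.
rewrite exchange_big; apply: eq_bigr => i _; rewrite exchange_big; apply: eq_bigr => j _.
rewrite sum_indicator // mulrC; congr (_ * _); rewrite /delta; congr (nat_of_bool _)%:R.
have memA U : (U \in s) = (U \in A) := in_fset_set finA U.
rewrite memA; apply/idP/idP => [|/eqP TS].
  by rewrite in_setE => -[_ _ <-].
by rewrite in_setE /A /= !torsionE Rp Sp TS !eqxx.
Qed.

Section Extend.
Variables (n : nat) (A : finType).

(** Appends a last index, matching one more factor on the right of the star power. *)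
Definition ext (u : {ffun 'I_n -> A} * A) : {ffun 'I_n.+1 -> A} :=
  [ffun l => if unlift ord_max l is Some k then u.1 k else u.2].

Lemma ext_lift u k : ext u (lift ord_max k) = u.1 k.
Proof. by rewrite ffunE liftK. Qed.

Lemma ext_max u : ext u ord_max = u.2.
Proof. by rewrite ffunE unlift_none. Qed.

Lemma sum_ext (F : {ffun 'I_n.+1 -> A} -> L) :
  \sum_i F i = \sum_(i : {ffun 'I_n -> A}) \sum_a F (ext (i, a)).
Proof.
rewrite pair_big /= (reindex ext) /=; first by apply: eq_bigr => -[].
exists (fun j => ([ffun k => j (lift ord_max k)], j ord_max)) => [[i a] _|j _].
  by congr (_, _); [apply/ffunP => k; rewrite ffunE ext_lift|rewrite ext_max].
apply/ffunP => l; case: (unliftP ord_max l) => [k ->|->]; last by rewrite ext_max.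
by rewrite ext_lift ffunE.
Qed.

End Extend.

Lemma widen_lift n (k : 'I_n) : widen_ord (leqnSn n) k = lift ord_max k.
Proof. by apply: ord_inj; rewrite /= /bump leqNgt ltn_ord. Qed.

(** Indices start at 0, so this is i_1 + ... + i_m in the usual numbering. *)
Definition psum n (i : {ffun 'I_n -> 'I_p}) m := (\sum_(l < n | (l < m)%N) i l)%N.

Lemma psum_ext n (i : {ffun 'I_n -> 'I_p}) a m : (m <= n)%N -> psum (ext (i, a)) m = psum i m.
Proof.
move=> mn; rewrite /psum big_mkcond big_ord_recr /= ltnNge mn addn0 -big_mkcond /=.
rewrite [LHS]big_mkcond [RHS]big_mkcond; apply: eq_bigr => k _.
by rewrite widen_lift ext_lift.
Qed.

Lemma psum_extS n (i : {ffun 'I_n -> 'I_p}) a : psum (ext (i, a)) n.+1 = (psum i n + a)%N.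
Proof.
rewrite /psum (eq_bigl xpredT); last by move=> l; rewrite ltn_ord.
rewrite [in RHS](eq_bigl xpredT); last by move=> l; rewrite ltn_ord.
rewrite big_ord_recr /=; congr (_ + _)%N; last by rewrite ext_max.
apply: eq_bigr => k _.
by rewrite widen_lift ext_lift.
Qed.

Variables (P Q : point E).
Hypotheses (Pp : P *+ p = 0) (Qp : Q *+ p = 0).

(** The structure constant of the product of the indicators of mQ + sP and Q + aP. *)
Definition kappa m s a : L :=
  eps p e (Q *+ m + P *+ s) (Q + P *+ a) * rho (Q *+ m + P *+ s) (Q + P *+ a).

Lemma star_powS_expand n T : star_powS p e rho (Delta p P Q) n T =
  \sum_(i : {ffun 'I_n.+1 -> 'I_p})
     (\prod_(m < n.+1 | (0 < m)%N) kappa m (psum i m) (i m))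
     * delta (Q *+ n.+1 + P *+ psum i n.+1) T.
Proof.
have tor a b : (Q *+ a + P *+ b) *+ p = 0 by rewrite mulrnDl !(mulrnAC _ _ p) Pp Qp !mul0rn addr0.
have eD X : Delta p P Q X = \sum_(a < p) delta (Q + P *+ a) X.
  by apply: eq_bigr => a _; rewrite pmulE.
elim: n T => [|n IHn] T.
  rewrite /= eD sum_ext exchange_big /=; apply: eq_bigr => a _.
  rewrite (eq_bigr (fun=> delta (Q + P *+ a) T)).
    by rewrite sumr_const card_ffun !card_ord expn0.
  move=> i _; rewrite psum_extS /psum big_ord0 add0n mulr1n.
  by rewrite big_pred0 ?mul1r // => m; rewrite ord1.
rewrite /= (star_expand (S := fun a : 'I_p => Q + P *+ a) T _ _ IHn eD).
- rewrite [RHS]sum_ext; apply: eq_bigr => i _; apply: eq_bigr => a _.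
  rewrite psum_extS [in RHS]big_mkcond [in RHS]big_ord_recr /=.
  rewrite (psum_ext _ _ (leqnn n.+1)) ext_max; congr (_ * _ * _); last first.
    by rewrite addrACA -mulrSr -mulrnDr.
    rewrite [LHS]big_mkcond; apply: eq_bigr => k _ /=; case: ifP => // _.
    by rewrite (psum_ext _ _ (ltnW (ltn_ord k))) widen_lift ext_lift.
- by move=> i; apply: tor.
by move=> a; rewrite -[Q]mulr1n tor.
Qed.

End FiniteSums.

(** * Partial sums and cyclic shifts of the indices *)

Section CyclicShift.
Variables (L : fieldType) (p : nat).
Implicit Types (i : {ffun 'I_p.+1 -> 'I_p.+1}).

(** The entry [i l] occurs in the partial sums with l < m, that is p - l times, and l + 1 times in
    the weighted sum. *)
Lemma sum_psum i :
  (\sum_(m < p.+1) psum i m + \sum_(l < p.+1) l.+1 * i l = p.+1 * \sum_(l < p.+1) i l)%N.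
Proof.
rewrite (eq_bigr (fun m : 'I_p.+1 => \sum_(l < p.+1) (l < m) * i l)%N); last first.
  move=> m _; rewrite /psum big_mkcond; apply: eq_bigr => l _; by case: ifP; rewrite ?mul1n ?mul0n.
rewrite exchange_big -big_split big_distrr; apply: eq_bigr => l _ /=.
rewrite -big_distrl /= -mulnDl; congr (_ * _)%N.
have count n k : (\sum_(m < n) (k < m))%N = (n - k.+1)%N.
  elim: n => [|n IHn]; first by rewrite big_ord0.
  rewrite big_ord_recr /= IHn subSS; case: ltnP => h; first by rewrite addn1 subnSK.
  by rewrite addn0; apply/eqP; rewrite (_ : n - k = 0)%N ?subn_eq0 ?(leq_trans h) //; apply/eqP.
by rewrite count subnK.
Qed.

Definition cshift i : {ffun 'I_p.+1 -> 'I_p.+1} := [ffun l => i (ordS l)].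

Lemma cshift_inj : injective cshift.
Proof.
move=> i i' h; apply/ffunP => l; have := congr1 (fun f : {ffun _ -> _} => f (ord_pred l)) h.
by rewrite !ffunE ord_predK.
Qed.

Lemma sum_cshift i : (\sum_l cshift i l = \sum_l i l)%N.
Proof.
by rewrite [RHS](reindex_inj (@ordS_inj p.+1)); apply: eq_bigr => l _; rewrite ffunE.
Qed.

End CyclicShift.

(** * The star power of Delta; here the prime is [p.+1] *)

Section StarPower.
Variables (L : fieldType) (E : ecurve L).
Implicit Types (X Y Z R S T : point E).
Variable p : nat.
Hypotheses (p_prime : prime p.+1) (p_odd : odd p.+1).
Variable e : point E -> point E -> L.
Hypothesis he : weil_pairing p.+1 e.
Variables P Q : point E.
Hypotheses (Pp : P *+ p.+1 = 0) (Qp : Q *+ p.+1 = 0).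
Hypothesis gen : generate_torsion p.+1 P Q.

Let z := e Q P.

Lemma torsion_mul T m : T *+ p.+1 = 0 -> (T *+ m) *+ p.+1 = 0.
Proof. by move=> Tp; rewrite mulrnAC Tp mul0rn. Qed.

Let alt T : T *+ p.+1 = 0 -> e T T = 1 := weil_alternating p_prime p_odd he (T := T).
Let addl := weil_add_l p_prime he.
Let addr' := weil_add_r p_prime he.
Let root := weil_root p_prime he.

Lemma weil0l T : T *+ p.+1 = 0 -> e 0 T = 1.
Proof.
move=> Tp; have h := addl (mul0rn _ _) (mul0rn _ _) Tp; rewrite addr0 in h.
have n0 : e 0 T != 0.
  have := root (mul0rn _ _) Tp; case: eqP => // ->.
  by rewrite expr0n => /esym/eqP; rewrite oner_eq0.
by apply: (mulfI n0); rewrite mulr1 -h.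
Qed.

Lemma weil_mull S T m : S *+ p.+1 = 0 -> T *+ p.+1 = 0 -> e (S *+ m) T = e S T ^+ m.
Proof.
move=> Sp Tp; elim: m => [|m IHm]; first by rewrite mulr0n weil0l.
by rewrite mulrS addl ?torsion_mul // IHm exprS.
Qed.

Lemma weil_skew S T : S *+ p.+1 = 0 -> T *+ p.+1 = 0 -> e S T * e T S = 1.
Proof.
move=> Sp Tp; have STp : (S + T) *+ p.+1 = 0 by rewrite mulrnDl Sp Tp addr0.
by have := alt STp; rewrite addl ?addr' // !alt // mul1r mulr1.
Qed.

Lemma weil_mulr S T m : S *+ p.+1 = 0 -> T *+ p.+1 = 0 -> e S (T *+ m) = e S T ^+ m.
Proof.
move=> Sp Tp; have Tm := torsion_mul m Tp.
have n0 : e (T *+ m) S != 0.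
  by apply/eqP => h; have := weil_skew Tm Sp; rewrite h mul0r => /esym/eqP; rewrite oner_eq0.
apply: (mulfI n0); rewrite weil_skew // weil_mull // -exprMn weil_skew //.
by rewrite expr1n.
Qed.

(** The pairing is z^(m a - s), as e(P,Q) is the inverse of z; z^s stands on the left to avoid
    negative exponents. *)
Lemma weil_basis m s a :
  e (Q *+ m + P *+ s) (Q + P *+ a) * z ^+ s = z ^+ (m * a).
Proof.
have Pa := torsion_mul a Pp; have Qm := torsion_mul m Qp; have Ps := torsion_mul s Pp.
have QPa : (Q + P *+ a) *+ p.+1 = 0 by rewrite mulrnDl Qp Pa addr0.
rewrite addl // !addr' // !weil_mull // !weil_mulr // !alt // !expr1n mul1r mulr1.
rewrite -/z -exprM -mulrA -[X in _ * X]exprMn weil_skew // expr1n mulr1 mulnC.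
by [].
Qed.

(** Otherwise z = 1 by Bezout, the pairing is trivial on the generators P and Q, and non-degeneracy
    contradicts the existence of a non-zero torsion point. *)
Lemma weil_primitive s : z ^+ s = 1 -> (p.+1 %| s)%N.
Proof.
move=> zs; apply: contraT => nps.
have cop : coprime s p.+1 by rewrite coprime_sym prime_coprime.
have z1 : z = 1.
  have zp : z ^+ p.+1 = 1 := root Qp Pp.
  have [s0|s0] := posnP s; first by rewrite s0 dvdn0 in nps.
  have [a _ /dvdnP [q eq_]] := Bezoutl p.+1 s0.
  have h : z ^+ (1 + a * p.+1) = 1 by rewrite -(eqP cop) eq_ mulnC exprM zs expr1n.
  by move: h; rewrite exprD mulnC exprM zp expr1n mulr1 expr1.
have PQ1 : e P Q = 1 by have := weil_skew Qp Pp; rewrite -/z z1 mul1r.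
have [T T0 Tp] := @exists_torsion L E p.+1 p_odd (prime_gt1 p_prime).
suff T00 : T = 0 by rewrite T00 eqxx in T0.
apply: (weil_nondegenerate p_prime he Tp) => S Sp.
have rep X : X *+ p.+1 = 0 -> exists a b, X = P *+ a + Q *+ b.
  move=> Xp; have [|a [b ->]] := gen (T := X); first by rewrite torsionE Xp.
  by exists a, b; rewrite !pmulE.
have [a [b ->]] := rep _ Tp; have [c [d ->]] := rep _ Sp.
have tm := torsion_mul.
rewrite addl ?addr' ?tm // ?mulrnDl ?tm ?addr0 //.
by rewrite !weil_mull ?weil_mulr ?tm // !alt // -/z z1 PQ1 !expr1n !mulr1.
Qed.

Variables (rho : point E -> point E -> L) (gamma : point E -> L).
Hypothesis gamma0 : forall T, T *+ p.+1 = 0 -> gamma T != 0.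
Hypothesis rhoE : forall S T, S *+ p.+1 = 0 -> T *+ p.+1 = 0 ->
  rho S T = gamma S * gamma T / gamma (S + T).

Implicit Types i : {ffun 'I_p.+1 -> 'I_p.+1}.

Let z0 : z != 0.
Proof.
apply/eqP => h; have := root Qp Pp; rewrite -/z h expr0n => /esym/eqP.
by rewrite oner_eq0.
Qed.

Let tor a b : (Q *+ a + P *+ b) *+ p.+1 = 0.
Proof. by rewrite mulrnDl !torsion_mul // addr0. Qed.

Let torS a : (Q + P *+ a) *+ p.+1 = 0.
Proof. by rewrite -[Q]mulr1n tor. Qed.

Definition rho_prod i := \prod_(m < p.+1 | (0 < m)%N) rho (Q *+ m + P *+ psum i m) (Q + P *+ i m).

Lemma psum0 n (i : {ffun 'I_n -> 'I_p.+1}) : psum i 0 = 0%N.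
Proof. by rewrite /psum big_pred0. Qed.

Lemma psumS n (i : {ffun 'I_n -> 'I_p.+1}) (m : 'I_n) : psum i m.+1 = (psum i m + i m)%N.
Proof.
rewrite /psum (bigD1 m) //= addnC; congr (_ + _)%N.
by apply: eq_bigl => l; rewrite ltnS [RHS]ltn_neqAle andbC.
Qed.

Lemma psum_full n (i : {ffun 'I_n -> 'I_p.+1}) : psum i n = (\sum_l i l)%N.
Proof. by apply: eq_bigl => l; rewrite ltn_ord. Qed.

(** Telescoping: the denominator of each factor is the first numerator term of the next, and in the
    last denominator the multiple of Q vanishes. The result is symmetric in the indices. *)
Lemma rho_prodE i : rho_prod i = \prod_l gamma (Q + P *+ i l) / gamma (P *+ (\sum_l i l)%N).
Proof.
have key n : (n < p.+1)%N ->
    \prod_(m < p.+1 | (0 < m < n.+1)%N) rho (Q *+ m + P *+ psum i m) (Q + P *+ i m)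
    = \prod_(m < p.+1 | (m < n.+1)%N) gamma (Q + P *+ i m) / gamma (Q *+ n.+1 + P *+ psum i n.+1).
  elim: n => [_|n IHn np].
    rewrite big_pred0; last by case=> -[].
    rewrite (big_pred1 ord0) => [|m]; last by rewrite ltnS leqn0.
    by rewrite (psumS i ord0) psum0 add0n mulr1n mulfV // gamma0.
  pose m0 := Ordinal np.
  rewrite (bigD1 m0) //= [in RHS](bigD1 m0) //=.
  have e1 : \prod_(m < p.+1 | (0 < m < n.+2)%N && (m != m0))
        rho (Q *+ m + P *+ psum i m) (Q + P *+ i m)
    = \prod_(m < p.+1 | (0 < m < n.+1)%N) rho (Q *+ m + P *+ psum i m) (Q + P *+ i m).
    by apply: eq_bigl => m; rewrite -andbA; congr (_ && _); rewrite ltnS [RHS]ltn_neqAle andbC.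
  rewrite e1 IHn ?(ltnW np) //.
  have -> : \prod_(m < p.+1 | (m < n.+2)%N && (m != m0)) gamma (Q + P *+ i m)
     = \prod_(m < p.+1 | (m < n.+1)%N) gamma (Q + P *+ i m).
    by apply: eq_bigl => m; rewrite ltnS [RHS]ltn_neqAle andbC.
  rewrite rhoE //.
  have -> : Q *+ n.+1 + P *+ psum i n.+1 + (Q + P *+ i m0) = Q *+ n.+2 + P *+ psum i n.+2.
    by rewrite (psumS i m0) addrACA -mulrSr -mulrnDr.
  have g1 := gamma0 (tor n.+1 (psum i n.+1)); have g2 := gamma0 (tor n.+2 (psum i n.+2)).
  by field; rewrite g1 g2.
have k := key p (ltnSn p); rewrite Qp add0r psum_full in k.
transitivity (\prod_(m < p.+1 | (0 < m < p.+1)%N) rho (Q *+ m + P *+ psum i m) (Q + P *+ i m)).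
  by apply: eq_bigl => m; rewrite ltn_ord andbT.
by rewrite k; congr (_ / _); apply: eq_bigl => m; rewrite ltn_ord.
Qed.

(** Half of the prime plus one, so that [y] is epsilon(Q,P), the square root of z among the roots of
    unity of that prime order. *)
Let h := (p.+2)./2.
Let y := z ^+ h.

Let y2 : y ^+ 2 = z.
Proof.
rewrite /y -exprM muln2 /h.
have -> : (p.+2)./2.*2 = p.+2.
  by rewrite -[RHS]odd_double_half /=; move: p_odd; rewrite /= => /negPf ->.
by rewrite exprS (root Qp Pp) mulr1.
Qed.

Let yp : y ^+ p.+1 = 1.
Proof. by rewrite /y -exprM mulnC exprM (root Qp Pp) expr1n. Qed.

(** Let s be the sum and W the weighted sum of the indices. The product is y to the sum of the m
    i_m, which is W - s, minus the sum of the partial sums, which is -W modulo the prime by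
    [sum_psum]. This is y^(2W - s), and y^2 = z. *)
Lemma eps_prod i : (\prod_(m < p.+1 | (0 < m)%N) eps p.+1 e (Q *+ m + P *+ psum i m) (Q + P *+ i m))
    * y ^+ (\sum_l i l)%N = z ^+ (\sum_(l < p.+1) l.+1 * i l)%N.
Proof.
have y0 : y != 0 by rewrite expf_neq0.
have eE (m : 'I_p.+1) :
    eps p.+1 e (Q *+ m + P *+ psum i m) (Q + P *+ i m) * y ^+ psum i m = y ^+ (m * i m).
  by rewrite -[eps _ _ _ _]/(e _ _ ^+ h) /y (exprAC z h (psum i m)) -exprMn weil_basis exprAC.
have -> : \prod_(m < p.+1 | (0 < m)%N) eps p.+1 e (Q *+ m + P *+ psum i m) (Q + P *+ i m)
   = \prod_(m < p.+1) eps p.+1 e (Q *+ m + P *+ psum i m) (Q + P *+ i m).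
  rewrite big_mkcond; apply: eq_bigr => m _; case: posnP => // m0.
  have := eE m; rewrite m0 psum0 mul0n expr0 mulr1 => ->; by [].
have ys : y ^+ (\sum_(m < p.+1) psum i m)%N != 0 by rewrite expf_neq0.
apply: (mulIf ys); rewrite mulrAC -[y ^+ (\sum_(m < p.+1) psum i m)%N]prodrXr -big_split /=.
rewrite (eq_bigr _ (fun m _ => eE m)) prodrXr prodrXr -exprD.
rewrite -y2 -exprM -exprD.
have e1 : (\sum_(l < p.+1) l * i l + \sum_l i l = \sum_(l < p.+1) l.+1 * i l)%N.
  by rewrite -big_split; apply: eq_bigr => l _; rewrite mulSn addnC.
rewrite e1 mul2n -addnn -addnA [(\sum_(l < p.+1) l.+1 * i l + \sum_(m < p.+1) psum i m)%N]addnC.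
by rewrite sum_psum exprD mulnC [y ^+ (_ * p.+1)]exprM exprAC yp expr1n mulr1.
Qed.

Let term i T := (\prod_(m < p.+1 | (0 < m)%N) kappa p.+1 e rho P Q m (psum i m) (i m))
     * delta (Q *+ p.+1 + P *+ psum i p.+1) T.

Lemma termE i T : y ^+ (\sum_l i l)%N * term i T =
  z ^+ (\sum_(l < p.+1) l.+1 * i l)%N * rho_prod i * delta (P *+ (\sum_l i l)%N) T.
Proof.
rewrite /term /kappa big_split /= -/(rho_prod i) Qp add0r psum_full -(eps_prod i).
by ring.
Qed.

(** Each weight drops by one, except that the first entry moves to the end and receives weight
    [p.+1]. *)
Lemma cshift_weight i : (\sum_(l < p.+1) l.+1 * cshift i l + \sum_l i l =
   \sum_(l < p.+1) l.+1 * i l + p.+1 * i ord0)%N.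
Proof.
rewrite big_ord_recr [X in (_ + X)%N]big_ord_recl [X in (_ = X + _)%N]big_ord_recl /=.
have eS (l : 'I_p) : cshift i (widen_ord (leqnSn p) l) = i (lift ord0 l).
  rewrite ffunE; congr (i _); apply: ord_inj => /=.
  by rewrite /bump /= add1n modn_small // ltnS.
have e0 : cshift i ord_max = i ord0.
  by rewrite ffunE; congr (i _); apply: ord_inj; rewrite /= modnn.
have -> : (\sum_(l < p) l.+1 * cshift i (widen_ord (leqnSn p) l)
  = \sum_(l < p) l.+1 * i (lift ord0 l))%N.
  by apply: eq_bigr => l _; rewrite eS.
rewrite e0.
have -> : (\sum_(l < p) (bump 0 l).+1 * i (lift ord0 l)
   = \sum_(l < p) l.+1 * i (lift ord0 l) + \sum_(l < p) i (lift ord0 l))%N.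
  by rewrite -big_split; apply: eq_bigr => l _; rewrite /bump /= add1n mulSn addnC.
by rewrite mul1n; ring.
Qed.

Lemma sum_nontrivial T :
  \sum_(i : {ffun 'I_p.+1 -> 'I_p.+1} | ~~ (p.+1 %| \sum_l i l)%N) term i T = 0.
Proof.
set S := LHS; have y0 : y != 0 by rewrite expf_neq0.
(* Where the indicator is non-zero, T = sP and z^s = e(Q,T). The shift factor thus depends on T
   alone, and all s are treated at once. *)
have pickT i : z ^+ (\sum_l i l)%N * term i T = e Q T * term i T.
  rewrite /term Qp add0r psum_full /delta; case: eqP => [->|_]; last by rewrite !mulr0.
  by rewrite weil_mulr.
have shift i : z ^+ (\sum_l i l)%N * term (cshift i) T = term i T.
  have es : (\sum_l cshift i l = \sum_l i l)%N by rewrite sum_cshift.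
  have ys : y ^+ (\sum_l i l)%N != 0 by rewrite expf_neq0.
  apply: (mulfI ys); rewrite mulrCA -{2}es !termE es.
  have -> : rho_prod (cshift i) = rho_prod i.
    rewrite !rho_prodE es; congr (_ / _).
    by rewrite [RHS](reindex_inj (@ordS_inj p.+1)); apply: eq_bigr => l _; rewrite ffunE.
  rewrite !mulrA -exprD addnC cshift_weight exprD mulnC exprM exprAC (root Qp Pp) expr1n mulr1.
  by [].
(* If e(Q,T) = 1, then T = sP would make z^s = 1 and the prime divide s, so every term vanishes at
   T. *)
have [eT|eT] := eqVneq (e Q T) 1.
  rewrite /S big1 // => i nd; rewrite /term Qp add0r psum_full /delta.
  case: eqP => [TE|_]; last by rewrite mulr0.
  by move: nd; rewrite (weil_primitive (s := \sum_l i l)) // -eT TE weil_mulr.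
have eS : e Q T * S = S.
  rewrite [in LHS]/S (reindex_inj (@cshift_inj p)) /= mulr_sumr.
  apply: eq_big => [i|i _]; first by rewrite sum_cshift.
  by rewrite -pickT sum_cshift shift.
apply/eqP; move/eqP: eS; rewrite -subr_eq0 -{2}[S]mul1r -mulrBl mulf_eq0 subr_eq0 (negPf eT).
by [].
Qed.

Lemma star_powS_Delta T : T *+ p.+1 = 0 ->
  star_powS p.+1 e rho (Delta p.+1 P Q) p T =
  \sum_(i : {ffun 'I_p.+1 -> 'I_p.+1} | (p.+1 %| \sum_l i l)%N)
     z ^+ (\sum_(l < p.+1) l.+1 * i l)%N * rho_prod i * delta 0 T.
Proof.
move=> Tp; rewrite (star_powS_expand (ltn0Sn p)) //.
rewrite (bigID (fun i : {ffun 'I_p.+1 -> 'I_p.+1} => p.+1 %| \sum_l i l)%N) /=.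
rewrite [X in _ + X]sum_nontrivial addr0; apply: eq_bigr => i /dvdnP [q eq_q].
have ys : y ^+ (\sum_l i l)%N = 1.
  by rewrite eq_q mulnC exprM yp expr1n.
have := termE i T; rewrite ys mul1r /term => ->; congr (_ * delta _ _).
by rewrite eq_q mulnC mulrnA Pp mul0rn.
Qed.

End StarPower.

(** * Base change to the algebraic closure, and the formula for the star power *)

Lemma discriminant_map (F F' : fieldType) (f : {rmorphism F -> F'}) (E : weierstrass F) :
  discriminant (map_curve f E) = f (discriminant E).
Proof.
by rewrite /discriminant /=; ring.
Qed.

Lemma elliptic_map (F F' : fieldType) (f : {rmorphism F -> F'}) (E : weierstrass F) :
  elliptic (map_curve f E) = elliptic E.
Proof. by rewrite /elliptic discriminant_map fmorph_eq0. Qed.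

Lemma map_add_coords (F F' : fieldType) (f : {rmorphism F -> F'}) (E : weierstrass F) S T :
  map_coords f (add_coords E S T) = add_coords (map_curve f E) (map_coords f S) (map_coords f T).
Proof.
case: S T => [[x1 y1]|] [[x2 y2]|] //=.
have e1 : (f x1 == f x2) = (x1 == x2) by rewrite (inj_eq (fmorph_inj f)).
have e2 : (f y2 == - f y1 - f (a1 E) * f x1 - f (a3 E)) = (y2 == - y1 - a1 E * x1 - a3 E).
  by rewrite -(inj_eq (fmorph_inj f)) !(rmorphB, rmorphN, rmorphM).
rewrite e1 e2; case: ifP => //= _.
by case: (x1 == x2); rewrite !(rmorph_nat, rmorphXn, fmorphV, rmorphM, rmorphD, rmorphN).
Qed.

Lemma map_point_mul (F F' : fieldType) (f : {rmorphism F -> F'}) (E : weierstrass F) n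
    (T : point E) : map_point f (n * T)%EC = (n * map_point f T)%EC.
Proof.
elim: n => [|n IHn]; apply: val_inj => //=.
by rewrite map_add_coords; congr add_coords; apply: (congr1 (@coords _ _) IHn).
Qed.

Theorem theorem3p10
  (k : fieldExtType rat) (E0 : weierstrass k) (hE : elliptic E0)
  (p : nat) (p_prime : prime p) (p_odd : odd p)
  (v : k -> int) (hv : discrete_valuation v)
  (kv : fieldType) (vhat : kv -> int) (iota : {rmorphism k -> kv})
  (hkv : is_completion v vhat iota)
  (K : fieldExtType kv)
  (L : fieldType) (j : {rmorphism K -> L}) (hL : is_algebraic_closure j)
  (E := map_curve (in_alg K) (map_curve iota E0) : weierstrass K)
  (EL := map_curve j E : weierstrass L)
  (e : point EL -> point EL -> L) (he : weil_pairing p e)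
  (PK : point E) (hP : torsion p PK) (P := map_point j PK : point EL)
  (Q : point EL) (hQ : torsion p Q) (hPQ : generate_torsion p P Q)
  (xi : absgal j -> point EL) (hxi : cocycle p xi)
  (alpha : point EL -> L) (halpha : unit_R p alpha)
  (rho : point EL -> point EL -> L) (hrho : unit_RR p rho)
  (hcompat : compatible_representatives p e xi alpha rho) :
  forall T : point EL, torsion p T ->
    star_powS p e rho (Delta p P Q) p.-1 T
    = \sum_(i : {ffun 'I_p -> 'I_p} | (p %| \sum_(l < p) i l)%N)
        e Q P ^+ (\sum_(l < p) l.+1 * i l)%N
        * (\prod_(m < p | (0 < m)%N)
             rho (m * Q + (\sum_(l < p | (l < m)%N) i l)%N * P)%EC
                 (Q + i m * P)%EC)
        * delta (pzero EL) T.
Proof.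
(* Characteristic 0 is carried from the rationals through k, its completion and K up to L. *)
have char0 (F F' : fieldType) (f : {rmorphism F -> F'}) :
    (forall n, n.+1%:R != 0 :> F) -> forall n, n.+1%:R != 0 :> F'.
  by move=> h n; rewrite -(rmorph_nat f) fmorph_eq0.
have good : good_curve EL.
  split; first by case: hL.
    apply: (char0 _ _ j); apply: (char0 _ _ (in_alg K)); apply: (char0 _ _ iota).
    by apply: (char0 _ _ (in_alg k)) => n; rewrite Num.Theory.pnatr_eq0.
  by rewrite /EL /E !elliptic_map.
(* [point EG] is convertible to [point EL], so the points of the statement acquire the group
   structure. *)
pose EG := ECurve good.
have tors (n : nat) (X : point EG) : torsion n X = (X *+ n == 0) := torsionE n X.
case: p p_prime p_odd he hP hQ hPQ hxi halpha hrho hcompat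
  => // p' p_pr p_od he' hP' hQ' hPQ' _ _ _ hc T.
have Pp : (P : point EG) *+ p'.+1 = 0.
  apply/eqP; rewrite -tors /torsion -map_point_mul (eqP hP').
  by apply/eqP; apply: val_inj.
have Qp : (Q : point EG) *+ p'.+1 = 0 by apply/eqP; rewrite -tors.
have [gamma [g0 _ _ _ gr]] := hc.
rewrite tors => /eqP Tp.
have gamma0 (X : point EG) : X *+ p'.+1 = 0 -> gamma X != 0.
  by move=> h; apply: g0; have := tors p'.+1 X; rewrite h eqxx.
have rhoE (S X : point EG) : S *+ p'.+1 = 0 -> X *+ p'.+1 = 0 ->
    rho S X = gamma S * gamma X / gamma (S + X).
  move=> hS hX; rewrite -gr //.
    by have := tors p'.+1 S; rewrite hS eqxx.
  by have := tors p'.+1 X; rewrite hX eqxx.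
rewrite (star_powS_Delta (E := EG) p_pr p_od he' Pp Qp hPQ' gamma0 rhoE Tp).
apply: eq_bigr => i _; congr (_ * _ * _); apply: eq_bigr => m _.
by rewrite -!(pmulE (E := EG)).
Qed.
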